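(* Let $\mathfrak{n}=\prod_{i=1}^s\mathfrak{p}_i^{r_i}\in A_+$ with $s\ge1$, distinct primes $\mathfrak{p}_i$ and $r_i\ge1$. Then the exponent of the rational cuspidal divisor class group $\mathcal{C}(\mathfrak{n})$ of $X_0(\mathfrak{n})$ divides $$\prod_{i=1}^s(|\mathfrak{p}_i|^2-1)\,|\mathfrak{p}_i|^{r_i-1}.$$
   Context: $\mathbb{F}_q$ is a finite field with $q$ elements, $A=\mathbb{F}_q[T]$, $K=\mathbb{F}_q(T)$, $A_+$ the monic polynomials, primes are monic irreducible polynomials, $|\mathfrak{a}|=q^{\deg\mathfrak{a}}$. $\mathbb{C}_\infty$ is the completion of an algebraic closure of $\mathbb{F}_q((1/T))$, $\Omega=\mathbb{C}_\infty-\mathbb{F}_q((1/T))$. $\Gamma_0(\mathfrak{n})\subset\operatorname{GL}_2(A)$ is the group of matrices with lower-left entry divisible by $\mathfrak{n}$, and $X_0(\mathfrak{n})$ is the Drinfeld modular curve with $\mathbb{C}_\infty$-points $\Gamma_0(\mathfrak{n})\backslash(\Omega\cup\mathbb{P}^1(K))$. Cusps correspond to $\Gamma_0(\mathfrak{n})\backslash\mathbb{P}^1(K)$; each has a representative $(a:d)$ with $a,d\in A_+$, $d\mid\mathfrak{n}$, $\gcd(a,\mathfrak{n})=1$, and $d$ (the height) is independent of the choice. $(P(\mathfrak{n})_d)$ is the sum of all cusps of height $d$. A modular unit on $X_0(\mathfrak{n})$ is a modular function on $X_0(\mathfrak{n})$ (a rigid-analytic meromorphic $\Gamma_0(\mathfrak{n})$-invariant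 function on $\Omega$, meromorphic at the cusps) with no zeros or poles on $\Omega$. $\operatorname{Div}^0_{\mathrm{cusp}}(X_0(\mathfrak{n}))(K)$ is the group of divisors $\sum_{d\mid\mathfrak{n},\,d\in A_+}a_d(P(\mathfrak{n})_d)$ with $a_d\in\mathbb{Z}$ and degree $0$, and $\mathcal{C}(\mathfrak{n})$ is its quotient by the subgroup of divisors of modular units on $X_0(\mathfrak{n})$. *)

(* Defs.v *)
From HB Require Import structures.
From mathcomp Require Import all_boot all_order all_algebra.
From mathcomp Require Import all_classical reals.

Set Implicit Arguments.
Unset Strict Implicit.
Unset Printing Implicit Defensive.

Import Order.TTheory GRing.Theory Num.Theory.
Local Open Scope classical_set_scope.
Local Open Scope ring_scope.

Local Notation ratK Fq := {fraction {poly Fq}}.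

Definition anorm (Fq : finFieldType) (p : {poly Fq}) : nat :=
  (#|Fq| ^ (size p).-1)%N.

Section AbsoluteValue.
Variables (R : realType) (F : fieldType) (v : F -> R).

Definition vcvg (u : nat -> F) (l : F) : Prop :=
  forall e : R, 0 < e -> exists N, forall k, (N <= k)%N -> v (u k - l) < e.

Definition vcauchy (u : nat -> F) : Prop :=
  forall e : R, 0 < e ->
  exists N, forall j k, (N <= j)%N -> (N <= k)%N -> v (u j - u k) < e.

Definition vlim (u : nat -> F) : F := xget 0 [set l | vcvg u l].

Definition vclosure (S : set F) : set F :=
  [set z | forall e : R, 0 < e -> exists2 x, S x & v (z - x) < e].

Definition algebraic_elt_over (S : set F) (z : F) : Prop :=
  exists p : {poly F}, [/\ p != 0, (forall i, S p`_i) & root p z].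

End AbsoluteValue.

(* C_oo, axiomatized up to isometric isomorphism of extensions of K: an
   algebraically closed field, complete for a non-archimedean absolute value
   that restricts on K = Fq(T) to the one with |a| = q ^ deg a, in which the
   elements algebraic over the closure of K are dense. By completeness the
   closure of K is the completion Fq((1/T)), so the algebraic elements form an
   algebraic closure of Fq((1/T)), and C_oo is the completion of the latter. *)
Record Cinfty (Fq : finFieldType) (R : realType) := MkCinfty {
  Csort :> closedFieldType;
  Cabs : Csort -> R;
  Cemb : {rmorphism ratK Fq -> Csort};
  Cabs_ge0 : forall x, 0 <= Cabs x;
  Cabs_eq0 : forall x, Cabs x = 0 <-> x = 0;
  CabsM : forall x y, Cabs (x * y) = Cabs x * Cabs y;
  Cabs_ultra : forall x y, Cabs (x + y) <= Num.max (Cabs x) (Cabs y);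
  Cabs_emb : forall p : {poly Fq}, p != 0 ->
    Cabs (Cemb (tofrac p)) = (anorm p)%:R;
  Cabs_complete : forall u : nat -> Csort,
    vcauchy Cabs u -> exists l, vcvg Cabs u l;
  Calg_dense :
    vclosure Cabs (algebraic_elt_over (vclosure Cabs (range Cemb))) = setT
}.

Section Level.
Variable (Fq : finFieldType).
Implicit Types (n d : {poly Fq}) (g : 'M[{poly Fq}]_2).

Definition Gamma0 n g : bool := (g \in unitmx) && (n %| g 1 0).

Definition affmx (a b : {poly Fq}) : 'M[{poly Fq}]_2 :=
  \matrix_(i < 2, j < 2)
    if i == 0 then (if j == 0 then a else b) else (j == 1)%:R.

(* For g in GL_2(A), whether z |-> e * z + b belongs to the stabilizer of oo
   in the image of g^-1 Gamma0(n) g in PGL_2. Scalar matrices lie in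
   Gamma0(n), so the lower right entry may be taken to be 1. *)
Definition cusp_stab n g (e : Fq) (b : {poly Fq}) : bool :=
  Gamma0 n (g *m affmx e%:P b *m invmx g).

(* The number of linear parts e of the above stabilizer. A uniformizer of
   X_0(n) at the cusp g(oo) has order cusp_weight n g in the parameter t
   associated with the translations b (e = 1). *)
Definition cusp_weight n g : nat :=
  #|[pred e : Fq | `[< exists b, cusp_stab n g e b >]]|.

(* A cusp is a Gamma0(n)-orbit on P^1(K), represented as the set of all the
   nonzero vectors of K^2 lying on the lines of this orbit. *)
Definition ptP1 (x y : ratK Fq) : 'cV[ratK Fq]_2 :=
  \col_(i < 2) if i == 0 then x else y.

Definition cusp_orbit n (u : 'cV[ratK Fq]_2) : set 'cV[ratK Fq]_2 :=
  [set w | exists g (c : ratK Fq),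
     [/\ Gamma0 n g, c != 0 & w = c *: (map_mx (@tofrac _) g *m u)]].

Definition cusps n : set (set 'cV[ratK Fq]_2) :=
  [set cusp_orbit n u | u in [set u | u != 0]].

Definition has_height n (c : set 'cV[ratK Fq]_2) d : Prop :=
  exists a : {poly Fq},
    [/\ a \is monic, coprimep a n & c (ptP1 (tofrac a) (tofrac d))].

(* Divisors supported on the cusps of X_0(n) are functions on cusps,
   extended by 0 to all sets of vectors. *)
Definition cuspdiv := set 'cV[ratK Fq]_2 -> int.

Definition cuspP n d : cuspdiv :=
  fun c => if `[< cusps n c /\ has_height n c d >] then 1 else 0.

Definition cuspdeg n (D : cuspdiv) : int := \sum_(c \in cusps n) D c.

Definition monic_divisors n : set {poly Fq} :=
  [set d | d \is monic /\ (d %| n)].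

Definition Div0cuspK n : set cuspdiv :=
  [set D | (exists a : {poly Fq} -> int,
             D = fun c => \sum_(d \in monic_divisors n) a d * cuspP n d c)
           /\ cuspdeg n D = 0].

End Level.

Section DrinfeldModular.
Variables (Fq : finFieldType) (R : realType) (C : Cinfty Fq R).
Local Notation A := {poly Fq}.
Local Notation K := (ratK Fq).
Local Notation q := (#|Fq|%:R : R).
Implicit Types (n : A) (g : 'M[A]_2) (z : C).

Definition iA (a : A) : C := Cemb C (tofrac a).

Definition Kinfty : set C := vclosure (@Cabs _ _ C) (range (Cemb C)).

Definition Omega : set C := ~` Kinfty.

(* |z|_i >= r, where |z|_i = inf_{x in Kinfty} |z - x|. *)
Definition imag_ge (r : R) (z : C) : Prop :=
  forall x, Kinfty x -> r <= Cabs (z - x).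

(* The standard admissible covering of Omega by the connected affinoids
   |z| <= q^m, |z|_i >= q^-m. *)
Definition Omega_ (m : nat) : set C :=
  [set z | Cabs z <= q ^+ m /\ imag_ge (q ^- m) z].

(* Rigid analytic functions on Omega_ m: uniform limits of rational functions
   without poles on Omega_ m. *)
Definition holo_on (m : nat) (h : C -> C) : Prop :=
  forall e : R, 0 < e -> exists P Q : {poly C},
    forall z, Omega_ m z -> Q.[z] != 0 /\ Cabs (h z - P.[z] / Q.[z]) < e.

(* Meromorphic functions are viewed as functions to P^1, with None for oo.
   The ring of analytic functions on Omega_ m is a principal ideal domain,
   so a meromorphic function on Omega_ m is a quotient of two analytic functions
   without common zeros. *)
Definition mero (f : C -> option C) : Prop :=
  forall m, exists h k : C -> C,
    [/\ holo_on m h, holo_on m k,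
        (exists2 z, Omega_ m z & k z != 0),
        (forall z, Omega_ m z -> h z != 0 \/ k z != 0)
      & forall z, Omega_ m z ->
          f z = if k z == 0 then None else Some (h z / k z)].

Definition mobius g z : C :=
  (iA (g 0 0) * z + iA (g 0 1)) / (iA (g 1 0) * z + iA (g 1 1)).

(* e_L(z) = z * prod_(b in L \ 0) (1 - z / b), for L the lattice of the b in A
   such that z |-> z + b is in g^-1 Gamma0(n) g; the product is taken over the
   b of degree < N, then N tends to infinity. *)
Definition exp_lattice n g z : C :=
  vlim (@Cabs _ _ C) (fun N =>
    z * \prod_(b : 'rV[Fq]_N | (rVpoly b != 0) && cusp_stab n g 1 (rVpoly b))
          (1 - z / iA (rVpoly b))).

Definition t_param n g z : C := (exp_lattice n g z)^-1.

(* f (g z) = sum_(j >= 0) a_j t^(m + j) when |z|_i is large enough. *)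
Definition t_expansion n (f : C -> option C) g (m : int) (a : nat -> C) : Prop :=
  exists2 r : R, 0 < r & forall z, imag_ge r z ->
    exists2 y, f (mobius g z) = Some y &
      vcvg (@Cabs _ _ C)
        (fun N => \sum_(j < N) a j * t_param n g z ^ (m + j%:Z)) y.

Definition maps_oo_to g (c : set 'cV[K]_2) : Prop :=
  g \in unitmx /\ c (ptP1 (tofrac (g 0 0)) (tofrac (g 1 0))).

Definition mero_at_cusp n (f : C -> option C) (c : set 'cV[K]_2) : Prop :=
  forall g, maps_oo_to g c -> exists m a, t_expansion n f g m a.

Definition cusp_order n (f : C -> option C) (c : set 'cV[K]_2) (k : int) : Prop :=
  exists g a, [/\ maps_oo_to g c, a 0%N != 0
                & t_expansion n f g (k * (cusp_weight n g)%:Z) a].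

Definition modular_function n (f : C -> option C) : Prop :=
  [/\ mero f,
      (forall g z, Gamma0 n g -> Omega z -> f (mobius g z) = f z)
    & forall c, cusps n c -> mero_at_cusp n f c].

Definition modular_unit n (f : C -> option C) : Prop :=
  modular_function n f /\
  forall z, Omega z -> f z <> None /\ f z <> Some 0.

Definition unit_divisor n (f : C -> option C) (D : cuspdiv Fq) : Prop :=
  forall c, if `[< cusps n c >] then cusp_order n f c (D c) else D c = 0.

Definition unit_divisors n : set (cuspdiv Fq) :=
  [set D | exists2 f, modular_unit n f & unit_divisor n f D].

End DrinfeldModular.

(* e is the exponent of the quotient G / H of two subgroups H <= G of V. *)
Definition quotient_exponent (V : zmodType) (G H : set V) (e : nat) : Prop :=
  [/\ (0 < e)%N,
      (forall x, G x -> H (x *+ e))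
    & forall m, (0 < m)%N -> (forall x, G x -> H (x *+ m)) -> (e <= m)%N].

(* Exponent of the rational cuspidal divisor class group C(n) of X_0(n). *)
Definition class_group_exponent (Fq : finFieldType) (R : realType)
    (C : Cinfty Fq R) (n : {poly Fq}) (e : nat) : Prop :=
  quotient_exponent (Div0cuspK n) (Div0cuspK n `&` unit_divisors C n) e.

(* Main.v *)
Require Import Defs.
From HB Require Import structures.
From mathcomp Require Import all_boot all_order all_algebra finfield.
From mathcomp Require pgroup abelian.
From mathcomp Require generic_quotient.
From mathcomp Require Import all_classical reals.
From mathcomp Require Import ring lra zify.

Set Implicit Arguments.
Unset Strict Implicit.
Unset Printing Implicit Defensive.

Import Order.TTheory GRing.Theory Num.Theory.
Local Open Scope classical_set_scope.
Local Open Scope ring_scope.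

(** For a monic [d] dividing [n], the units are products of the functions
    [z |-> h (d z)], where [1 / h z] is the Moore determinant of the values of the
    exponential of the lattice [A z + A] at the [T]-division points [z / T] and
    [1 / T] ([h] is, up to a constant, Gekeler's function with [h ^ (q - 1) = - Delta]).
    It has no zeros on the half plane, transforms under [GL_2(A)] with weight [q + 1]
    and type [1], and its order in the parameter at a cusp is computed from the
    product of the lattice exponential, grouped by the multiples of [z]. The matrix
    of these orders is a tensor product over the primes dividing [n] of matrices
    whose inverses are tridiagonal with denominator [(|p| ^ 2 - 1) |p| ^ (r - 1)];
    a divisor of degree [0] corresponds to a product of weight [0]. *)

(** * Ultrametric limits *)

(** With Delta in place of h every order would be multiplied by [q - 1], and so would the bound on
    the exponent. Invariance of a product of powers h(d z) ^ rho(d) requires the automorphy factor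
    and the determinant to cancel. Both occur with the same exponent for every d, so the single
    equation sum rho = 0 suffices. It follows from degree 0: up to the constant product of the |p| -
    1, the column sums of the integral inverse matrix are the values of [phi] at the cusp moduli,
    and [phi] times [cusp_weight] over [q - 1] counts the cusps of a given height. A second obstacle
    comes from the definition of the exponent. [cusp_order] asks for an expansion at one matrix per
    cusp, so the orders of two arbitrary units cannot be added at once. The units constructed here
    have a known order at every matrix, and such a unit can be combined with an arbitrary one. This
    is enough to show that the remainder of the bound modulo the exponent also kills the class
    group, hence is 0. *)

Section Ultrametric.
Variables (Fq : finFieldType) (R : realType) (C : Cinfty Fq R).
Local Notation v := (@Cabs Fq R C).
Implicit Types (x y z l : C) (u : nat -> C).

Lemma abs0 : v 0 = 0. Proof. by apply/Cabs_eq0. Qed.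

Lemma abs_eq0 x : (v x == 0) = (x == 0).
Proof. by apply/eqP/eqP => /Cabs_eq0. Qed.

Lemma abs_gt0 x : (0 < v x) = (x != 0).
Proof. by rewrite lt0r Cabs_ge0 abs_eq0 andbT. Qed.

Lemma abs1 : v 1 = 1.
Proof.
have h : v 1 * v 1 = v 1 by rewrite -CabsM mulr1.
by apply: (@mulfI _ (v 1)); rewrite ?abs_eq0 ?oner_eq0 // mulr1.
Qed.

Lemma absX x k : v (x ^+ k) = v x ^+ k.
Proof. by elim: k => [|k IH]; rewrite ?expr0 ?abs1 // !exprS CabsM IH. Qed.

Lemma absN x : v (- x) = v x.
Proof.
have : v (-1) ^+ 2 = 1 by rewrite -absX sqrrN expr1n abs1.
move/eqP; rewrite sqrf_eq1 => /orP[/eqP h|/eqP h].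
  by rewrite -mulN1r CabsM h mul1r.
by have := Cabs_ge0 (-1 : C); rewrite h lerNr oppr0 ler10.
Qed.

Lemma absV x : v x^-1 = (v x)^-1.
Proof.
have [->|x0] := eqVneq x 0; first by rewrite invr0 abs0 invr0.
apply: (@mulfI _ (v x)); first by rewrite abs_eq0.
by rewrite -CabsM !mulfV ?abs1 ?abs_eq0.
Qed.

Lemma abs_div x y : v (x / y) = v x / v y.
Proof. by rewrite CabsM absV. Qed.

Lemma abs_subC x y : v (x - y) = v (y - x).
Proof. by rewrite -absN opprB. Qed.

Lemma absD_le (B : R) x y : v x <= B -> v y <= B -> v (x + y) <= B.
Proof. by move=> hx hy; apply: le_trans (Cabs_ultra _ _) _; rewrite ge_max hx. Qed.

Lemma absD_lt (B : R) x y : v x < B -> v y < B -> v (x + y) < B.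
Proof. by move=> hx hy; apply: le_lt_trans (Cabs_ultra _ _) _; rewrite gt_max hx. Qed.

Lemma absB_le (B : R) x y : v x <= B -> v y <= B -> v (x - y) <= B.
Proof. by move=> hx hy; apply: absD_le; rewrite ?absN. Qed.

Lemma absB_lt (B : R) x y : v x < B -> v y < B -> v (x - y) < B.
Proof. by move=> hx hy; apply: absD_lt; rewrite ?absN. Qed.

Lemma abs_chain (B : R) x y z : v (x - y) <= B -> v (y - z) <= B -> v (x - z) <= B.
Proof. by move=> h1 h2; rewrite -(subrKA y); apply: absD_le. Qed.

Lemma abs_chain_lt (B : R) x y z : v (x - y) < B -> v (y - z) < B -> v (x - z) < B.
Proof. by move=> h1 h2; rewrite -(subrKA y); apply: absD_lt. Qed.

Lemma absD_eql x y : v y < v x -> v (x + y) = v x.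
Proof.
move=> h; apply/eqP; rewrite eq_le absD_le //= ?(ltW h) // leNgt.
apply/negP => h2; have : v x < v x by rewrite -{1}(addrK y x); apply: absB_lt.
by rewrite ltxx.
Qed.

Lemma absD_eqr x y : v x < v y -> v (x + y) = v y.
Proof. by move=> h; rewrite addrC absD_eql. Qed.

Lemma absB_eql x y : v y < v x -> v (x - y) = v x.
Proof. by move=> h; rewrite absD_eql ?absN. Qed.

Lemma abs_eq_close x y : v (x - y) < v x -> v y = v x.
Proof. by move=> h; rewrite -[y](subKr x) absB_eql. Qed.

Lemma abs_sum_le I (s : seq I) (P : pred I) (F : I -> C) (B : R) :
  0 <= B -> (forall i, P i -> v (F i) <= B) -> v (\sum_(i <- s | P i) F i) <= B.
Proof.
move=> B0 h; elim/big_ind : _ => //; first by rewrite abs0.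
by move=> *; apply: absD_le.
Qed.

Lemma abs_prod I (s : seq I) (P : pred I) (F : I -> C) :
  v (\prod_(i <- s | P i) F i) = \prod_(i <- s | P i) v (F i).
Proof. by apply: (big_morph v); [move=> x y; rewrite CabsM | rewrite abs1]. Qed.

Lemma vcvg_unique u l l' : vcvg v u l -> vcvg v u l' -> l = l'.
Proof.
move=> h h'; apply/eqP; rewrite -subr_eq0 -abs_eq0; apply: contraT => n0.
have e0 : 0 < v (l - l') by rewrite lt0r n0 Cabs_ge0.
have [N hN] := h _ e0; have [N' hN'] := h' _ e0.
have := abs_chain_lt (x := l) (y := u (maxn N N')) (z := l') (B := v (l - l')).
rewrite ltxx; apply; first by rewrite abs_subC hN ?leq_maxl.
by rewrite hN' ?leq_maxr.
Qed.

Lemma vlimE u l : vcvg v u l -> vlim v u = l.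
Proof.
move=> h; rewrite /vlim; case: xgetP => [l' _ h'|nh].
  exact: vcvg_unique h' h.
by case: (nh l).
Qed.

Lemma vcvg_cst l : vcvg v (fun=> l) l.
Proof. by move=> e e0; exists 0%N => k _; rewrite subrr abs0. Qed.

Lemma vcvg_ext u u' l : u =1 u' -> vcvg v u l -> vcvg v u' l.
Proof. by move=> h hu e /hu[N hN]; exists N => k /hN; rewrite h. Qed.

Lemma vcvg_near N u u' l :
  (forall k, (N <= k)%N -> u k = u' k) -> vcvg v u l -> vcvg v u' l.
Proof.
move=> h hu e /hu[M hM]; exists (maxn N M) => k; rewrite geq_max => /andP[h1 h2].
by rewrite -h // hM.
Qed.

Lemma vcvg_shift k u l : vcvg v u l -> vcvg v (fun n => u (n + k)%N) l.
Proof.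
by move=> h e /h[N hN]; exists N => n hn; apply/hN/(leq_trans hn)/leq_addr.
Qed.

Lemma vcvgD u u' l l' :
  vcvg v u l -> vcvg v u' l' -> vcvg v (fun n => u n + u' n) (l + l').
Proof.
move=> h h' e e0; have [N hN] := h _ e0; have [N' hN'] := h' _ e0.
exists (maxn N N') => k; rewrite geq_max => /andP[/hN h1 /hN' h2].
by rewrite opprD addrACA; apply: absD_lt.
Qed.

Lemma vcvgN u l : vcvg v u l -> vcvg v (fun n => - u n) (- l).
Proof. by move=> h e /h[N hN]; exists N => k /hN; rewrite -opprD absN. Qed.

Lemma vcvgB u u' l l' :
  vcvg v u l -> vcvg v u' l' -> vcvg v (fun n => u n - u' n) (l - l').
Proof. by move=> h /vcvgN; apply: vcvgD. Qed.

Lemma vcvg_le N u l x (B : R) :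
  vcvg v u l -> (forall k, (N <= k)%N -> v (u k - x) <= B) -> v (l - x) <= B.
Proof.
move=> h hB; rewrite leNgt; apply/negP => lt.
have p : 0 < v (l - x).
  by apply: le_lt_trans lt; apply: le_trans (hB N _); rewrite ?Cabs_ge0.
have [M hM] := h _ p.
suff : v (l - x) < v (l - x) by rewrite ltxx.
apply: (abs_chain_lt (y := u (maxn N M))); first by rewrite abs_subC hM ?leq_maxr.
by apply: le_lt_trans lt; apply: hB; rewrite leq_maxl.
Qed.

Lemma vcvg_abs_le N u l (B : R) :
  vcvg v u l -> (forall k, (N <= k)%N -> v (u k) <= B) -> v l <= B.
Proof.
move=> h hB; rewrite -[l]subr0; apply: (vcvg_le (N := N) h) => k /hB.
by rewrite subr0.
Qed.

(** A term with [v (u k - l) < B <= v (u k)] already has the absolute value of the limit. *)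
Lemma vcvg_abs_ge N u l (B : R) : 0 < B ->
  vcvg v u l -> (forall k, (N <= k)%N -> B <= v (u k)) -> B <= v l.
Proof.
move=> B0 h hB; have [M hM] := h _ B0.
have h1 := hB (maxn N M) (leq_maxl _ _); have h2 := hM (maxn N M) (leq_maxr _ _).
by rewrite (abs_eq_close (x := u (maxn N M))) //; apply: lt_le_trans h1.
Qed.

Lemma vcvg_bound u l : vcvg v u l -> exists2 B : R, 0 < B & forall k, v (u k) <= B.
Proof.
move=> h; have [N hN] := h 1 ltr01.
have [B B0 hB] : exists2 B : R, 0 < B & forall k, (k < N)%N -> v (u k) <= B.
  elim: N {hN} => [|N [B B0 hB]]; first by exists 1.
  exists (Num.max B (v (u N))); first by rewrite lt_max B0.
  by move=> k; rewrite ltnS leq_eqVlt => /orP[/eqP->|/hB h'];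
    rewrite le_max ?lexx ?orbT ?h'.
exists (Num.max B (Num.max 1 (v l))); first by rewrite lt_max B0.
move=> k; have [/hN h1|/hB h1] := leqP N k; last by rewrite le_max h1.
rewrite le_max; apply/orP; right; rewrite -[u k](subrK l).
by apply: absD_le; rewrite le_max ?lexx ?orbT // ltW.
Qed.

Lemma vcvgM u u' l l' :
  vcvg v u l -> vcvg v u' l' -> vcvg v (fun n => u n * u' n) (l * l').
Proof.
move=> h h' e e0; have [B B0 hB] := vcvg_bound h'.
pose B' := Num.max 1 (v l); have B'0 : 0 < B' by rewrite lt_max ltr01.
have [N hN] := h (e / B) (divr_gt0 e0 B0); have [N' hN'] := h' (e / B') (divr_gt0 e0 B'0).
exists (maxn N N') => k; rewrite geq_max => /andP[/hN h1 /hN' h2].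
have -> : u k * u' k - l * l' = (u k - l) * u' k + l * (u' k - l').
  by rewrite mulrBl mulrBr subrKA.
apply: absD_lt; rewrite CabsM.
  apply: le_lt_trans (ler_wpM2l (Cabs_ge0 _) (hB _)) _.
  by rewrite -ltr_pdivlMr.
apply: le_lt_trans (_ : B' * v (u' k - l') < e).
  by rewrite ler_wpM2r ?Cabs_ge0 // le_max lexx orbT.
by rewrite mulrC -ltr_pdivlMr.
Qed.

Lemma vcvgZ c u l : vcvg v u l -> vcvg v (fun n => c * u n) (c * l).
Proof. exact/vcvgM/vcvg_cst. Qed.

Lemma vcvgX k u l : vcvg v u l -> vcvg v (fun n => u n ^+ k) (l ^+ k).
Proof.
move=> h; elim: k => [|k IH]; first exact: vcvg_cst.
by rewrite exprS; apply: vcvg_ext (vcvgM h IH) => n; rewrite exprS.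
Qed.

Lemma vcvg_prod I (s : seq I) (P : pred I) (F : nat -> I -> C) (L : I -> C) :
  (forall i, P i -> vcvg v (F^~ i) (L i)) ->
  vcvg v (fun n => \prod_(i <- s | P i) F n i) (\prod_(i <- s | P i) L i).
Proof.
move=> h; elim: s => [|i s IH].
  by rewrite big_nil; apply: vcvg_ext (vcvg_cst _) => n; rewrite big_nil.
rewrite big_cons; apply: vcvg_ext (_ : vcvg v (fun n => if P i then F n i *
  \prod_(i <- s | P i) F n i else \prod_(i <- s | P i) F n i) _).
  by move=> n; rewrite big_cons.
by case: ifP => // Pi; apply: vcvgM => //; apply: h.
Qed.

Lemma vcvgV u l : l != 0 -> vcvg v u l -> vcvg v (fun n => (u n)^-1) l^-1.
Proof.
move=> l0 h e e0; have vl : 0 < v l by rewrite abs_gt0.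
have [N hN] := h _ vl; have [M hM] := h (e * (v l * v l)) (mulr_gt0 e0 (mulr_gt0 vl vl)).
exists (maxn N M) => k; rewrite geq_max => /andP[/hN h1 /hM h2].
have E : v (u k) = v l by apply: abs_eq_close; rewrite abs_subC.
have uk0 : u k != 0 by rewrite -abs_gt0 E.
have -> : (u k)^-1 - l^-1 = (l - u k) / (u k * l) by field; rewrite l0.
by rewrite abs_div CabsM E abs_subC ltr_pdivrMr // mulr_gt0.
Qed.

Lemma vcvg_div u u' l l' : l' != 0 ->
  vcvg v u l -> vcvg v u' l' -> vcvg v (fun n => u n / u' n) (l / l').
Proof. by move=> l0 h /(vcvgV l0); apply: vcvgM. Qed.

(* Ultrametric Cauchy criterion: consecutive differences suffice. *)
Lemma vcvg_ex (eps : nat -> R) u :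
  (forall e, 0 < e -> exists N, forall k, (N <= k)%N -> eps k < e) ->
  (forall k, v (u k.+1 - u k) <= eps k) -> exists l, vcvg v u l.
Proof.
move=> heps h; apply: Cabs_complete => e e0; have [N hN] := heps _ e0.
have key k : v (u (N + k)%N - u N) < e.
  elim: k => [|k IH]; first by rewrite addn0 subrr abs0.
  apply: abs_chain_lt IH; rewrite addnS; apply: le_lt_trans (h _) _.
  by apply: hN; rewrite leq_addr.
exists N => j k /subnKC <- /subnKC <-.
by apply: (abs_chain_lt (y := u N)) => //; rewrite abs_subC.
Qed.

End Ultrametric.

(** * The embedding of [A] and Frobenius *)

HB.instance Definition _ (Fq : finFieldType) (R : realType) (C : Cinfty Fq R) :=
  GRing.RMorphism.copy (iA C) (Cemb C \o @tofrac {poly Fq}).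

Section Embedding.
Variables (Fq : finFieldType) (R : realType) (C : Cinfty Fq R).
Local Notation v := (@Cabs Fq R C).
Local Notation q := #|Fq|.
Implicit Types (x y z w : C) (a b c p : {poly Fq}).

Definition ic (e : Fq) : C := iA C e%:P.

HB.instance Definition _ := GRing.RMorphism.copy ic (iA C \o polyC).

Lemma q_gt1 : (1 < q)%N. Proof. exact: finNzRing_gt1. Qed.
Lemma q_gt0 : (0 < q)%N. Proof. exact: ltnW q_gt1. Qed.
Lemma qR_gt1 : 1 < q%:R :> R. Proof. by rewrite ltr1n q_gt1. Qed.
Lemma qR_gt0 : 0 < q%:R :> R. Proof. by rewrite ltr0n q_gt0. Qed.

Lemma iA_eq0 a : (iA C a == 0) = (a == 0).
Proof. by rewrite /iA fmorph_eq0 -tofrac0 tofrac_eq. Qed.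

Lemma abs_iA a : a != 0 -> v (iA C a) = q%:R ^+ (size a).-1.
Proof. by move=> a0; rewrite /iA Cabs_emb // /anorm natrX. Qed.

Lemma abs_iA_ge N a : (N < size a)%N -> q%:R ^+ N <= v (iA C a).
Proof.
move=> h; rewrite abs_iA -?size_poly_gt0 ?(leq_trans _ h) //.
by rewrite ler_eXn2l ?qR_gt1 // -ltnS prednK // (leq_trans _ h).
Qed.

Lemma abs_iA_ge1 a : a != 0 -> 1 <= v (iA C a).
Proof. by rewrite -size_poly_gt0 => /abs_iA_ge; rewrite expr0. Qed.

Lemma abs_ic e : e != 0 -> v (ic e) = 1.
Proof. by move=> e0; rewrite /ic abs_iA ?polyC_eq0 // size_polyC e0. Qed.

Lemma abs_ic_le e : v (ic e) <= 1.
Proof.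
by have [->|/abs_ic ->//] := eqVneq e 0; rewrite rmorph0 abs0 ler01.
Qed.

Lemma abs_iAX : v (iA C 'X) = q%:R.
Proof. by rewrite abs_iA ?polyX_eq0 // size_polyX. Qed.

Lemma iAX_neq0 : iA C 'X != 0. Proof. by rewrite iA_eq0 polyX_eq0. Qed.

Lemma exists_qN_lt (e : R) : 0 < e -> exists N, forall k, (N <= k)%N -> q%:R ^- k < e.
Proof.
move=> e0; pose N := Num.bound e^-1; exists N => k hk.
rewrite invf_plt ?posrE ?exprn_gt0 ?qR_gt0 //.
apply: lt_le_trans (archi_boundP _) _; first by rewrite invr_ge0 ltW.
rewrite -natrX ler_nat -/N; apply: leq_trans hk _.
exact/ltnW/ltn_expl/q_gt1.
Qed.

Lemma exists_qX_ge (B : R) : exists N, forall k, (N <= k)%N -> B <= q%:R ^+ k.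
Proof.
have B0 : 0 < Num.max 1 B by rewrite lt_max ltr01.
have [|N hN] := @exists_qN_lt (Num.max 1 B)^-1; first by rewrite invr_gt0.
exists N => k /hN; rewrite ltf_pV2 ?posrE ?exprn_gt0 ?qR_gt0 // => /ltW.
by apply: le_trans; rewrite le_max lexx orbT.
Qed.

(** [q] is a power of the characteristic of [Fq], which [ic] transports to [C]. *)
Lemma FrobeniusD x y : (x + y) ^+ q = x ^+ q + y ^+ q.
Proof.
have [p pr_p chp] := finPcharP Fq.
apply: exprDn_pchar; rewrite (eq_pnat _ (pcharf_eq (rmorph_pchar ic chp))).
by have := abelian.abelem_pgroup (abelian.fin_ring_pchar_abelem chp);
  rewrite /pgroup.pgroup cardsT.
Qed.

Lemma icXq e : ic e ^+ q = ic e.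
Proof. by rewrite -rmorphXn /= expf_card. Qed.

Lemma FrobeniusN x : (- x) ^+ q = - x ^+ q.
Proof.
apply/eqP; rewrite -addr_eq0 -FrobeniusD addNr expr0n.
by rewrite -leqn0 leqNgt q_gt0.
Qed.

Lemma FrobeniusB x y : (x - y) ^+ q = x ^+ q - y ^+ q.
Proof. by rewrite FrobeniusD FrobeniusN. Qed.

(** Homogeneous form of the factorization of X^q - X over [Fq]: substitute x / y and clear
    denominators. *)
Lemma prod_sub_ic x y : \prod_(e : Fq) (x - ic e * y) = x ^+ q - y ^+ q.-1 * x.
Proof.
have [->|y0] := eqVneq y 0.
  rewrite (eq_bigr (fun=> x)) => [|e _]; last by rewrite mulr0 subr0.
  rewrite prodr_const expr0n; case E: q.-1 => [|k] /=; last by rewrite mul0r subr0.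
  by have := q_gt1; rewrite -[q]prednK ?q_gt0 // E.
have := congr1 (fun P => (map_poly ic P).[x / y]) (finField_genPoly Fq).
rewrite rmorphB /= map_polyXn map_polyX !hornerE rmorph_prod /= horner_prod.
under [X in _ = X -> _]eq_bigr do
  rewrite rmorphB /= map_polyX map_polyC hornerXsubC.
move=> h; rewrite (eq_bigr (fun e => y * (x / y - ic e))) => [|e _]; last first.
  by rewrite mulrBr mulrCA mulfV // mulr1 [y * _]mulrC.
rewrite big_split /= -h prodr_const cardT /= -cardE mulrBr -exprMn.
rewrite [y * _]mulrC divfK //; congr (_ - _).
by rewrite -{1}[q]prednK ?q_gt0 // exprSr -mulrA [y * _]mulrC divfK.
Qed.

(* At [e = 0] the factor is [1 - w / 0 = 1]. *)
Lemma prod_sub_div_ic w y :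
  \prod_(e : Fq) (1 - w / (ic e * y)) = 1 - (w / y) ^+ q.-1.
Proof.
have := prod_sub_ic 1 (w / y); rewrite expr1n mulr1 => <-.
rewrite (reindex_inj invr_inj) /=; apply: eq_bigr => e _.
by rewrite fmorphV invfM invrK mulrCA mulrA.
Qed.

(** Enumerated through row vectors, as in [exp_lattice], so that the products there become products
    over this list. *)
Definition polyN N : seq {poly Fq} := [seq rVpoly u | u <- enum {: 'rV[Fq]_N}].

Lemma mem_polyN N p : (p \in polyN N) = (size p <= N)%N.
Proof.
apply/mapP/idP => [[b _ ->]|h]; first exact: size_poly.
by exists (poly_rV p); rewrite ?mem_enum // poly_rV_K.
Qed.

Lemma polyN_uniq N : uniq (polyN N).
Proof. by rewrite map_inj_uniq ?enum_uniq //; apply: can_inj rVpolyK. Qed.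

Lemma polyN_sub N M : (N <= M)%N -> {subset polyN N <= polyN M}.
Proof. by move=> h p; rewrite !mem_polyN => /leq_trans; apply. Qed.

(** Splitting off the constant coefficient decomposes A into Fq + T A; this drives the induction on
    [N] for all lattice products. *)
Lemma polyN_step N :
  perm_eq (polyN N.+1) [seq e%:P + 'X * b | e <- enum Fq, b <- polyN N].
Proof.
apply: uniq_perm; first exact: polyN_uniq.
  apply: allpairs_uniq; rewrite ?enum_uniq ?polyN_uniq //.
  case=> e b [e' b'] _ _ /= h; have : e = e'.
    by have := congr1 (fun p : {poly Fq} => p`_0) h; rewrite !coefD !coefC !coefXM /= !addr0.
  move=> ee; congr pair => //; move: h; rewrite ee => /addrI /mulfI; apply.
  by rewrite polyX_eq0.
move=> p; rewrite mem_polyN; apply/idP/allpairsP => [h|[[e b] /= [_]]].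
  exists (p`_0, \poly_(i < N) p`_i.+1) => /=; split; first by rewrite mem_enum.
    by rewrite mem_polyN size_poly.
  apply/polyP => i; rewrite coefD coefC coefXM coef_poly.
  case: i => [|i] /=; rewrite ?addr0 // add0r.
  case: ltnP => // hi; rewrite nth_default //; exact: leq_trans h _.
rewrite mem_polyN => h ->.
apply: leq_trans (size_polyD _ _) _; rewrite geq_max.
apply/andP; split; first by apply: leq_trans (size_polyC_leq1 _) _.
have [->|b0] := eqVneq b 0; first by rewrite mulr0 size_poly0.
by rewrite mulrC size_mulX.
Qed.

End Embedding.

(** * Lattice products *)

Section LatticeProduct.
Variables (Fq : finFieldType) (R : realType) (C : Cinfty Fq R).
Local Notation v := (@Cabs Fq R C).
Implicit Types (x y z w : C).

Lemma prod_close1 I (s : seq I) (P : pred I) (F : I -> C) (eps : R) :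
  0 <= eps -> eps <= 1 -> (forall i, P i -> v (F i - 1) <= eps) ->
  v (\prod_(i <- s | P i) F i - 1) <= eps.
Proof.
move=> e0 e1 h; elim/big_ind: _ => //; first by rewrite subrr abs0.
move=> x y hx hy; have -> : x * y - 1 = (x - 1) * y + (y - 1) by ring.
apply: absD_le => //; rewrite CabsM; apply: le_trans (_ : eps * 1 <= _).
  apply: ler_pM; rewrite ?Cabs_ge0 // -[y](subrK 1).
  by apply: absD_le; rewrite ?abs1 //; apply: le_trans hy e1.
by rewrite mulr1.
Qed.

(* [1 / 0 = 0], so indices with [f i = 0] do not contribute. *)
Definition latprod (T : eqType) (f : T -> C) (s : seq T) w : C :=
  w * \prod_(i <- s) (1 - w / f i).

Section Compare.
Variables (T : eqType) (f : T -> C).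
Local Notation E := (latprod f).

Lemma latprod_perm s1 s2 w : perm_eq s1 s2 -> E s1 w = E s2 w.
Proof. by move=> h; rewrite /latprod (perm_big _ h). Qed.

(** Every factor added by [s2] is within [eps] of 1, hence so is their product; the error is
    relative to the smaller product. *)
Lemma latprod_compare s1 s2 w (eps : R) : uniq s1 -> uniq s2 ->
  {subset s1 <= s2} -> 0 <= eps -> eps <= 1 ->
  (forall i, i \notin s1 -> v (w / f i) <= eps) ->
  v (E s2 w - E s1 w) <= eps * v (E s1 w).
Proof.
move=> u1 u2 s12 e0 e1 h; rewrite /latprod.
rewrite (bigID (mem s1)) /=.
have -> : \prod_(i <- s2 | i \in s1) (1 - w / f i) =
    \prod_(i <- [seq i <- s2 | i \in s1]) (1 - w / f i) by rewrite big_filter.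
have pe : perm_eq [seq i <- s2 | i \in s1] s1.
  apply: uniq_perm => //; first exact: filter_uniq.
  by move=> i; rewrite mem_filter; case: (boolP (i \in s1)) => //= /s12.
rewrite (perm_big _ pe) mulrA -[X in _ - X]mulr1 -mulrBr.
rewrite [X in X <= _]CabsM [X in X <= _]mulrC ler_wpM2r ?Cabs_ge0 //; apply: prod_close1 => // i /h.
by rewrite addrAC subrr sub0r absN.
Qed.

Lemma latprod_abs s1 s2 w (eps : R) : uniq s1 -> uniq s2 ->
  {subset s1 <= s2} -> 0 <= eps -> eps < 1 ->
  (forall i, i \notin s1 -> v (w / f i) <= eps) ->
  v (E s2 w) = v (E s1 w).
Proof.
move=> u1 u2 s12 e0 e1 h.
have := latprod_compare u1 u2 s12 e0 (ltW e1) h.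
have [->|n0] := eqVneq (E s1 w) 0.
  by rewrite subr0 abs0 mulr0 => h'; apply/eqP; rewrite eq_le h' Cabs_ge0.
move=> h'; apply: abs_eq_close; rewrite abs_subC; apply: le_lt_trans h' _.
by rewrite gtr_pMl // abs_gt0.
Qed.

Lemma latprod_abs_le s1 s2 w : uniq s1 -> uniq s2 -> {subset s1 <= s2} ->
  (forall i, i \notin s1 -> v (w / f i) <= 1) -> v (E s2 w) <= v (E s1 w).
Proof.
move=> u1 u2 s12 h; have := latprod_compare u1 u2 s12 ler01 (lexx _) h.
rewrite mul1r => h'; rewrite -[E s2 w](subrK (E s1 w)); exact: absD_le.
Qed.

Lemma latprod_eq0 s i : i \in s -> E s (f i) = 0.
Proof.
move=> hi; have [fi0|fi0] := eqVneq (f i) 0; rewrite /latprod; first by rewrite fi0 mul0r.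
by rewrite (big_rem i hi) /= mulfV // subrr mul0r mulr0.
Qed.

Lemma latprod_neq0 s w : w != 0 -> (forall i, i \in s -> w != f i) -> E s w != 0.
Proof.
move=> w0 h; rewrite mulf_neq0 // prodf_seq_neq0; apply/allP => i hi /=.
rewrite subr_eq0 eq_sym; have [->|fi0] := eqVneq (f i) 0.
  by rewrite invr0 mulr0 eq_sym oner_neq0.
by apply: contra (h _ hi) => /eqP E1; rewrite -[w](divfK fi0) E1 mul1r.
Qed.

Variables (S : nat -> seq T).
Hypotheses (Suniq : forall N, uniq (S N)).
Hypothesis (Smono : forall N M, (N <= M)%N -> {subset S N <= S M}).
Hypothesis (Sproper : forall B : R, exists N, forall i, i \notin S N -> B <= v (f i)).

Definition latexp w : C := vlim v (fun N => E (S N) w).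

Lemma latprod_small w (eps : R) : 0 < eps ->
  exists N, forall i, i \notin S N -> v (w / f i) <= eps.
Proof.
move=> e0; have [N hN] := Sproper (v w / eps); exists N => i /hN.
have [->|fi0] := eqVneq (f i) 0; first by move=> _; rewrite invr0 mulr0 abs0 ltW.
by rewrite ler_pdivrMr // abs_div ler_pdivrMr ?abs_gt0 // mulrC.
Qed.

(** The Cauchy property holds along all finite sets containing [S N], not only along [S] itself;
    this is what permits regrouping and reindexing a lattice later. *)
Lemma latprod_cauchy w (e : R) : 0 < e ->
  exists N, forall s, uniq s -> {subset S N <= s} -> v (E s w - E (S N) w) < e.
Proof.
(* Beyond [N0] the absolute values of the products no longer exceed [b], so a relative error
   [e / (b + 1)] is enough; the summand 1 guards against [b = 0]. *)
move=> e0; have [N0 h0] := latprod_small w (@ltr01 R).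
pose b := v (E (S N0) w); have b1 : 0 < b + 1 by apply: ltr_wpDl; [exact: Cabs_ge0|exact: ltr01].
pose eps := Num.min 1 (e / (b + 1)).
have eps0 : 0 < eps by rewrite lt_min ltr01 divr_gt0.
have [N1 h1] := latprod_small w eps0.
exists (maxn N0 N1) => s us hs.
apply: le_lt_trans (latprod_compare (eps := eps) _ us hs _ _ _) _ => //.
- exact: ltW.
- by rewrite ge_min lexx.
- by move=> i hi; apply: h1; apply: contra hi; apply: Smono; rewrite leq_maxr.
apply: le_lt_trans (_ : e / (b + 1) * b < e).
  apply: ler_pM; rewrite ?Cabs_ge0 ?(ltW eps0) // ?ge_min ?lexx ?orbT //.
  by apply: latprod_abs_le => //; apply: Smono; rewrite leq_maxl.
by rewrite mulrAC ltr_pdivrMr // ltr_pM2l // ltrDl.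
Qed.

Lemma latexp_cvg w : vcvg v (fun N => E (S N) w) (latexp w).
Proof.
have [l hl] : exists l, vcvg v (fun N => E (S N) w) l.
  apply: Cabs_complete => e /(latprod_cauchy w)[N hN]; exists N => j k hj hk.
  apply: (abs_chain_lt (y := E (S N) w)); first by apply: hN => //; exact: Smono.
  by rewrite abs_subC; apply: hN => //; exact: Smono.
by rewrite /latexp (vlimE hl).
Qed.

Lemma latexp_net w (e : R) : 0 < e ->
  exists N, forall s, uniq s -> {subset S N <= s} -> v (E s w - latexp w) < e.
Proof.
move=> e0; have [N hN] := latprod_cauchy w e0; have [M hM] := latexp_cvg w e0.
exists N => s us hs; apply: (abs_chain_lt (y := E (S N) w)); first exact: hN.
apply: (abs_chain_lt (y := E (S (maxn N M)) w)); last by apply/hM/leq_maxr.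
rewrite abs_subC; apply: hN => //; apply: Smono; exact: leq_maxl.
Qed.

(** Evaluates the product along an exhaustion adapted to the problem: rectangles in [lamexpE],
    images under a matrix in [lamexp_mobius]. *)
Lemma latexp_netE w l :
  (forall e : R, 0 < e -> forall N, exists s,
     [/\ uniq s, {subset S N <= s} & v (E s w - l) < e]) -> latexp w = l.
Proof.
move=> h; apply/eqP; rewrite -subr_eq0 -abs_eq0; apply: contraT => n0.
have e0 : 0 < v (latexp w - l) by rewrite lt0r n0 Cabs_ge0.
have [N hN] := latexp_net w e0; have [s [us hs hl]] := h _ e0 N.
have := abs_chain_lt (x := latexp w) (y := E s w) (z := l) (B := v (latexp w - l)).
by rewrite ltxx; apply => //; rewrite abs_subC hN.
Qed.

Lemma latexp_eq0 i : (exists N, i \in S N) -> latexp (f i) = 0.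
Proof.
case=> N hN; apply: vlimE; apply: (vcvg_near (N := N)) (vcvg_cst _) => k hk.
by rewrite latprod_eq0 //; apply: Smono hN.
Qed.

(** Once the remaining factors are within 1/2 of 1, the absolute value of the partial products is
    stationary, and it is not 0. *)
Lemma latexp_neq0 w : w != 0 -> (forall i, w != f i) -> latexp w != 0.
Proof.
move=> w0 h; have half : 0 < 2^-1 :> R by rewrite invr_gt0.
have [N hN] := latprod_small w half.
have EN0 : 0 < v (E (S N) w) by rewrite abs_gt0 latprod_neq0.
rewrite -abs_gt0; apply: lt_le_trans EN0 _.
apply: (vcvg_abs_ge (N := N) _ (latexp_cvg w)).
  by rewrite abs_gt0 latprod_neq0.
move=> k hk; rewrite (@latprod_abs (S N) (S k) w 2^-1) //.
- exact: Smono.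
- exact: ltW.
- by rewrite invf_lt1 ?ltr1n.
Qed.

Lemma latexp_abs_ge (B : R) w : 0 < B ->
  (forall N, B <= v (E (S N) w)) -> B <= v (latexp w).
Proof. by move=> B0 h; apply: (vcvg_abs_ge (N := 0) B0 (latexp_cvg w)). Qed.

End Compare.
End LatticeProduct.

(** * Fq-linearity of lattice products *)

Section Additive.
Variables (Fq : finFieldType) (R : realType) (C : Cinfty Fq R).
Local Notation v := (@Cabs Fq R C).
Local Notation q := #|Fq|.
Implicit Types (x y z w : C) (a b c p : {poly Fq}) (Y : {poly Fq} -> C).

Definition fq_linear (f : C -> C) : Prop :=
  {morph f : x y / x + y} /\ forall (e : Fq) x, f (ic C e * x) = ic C e * f x.

Lemma fq_linear0 f : fq_linear f -> f 0 = 0.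
Proof. by move=> [h _]; apply: (addrI (f 0)); rewrite -h !addr0. Qed.

Lemma fq_linearN f x : fq_linear f -> f (- x) = - f x.
Proof.
by move=> h; apply/eqP; rewrite -addr_eq0 -(h.1) addNr (fq_linear0 h).
Qed.

Lemma fq_linearB f x y : fq_linear f -> f (x - y) = f x - f y.
Proof. by move=> h; rewrite h.1 (fq_linearN _ h). Qed.

Definition lattice_map Y : Prop :=
  [/\ {morph Y : a b / a + b}, forall (e : Fq) b, Y (e%:P * b) = ic C e * Y b
    & forall b, Y b = 0 -> b = 0].

Lemma lattice_map0 Y : lattice_map Y -> Y 0 = 0.
Proof. by move=> [h _ _]; apply: (addrI (Y 0)); rewrite -h !addr0. Qed.

Lemma lattice_map_neq0 Y b : lattice_map Y -> b != 0 -> Y b != 0.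
Proof. by case=> _ _ h; apply: contra => /eqP/h->. Qed.

(** For P(x) the product of the x - Y b, the left side is P(w - y) / P(- y), and P is a constant
    multiple of the additive function [latprod Y (polyN Fq N)]. *)
Lemma latprod_shift Y N y w : lattice_map Y ->
    fq_linear (latprod Y (polyN Fq N)) ->
    (forall b, y + Y b != 0) ->
  \prod_(b <- polyN Fq N) (1 - w / (y + Y b)) =
  1 - latprod Y (polyN Fq N) w / latprod Y (polyN Fq N) y.
Proof.
move=> hY hE hy; set E := latprod Y _ in hE *.
pose P x := \prod_(b <- polyN Fq N) (x - Y b).
pose D := \prod_(b <- rem 0 (polyN Fq N)) (- Y b).
have m0 : 0 \in polyN Fq N by rewrite mem_polyN size_poly0.
have r0 b : b \in rem 0 (polyN Fq N) -> Y b != 0.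
  by rewrite mem_rem_uniq ?polyN_uniq // inE => /andP[b0 _]; apply: lattice_map_neq0.
have D0 : D != 0.
  by rewrite prodf_seq_neq0; apply/allP => b /r0; rewrite oppr_eq0.
have PE x : P x = D * E x.
  rewrite /P /E /latprod !(big_rem 0 m0) /= (lattice_map0 hY) subr0 invr0 mulr0 subr0 mul1r.
  rewrite mulrCA; congr (_ * _); rewrite -big_split /=.
  rewrite big_seq [RHS]big_seq; apply: eq_bigr => b /r0 b0.
  by field.
have Ey : E y != 0.
  have : P (- y) != 0.
    rewrite prodf_seq_neq0; apply/allP => b _ /=.
    by rewrite -opprD oppr_eq0.
  by rewrite PE mulf_eq0 negb_or => /andP[_]; rewrite (fq_linearN _ hE) oppr_eq0.
transitivity (P (w - y) / P (- y)).
  rewrite -prodf_div; apply: eq_bigr => b _; have := hy b => h0.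
  by field; rewrite -opprD oppr_eq0 h0.
rewrite !PE -mulf_div mulfV // mul1r (fq_linearB _ _ hE) (fq_linearN _ hE).
by rewrite invrN mulrN -mulNr opprB mulrBl mulfV.
Qed.

(** Group the lattice by the constant coefficient e. By [latprod_shift] the coset of e != 0
    contributes 1 - E w / (e E(Y 1)), and the product over e collapses by [prod_sub_div_ic]. *)
Lemma latprod_step Y N w : lattice_map Y ->
    fq_linear (latprod (fun b => Y ('X * b)) (polyN Fq N)) ->
  let E := latprod (fun b => Y ('X * b)) (polyN Fq N) in
  latprod Y (polyN Fq N.+1) w = E w * (1 - (E w / E (Y 1)) ^+ q.-1).
Proof.
move=> hY hE E; have [hYD hYZ hYi] := hY.
have hY' : lattice_map (fun b => Y ('X * b)).
  split=> [a b|e b|b /hYi/eqP]; first by rewrite mulrDr hYD.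
    by rewrite mulrCA hYZ.
  by rewrite mulf_eq0 polyX_eq0 => /eqP.
rewrite (latprod_perm _ _ (polyN_step _ N)) /latprod big_allpairs_dep /=.
have h e : e != 0 -> \prod_(b <- polyN Fq N) (1 - w / Y (e%:P + 'X * b)) =
    1 - E w / (ic C e * E (Y 1)).
  move=> e0; have Ye : Y e%:P = ic C e * Y 1 by rewrite -hYZ mulr1.
  under eq_bigr do rewrite hYD.
  rewrite (latprod_shift w hY' hE); first by rewrite -hE.2 -Ye.
  move=> b; rewrite -hYD lattice_map_neq0 //.
  apply/negP => /eqP/(congr1 (fun p : {poly Fq} => p`_0)).
  by rewrite coefD coefC coefXM coef0 /= addr0; apply/eqP.
rewrite big_enum /= (bigD1 (0 : Fq)) //= mulrA; congr (_ * _).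
  by congr (_ * _); apply: eq_bigr => b _; rewrite add0r.
rewrite -prod_sub_div_ic [RHS](bigD1 (0 : Fq)) //=.
rewrite rmorph0 mul0r invr0 mulr0 subr0 mul1r.
by apply: eq_bigr => e /h.
Qed.

(** The induction runs over all lattice maps at once, since the step passes from [Y] to its
    restriction to multiples of ['X]. That step composes a linear map with x - c x^q, which is again
    linear by Frobenius. *)
Lemma fq_linear_latprod Y N : lattice_map Y -> fq_linear (latprod Y (polyN Fq N)).
Proof.
elim: N Y => [|N IH] Y hY.
  have E w : latprod Y (polyN Fq 0) w = w.
    rewrite /latprod big_seq big1 ?mulr1 // => b; rewrite mem_polyN leqn0 size_poly_eq0.
    by move/eqP->; rewrite (lattice_map0 hY) invr0 mulr0 subr0.
  by split=> [x y|e x]; rewrite !E.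
have [hYD hYZ hYi] := hY.
have hY' : lattice_map (fun b => Y ('X * b)).
  split=> [a b|e b|b /hYi/eqP]; first by rewrite mulrDr hYD.
    by rewrite mulrCA hYZ.
  by rewrite mulf_eq0 polyX_eq0 => /eqP.
have hE := IH _ hY'; set E := latprod _ _ in hE.
have step w : latprod Y (polyN Fq N.+1) w = E w - (E (Y 1))^-1 ^+ q.-1 * E w ^+ q.
  rewrite (latprod_step _ hY hE) -/E mulrBr mulr1 exprMn; congr (_ - _).
  by rewrite mulrA -exprS prednK ?q_gt0 // mulrC.
split=> [x y|e x]; rewrite !step.
  by rewrite hE.1 FrobeniusD; ring.
by rewrite hE.2 exprMn icXq; ring.
Qed.

End Additive.

(** * The exponential of the lattice [A] *)

Section CarlitzExp.
Variables (Fq : finFieldType) (R : realType) (C : Cinfty Fq R).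
Local Notation v := (@Cabs Fq R C).
Local Notation q := #|Fq|.
Local Notation T := (iA C 'X).
Implicit Types (x y z w : C) (a b c p : {poly Fq}).

Lemma polyN_proper (f : {poly Fq} -> C) (k : R) : 0 < k ->
  (forall a, k * v (iA C a) <= v (f a)) ->
  forall B : R, exists N, forall a, a \notin polyN Fq N -> B <= v (f a).
Proof.
move=> k0 h B; have [N hN] := exists_qX_ge Fq (B / k).
exists N => a; rewrite mem_polyN -ltnNge => /(abs_iA_ge C) ha.
apply: le_trans (h a); rewrite mulrC -ler_pdivrMr //.
exact: le_trans (hN N (leqnn _)) ha.
Qed.

(** The Carlitz exponential, rescaled so that its period lattice is A. *)
Definition cexp : C -> C := latexp (iA C) (polyN Fq).

Lemma iA_lattice_map : lattice_map (iA C).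
Proof.
split=> [a b|e b|b /eqP]; rewrite ?rmorphD ?rmorphM //.
by rewrite iA_eq0 => /eqP.
Qed.

Lemma iA_proper (B : R) : exists N, forall a, a \notin polyN Fq N -> B <= v (iA C a).
Proof. by apply: (@polyN_proper _ 1) => // a; rewrite mul1r. Qed.

Lemma cexp_cvg w : vcvg v (fun N => latprod (iA C) (polyN Fq N) w) (cexp w).
Proof.
apply: latexp_cvg; first exact: polyN_uniq.
  exact: polyN_sub.
exact: iA_proper.
Qed.

Lemma latexp_fq_linear (Y : {poly Fq} -> C) : lattice_map Y ->
  (forall w, vcvg v (fun N => latprod Y (polyN Fq N) w) (latexp Y (polyN Fq) w)) ->
  fq_linear (latexp Y (polyN Fq)).
Proof.
move=> hY hc; split=> [x y|e x].
  apply: vcvg_unique (hc _) _; apply: vcvg_ext (vcvgD (hc x) (hc y)) => N.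
  by rewrite (fq_linear_latprod _ hY).1.
apply: vcvg_unique (hc _) _; apply: vcvg_ext (vcvgZ (ic C e) (hc x)) => N.
by rewrite (fq_linear_latprod _ hY).2.
Qed.

Lemma cexp_linear : fq_linear cexp.
Proof. exact: latexp_fq_linear iA_lattice_map cexp_cvg. Qed.

Lemma cexpD x y : cexp (x + y) = cexp x + cexp y. Proof. exact: cexp_linear.1. Qed.
Lemma cexpB x y : cexp (x - y) = cexp x - cexp y.
Proof. exact/fq_linearB/cexp_linear. Qed.
Lemma cexpZ e x : cexp (ic C e * x) = ic C e * cexp x. Proof. exact: cexp_linear.2. Qed.
Lemma cexp_iA a : cexp (iA C a) = 0.
Proof.
apply: latexp_eq0; first exact: polyN_sub.
by exists (size a); rewrite mem_polyN.
Qed.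

(* Translating [z] by an element of [A], we may assume that [|z|] is minimal,
   and then every factor of the product has absolute value at least 1. *)
Lemma cexp_ge (r : R) z : 0 < r -> (forall a, r <= v (z - iA C a)) -> r <= v (cexp z).
Proof.
move=> r0 hr.
(* Polynomials of size greater than [N] exceed z in absolute value, hence are at least as far from z
   as 0 is; a minimum over the finite set of smaller ones is therefore a minimum over A. *)
have [N hN] := exists_qX_ge Fq (v z + 1).
pose F (u : 'rV[Fq]_N) := v (z - iA C (rVpoly u)).
have [u _ hu] := @Order.TotalTheory.arg_minP _ _ _ (0 : 'rV[Fq]_N) xpredT F isT.
pose z' := z - iA C (rVpoly u).
have hz' c : v z' <= v (z' - iA C c).
  rewrite /z' -addrA -opprD -rmorphD; set d := _ + c.
  have [sd|sd] := leqP (size d) N.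
    by have := hu (poly_rV d) isT; rewrite /F poly_rV_K.
  have h1 := abs_iA_ge C sd.
  have h2 : v z < v (iA C d).
    by apply: lt_le_trans (le_trans (hN N _) h1) => //; rewrite ltrDl.
  rewrite [X in _ <= X]abs_subC [X in _ <= X]absB_eql //.
  apply: le_trans (ltW h2).
  by have := hu 0 isT; rewrite /F linear0 rmorph0 subr0.
have E : cexp z = cexp z' by rewrite cexpB cexp_iA subr0.
rewrite E; apply: latexp_abs_ge => //; first exact: polyN_uniq.
- exact: polyN_sub.
- exact: iA_proper.
move=> M; rewrite /latprod CabsM abs_prod; apply: le_trans (hr (rVpoly u)) _.
rewrite -[X in X <= _]mulr1 ler_wpM2l ?Cabs_ge0 //.
elim/big_ind: _ => [//|x y x1 y1|c _]; first by rewrite mulr_ege1.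
have [->|c0] := eqVneq c 0; first by rewrite rmorph0 invr0 mulr0 subr0 abs1.
have [h|h] := ltP (v z') (v (iA C c)).
  by rewrite absB_eql ?abs1 // abs_div ltr_pdivrMr ?mul1r ?abs_gt0 ?iA_eq0.
have -> : 1 - z' / iA C c = (iA C c - z') / iA C c by field; rewrite iA_eq0.
rewrite abs_div ler_pdivlMr ?abs_gt0 ?iA_eq0 // mul1r abs_subC.
exact: le_trans (hz' c).
Qed.

Definition lam : C := cexp T^-1.

Lemma lam_neq0 : lam != 0.
Proof.
have q0 : 0 < (q%:R : R)^-1 by rewrite invr_gt0 qR_gt0.
rewrite -abs_gt0; apply: lt_le_trans q0 _; apply: cexp_ge.
  by rewrite invr_gt0 qR_gt0.
move=> a; have [->|a0] := eqVneq a 0.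
  by rewrite rmorph0 subr0 absV abs_iAX.
have q1 : (q%:R : R)^-1 < 1 by rewrite invf_lt1 ?qR_gt0 ?qR_gt1.
have a1 := abs_iA_ge1 C a0.
rewrite abs_subC absB_eql ?absV ?abs_iAX; first exact: le_trans (ltW q1) a1.
exact: lt_le_trans q1 a1.
Qed.

(** The functional equation of a rescaled Carlitz module, obtained from [latprod_step] in the limit:
    the product over T A at T x is T times the product over A at x. *)
Lemma cexpT x : cexp (T * x) = T * cexp x * (1 - (cexp x / lam) ^+ q.-1).
Proof.
pose E N := latprod (iA C) (polyN Fq N).
have hE' N w : latprod (fun b => iA C ('X * b)) (polyN Fq N) w = T * E N (w / T).
  rewrite /E /latprod mulrA [T * _]mulrC divfK ?iAX_neq0 //; congr (_ * _).
  by apply: eq_bigr => b _; rewrite rmorphM invfM mulrA.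
have lin N : fq_linear (latprod (fun b => iA C ('X * b)) (polyN Fq N)).
  apply: fq_linear_latprod; split=> [a b|e b|b /eqP].
  - by rewrite mulrDr rmorphD.
  - by rewrite mulrCA rmorphM.
  - by rewrite iA_eq0 mulf_eq0 polyX_eq0 => /eqP.
have st N : E N.+1 (T * x) = T * E N x * (1 - (E N x / E N T^-1) ^+ q.-1).
  rewrite {1}/E (latprod_step _ iA_lattice_map (lin N)) !hE' rmorph1 mul1r.
  by rewrite [T * x]mulrC mulfK ?iAX_neq0 // -mulf_div mulfV ?iAX_neq0 // mul1r.
apply: vcvg_unique (vcvg_shift 1 (cexp_cvg (T * x))) _.
apply: vcvg_ext (fun N => T * E N x * (1 - (E N x / E N T^-1) ^+ q.-1)) _ _ _ _.
  by move=> N; rewrite addn1 -st.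
apply: vcvgM; first exact: vcvgZ (cexp_cvg x).
apply: vcvgB; first exact: vcvg_cst.
by apply: vcvgX; apply: vcvg_div; [exact: lam_neq0 | exact: cexp_cvg | exact: cexp_cvg].
Qed.

End CarlitzExp.

Lemma ord2P (P : 'I_2 -> Prop) : P 0 -> P 1 -> forall i, P i.
Proof.
move=> h0 h1 [[|[|//]] hi]; first by rewrite (_ : Ordinal hi = 0) //; apply: val_inj.
by rewrite (_ : Ordinal hi = 1) //; apply: val_inj.
Qed.

Lemma mulmx2E (R : pzRingType) m n (A : 'M[R]_(m, 2)) (B : 'M[R]_(2, n)) i j :
  (A *m B) i j = A i 0 * B 0 j + A i 1 * B 1 j.
Proof. by rewrite mxE big_ord_recl big_ord1 /=; congr (_ + A _ _ * B _ _); apply: val_inj. Qed.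

Lemma det2E (R : comNzRingType) (A : 'M[R]_2) : \det A = A 0 0 * A 1 1 - A 0 1 * A 1 0.
Proof.
rewrite (expand_det_row _ 0) big_ord_recl big_ord1 /cofactor !det_mx11 !mxE /=.
rewrite expr0 mul1r expr1 mulN1r mulrN; congr (A _ _ * A _ _ - A _ _ * A _ _);
  by apply: val_inj.
Qed.

(** * The half plane and the lattices [A z + A] *)

Section HalfPlane.
Variables (Fq : finFieldType) (R : realType) (C : Cinfty Fq R).
Local Notation v := (@Cabs Fq R C).
Local Notation q := #|Fq|.
Local Notation qR := (#|Fq|%:R : R).
Local Notation T := (iA C 'X).
Implicit Types (x y z w : C) (a b c d p : {poly Fq}).

Lemma range_Kinfty k : Kinfty (Cemb C k).
Proof. by move=> e e0; exists (Cemb C k); [exists k | rewrite subrr abs0]. Qed.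

Lemma Omega_subset m z : Omega_ m z -> Omega z.
Proof.
move=> [_ h] /h; rewrite subrr abs0 leNgt invr_gt0 exprn_gt0 //; exact: qR_gt0.
Qed.

Lemma Omega_bigcup z : Omega z -> exists m, Omega_ m z.
Proof.
move=> hz; have [e e0 he] : exists2 e : R, 0 < e & forall k, e <= v (z - Cemb C k).
  apply: contrapT => h; apply: hz => e e0; apply: contrapT => h2; apply: h.
  exists e => // k; rewrite leNgt; apply/negP => h3; apply: h2.
  by exists (Cemb C k) => //; exists k.
have [M hM] := exists_qN_lt Fq e0; have [M' hM'] := exists_qX_ge Fq (v z).
pose m := maxn M M'; exists m; split; first by apply: hM'; rewrite leq_maxr.
move=> x hx; rewrite leNgt; apply/negP => h1.
have p0 : 0 < qR ^- m by rewrite invr_gt0 exprn_gt0 // qR_gt0.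
have [_ [k _ <-] h2] := hx _ p0.
have := abs_chain_lt h1 h2; rewrite ltNge => /negP; apply.
by apply: le_trans (he k); apply/ltW/hM/leq_maxl.
Qed.

Definition latform z (i : {poly Fq} * {poly Fq}) : C := iA C i.1 * z + iA C i.2.

(** The imaginary part gives |c z + d| >= q^-m |c|. If d dominates c z the bound for d is immediate;
    otherwise |d| <= q^m |c|, which costs a second factor q^-m. *)
Lemma latform_ge m z i : Omega_ m z ->
  qR ^- (m + m) * v (iA C i.1) <= v (latform z i) /\
  qR ^- (m + m) * v (iA C i.2) <= v (latform z i).
Proof.
case: i => c d [zm im]; rewrite /latform /=.
have Q0 k : 0 < qR ^- k by rewrite invr_gt0 exprn_gt0 ?qR_gt0.
have Q1 k : qR ^- k <= 1.
  by rewrite invf_le1 ?exprn_gt0 ?qR_gt0 // exprn_ege1 // ltW ?qR_gt1.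
have QM : qR ^- (m + m) = qR ^- m * qR ^- m by rewrite exprD invfM.
have hc : qR ^- m * v (iA C c) <= v (iA C c * z + iA C d).
  have [->|c0] := eqVneq c 0; first by rewrite rmorph0 abs0 mulr0 Cabs_ge0.
  have c0' : iA C c != 0 by rewrite iA_eq0.
  have -> : iA C c * z + iA C d = iA C c * (z - (- iA C d / iA C c)) by field.
  rewrite CabsM mulrC ler_wpM2l ?Cabs_ge0 //; apply: im.
  have -> : - iA C d / iA C c = Cemb C (- tofrac d / tofrac c).
    by rewrite rmorphM rmorphN fmorphV.
  exact: range_Kinfty.
split.
  apply: le_trans hc; rewrite ler_wpM2r ?Cabs_ge0 // QM.
  by rewrite -[X in _ <= X]mulr1 ler_wpM2l // ltW.
have [h|h] := ltP (v (iA C c * z)) (v (iA C d)).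
  rewrite absD_eqr // -[X in _ <= X]mul1r ler_wpM2r ?Cabs_ge0 //.
apply: le_trans hc; rewrite QM -mulrA ler_wpM2l ?(ltW (Q0 _)) //.
rewrite mulrC ler_pdivrMr ?exprn_gt0 ?qR_gt0 //; apply: le_trans h _.
by rewrite CabsM ler_wpM2l ?Cabs_ge0.
Qed.

Lemma latform_neq0 z i : Omega z -> i != 0 -> latform z i != 0.
Proof.
move=> /Omega_bigcup[m hm]; apply: contra => /eqP h.
have p0 : 0 < qR ^- (m + m) by rewrite invr_gt0 exprn_gt0 // qR_gt0.
have [] := latform_ge i hm; rewrite h abs0 !pmulr_rle0 //.
move=> h1 h2; case: i {h} h1 h2 => c d /= h1 h2; rewrite /eq_op /=.
by rewrite -!(iA_eq0 C) -!abs_eq0 !eq_le h1 h2 !Cabs_ge0.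
Qed.

Definition polyN2 N : seq ({poly Fq} * {poly Fq}) :=
  [seq (c, d) | c <- polyN Fq N, d <- polyN Fq N].

Lemma mem_polyN2 N i : (i \in polyN2 N) = (size i.1 <= N)%N && (size i.2 <= N)%N.
Proof.
case: i => c d; rewrite /polyN2; apply/allpairsP/andP => /= [[[c' d'] /= [h1 h2 [-> ->]]]|[h1 h2]].
  by rewrite -!mem_polyN.
by exists (c, d); rewrite !mem_polyN.
Qed.

Lemma polyN2_uniq N : uniq (polyN2 N).
Proof. by apply: allpairs_uniq; rewrite ?polyN_uniq // => -[? ?] [? ?]. Qed.

Lemma polyN2_sub N M : (N <= M)%N -> {subset polyN2 N <= polyN2 M}.
Proof.
move=> h i; rewrite !mem_polyN2 => /andP[h1 h2].
by rewrite (leq_trans h1 h) (leq_trans h2 h).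
Qed.

Lemma polyN2_bound (s : seq ({poly Fq} * {poly Fq})) : exists N, {subset s <= polyN2 N}.
Proof.
elim: s => [|i s [N hN]]; first by exists 0%N.
exists (maxn N (maxn (size i.1) (size i.2))) => j; rewrite inE => /orP[/eqP->|/hN].
  by rewrite mem_polyN2 !leq_max !leqnn !orbT.
by apply: polyN2_sub; rewrite leq_maxl.
Qed.

Lemma latform_proper z (B : R) : Omega z ->
  exists N, forall i, i \notin polyN2 N -> B <= v (latform z i).
Proof.
move=> /Omega_bigcup[m hm].
have p0 : 0 < qR ^- (m + m) by rewrite invr_gt0 exprn_gt0 // qR_gt0.
have [N hN] := exists_qX_ge Fq (B / qR ^- (m + m)).
exists N => i; rewrite mem_polyN2 negb_and -!ltnNge; have [h1 h2] := latform_ge i hm.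
case/orP => /(abs_iA_ge C) h; [apply: le_trans h1|apply: le_trans h2];
  rewrite mulrC -ler_pdivrMr //; exact: le_trans (hN N (leqnn _)) h.
Qed.

Definition lamexp z : C -> C := latexp (latform z) polyN2.

(** [cexp] has kernel A, so for z in [Omega] these values form the image of the lattice A z + A
    modulo A. *)
Definition cexp_mult z c : C := cexp (iA C c * z).

Lemma cexp_mult_ge m z c : Omega_ m z ->
  qR ^- (m + m) * v (iA C c) <= v (cexp_mult z c).
Proof.
move=> hm; have p0 : 0 < qR ^- (m + m) by rewrite invr_gt0 exprn_gt0 // qR_gt0.
have [->|c0] := eqVneq c 0; first by rewrite rmorph0 abs0 mulr0 Cabs_ge0.
apply: cexp_ge; first by rewrite mulr_gt0 // abs_gt0 iA_eq0.
by move=> a; have [h _] := latform_ge (c, - a) hm; rewrite /latform /= rmorphN in h.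
Qed.

Lemma cexp_mult_lattice z : Omega z -> lattice_map (cexp_mult z).
Proof.
move=> /Omega_bigcup[m hm]; have p0 : 0 < qR ^- (m + m) by rewrite invr_gt0 exprn_gt0 // qR_gt0.
split=> [a b|e b|b h]; first by rewrite /cexp_mult rmorphD mulrDl cexpD.
  by rewrite /cexp_mult rmorphM -mulrA cexpZ.
have := cexp_mult_ge b hm; rewrite h abs0 pmulr_rle0 // => h'.
by apply/eqP; rewrite -(iA_eq0 C) -abs_eq0 eq_le h' Cabs_ge0.
Qed.

Lemma cexp_mult_cvg z w : Omega z ->
  vcvg v (fun N => latprod (cexp_mult z) (polyN Fq N) w)
         (latexp (cexp_mult z) (polyN Fq) w).
Proof.
move=> /Omega_bigcup[m hm]; apply: latexp_cvg; first exact: polyN_uniq.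
  exact: polyN_sub.
apply: (@polyN_proper _ _ _ _ (qR ^- (m + m))); first by rewrite invr_gt0 exprn_gt0 // qR_gt0.
by move=> a; apply: cexp_mult_ge.
Qed.

Lemma lamexp_cvg z w : Omega z ->
  vcvg v (fun N => latprod (latform z) (polyN2 N) w) (lamexp z w).
Proof.
move=> hz; apply: latexp_cvg; first exact: polyN2_uniq.
  exact: polyN2_sub.
by move=> B; apply: latform_proper.
Qed.

(* Grouping the elements [c z + d] of the lattice by [c]. *)
Lemma lamexpE z w : Omega z ->
  lamexp z w = latexp (cexp_mult z) (polyN Fq) (cexp w).
Proof.
move=> hz; apply: latexp_netE; first exact: polyN2_uniq.
- exact: polyN2_sub.
- by move=> B; apply: latform_proper.
move=> e e0 N.
have [K0 hK0] := cexp_mult_cvg (cexp w) hz e0.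
pose K := maxn N K0; have hK := hK0 K (leq_maxr _ _).
pose E M := latprod (iA C) (polyN Fq M).
(* On a finite rectangle the grouping is exact, by [latprod_shift]. The range [M] of d is then sent
   to infinity while the range [K] of c stays fixed. *)
have Ex M : latprod (latform z) [seq (c, d) | c <- polyN Fq K, d <- polyN Fq M] w =
    latprod (fun c => E M (iA C c * z)) (polyN Fq K) (E M w).
  have m0 : 0 \in polyN Fq K by rewrite mem_polyN size_poly0.
  rewrite {1}/latprod big_allpairs_dep /= {1}/latprod !(big_rem 0 m0) /=.
  have -> : E M (iA C 0 * z) = 0 by rewrite rmorph0 mul0r /E /latprod mul0r.
  rewrite invr0 mulr0 subr0 mul1r mulrA; congr (_ * _).
    rewrite /E /latprod; congr (_ * _); apply: eq_bigr => d _.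
    by rewrite /latform /= rmorph0 mul0r add0r.
  rewrite big_seq [RHS]big_seq; apply: eq_bigr => c.
  rewrite mem_rem_uniq ?polyN_uniq // inE => /andP[c0 _].
  rewrite -(latprod_shift w (iA_lattice_map C) (fq_linear_latprod _ (iA_lattice_map C))) //.
  move=> d; apply: (@latform_neq0 z (c, d)) => //.
  by apply: contra c0 => /eqP[-> _].
have hM : vcvg v (fun M => latprod (fun c => E M (iA C c * z)) (polyN Fq K) (E M w))
    (latprod (cexp_mult z) (polyN Fq K) (cexp w)).
  apply: vcvgM; first exact: cexp_cvg.
  apply: vcvg_prod => c _; apply: vcvgB; first exact: vcvg_cst.
  have [->|c0] := eqVneq c 0.
    apply: vcvg_ext (_ : vcvg v (fun=> 0) _) => [M|].
      by rewrite rmorph0 mul0r /E /latprod mul0r invr0 mulr0.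
    rewrite (lattice_map0 (cexp_mult_lattice hz)) invr0 mulr0; exact: vcvg_cst.
  apply: vcvg_div; [|exact: cexp_cvg|exact: cexp_cvg].
  exact: lattice_map_neq0 (cexp_mult_lattice hz) c0.
have [M0 hM0] := hM _ e0; pose M := maxn N M0.
exists [seq (c, d) | c <- polyN Fq K, d <- polyN Fq M]; split.
- by apply: allpairs_uniq; rewrite ?polyN_uniq // => -[? ?] [? ?].
- move=> [c d]; rewrite mem_polyN2 /= => /andP[h1 h2]; apply/allpairsP.
  exists (c, d); rewrite !mem_polyN /=; split => //.
    by rewrite (leq_trans h1) // leq_maxl.
  by rewrite (leq_trans h2) // leq_maxl.
by rewrite Ex; apply: abs_chain_lt hK; apply: hM0; rewrite leq_maxr.
Qed.

Lemma lamexp_linear z : Omega z -> fq_linear (lamexp z).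
Proof.
move=> hz; have [hD hZ] := latexp_fq_linear (cexp_mult_lattice hz) (fun w => cexp_mult_cvg w hz).
by split=> [x y|e x]; rewrite !lamexpE // ?cexpD ?cexpZ ?hD ?hZ.
Qed.

Lemma lamexp_latform z i : lamexp z (latform z i) = 0.
Proof.
apply: latexp_eq0; first exact: polyN2_sub.
by have [N hN] := polyN2_bound [:: i]; exists N; apply: hN; rewrite inE.
Qed.

Lemma lamexp_neq0 z w : Omega z -> (forall i, w != latform z i) -> lamexp z w != 0.
Proof.
move=> hz h; apply: latexp_neq0 => //; first exact: polyN2_uniq.
- exact: polyN2_sub.
- by move=> B; apply: latform_proper.
by have := h (0, 0); rewrite /latform rmorph0 mul0r addr0.
Qed.

Definition act_row (g : 'M[{poly Fq}]_2) (i : {poly Fq} * {poly Fq}) :=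
  (i.1 * g 0 0 + i.2 * g 1 0, i.1 * g 0 1 + i.2 * g 1 1).

Lemma act_rowM g h i : act_row h (act_row g i) = act_row (g *m h) i.
Proof.
by case: i => c d; rewrite /act_row !mulmx2E /=; congr pair; ring.
Qed.

Lemma act_row1 i : act_row 1%:M i = i.
Proof. by case: i => c d; rewrite /act_row !mxE /= !mulr0 !mulr1 addr0 add0r. Qed.

Definition autj (g : 'M[{poly Fq}]_2) z : C := iA C (g 1 0) * z + iA C (g 1 1).

Lemma autj_neq0 g z : g \in unitmx -> Omega z -> autj g z != 0.
Proof.
move=> gu hz; apply: (@latform_neq0 z (g 1 0, g 1 1)) => //.
apply/negP => /eqP[h0 h1]; move: gu; rewrite unitmxE det2E h0 h1 !mulr0 subr0.
by rewrite unitr0.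
Qed.

Lemma latform_mobius g z i : autj g z != 0 ->
  latform (mobius g z) i = latform z (act_row g i) / autj g z.
Proof.
move=> j0; rewrite /latform /mobius /act_row -/(autj g z) /= !rmorphD !rmorphM.
rewrite /autj in j0 *; field => //.
Qed.

(** The lattice of [mobius g z] is the lattice of z divided by [autj g z]; [act_row] merely permutes
    its elements, and a lattice exponential is homogeneous of degree 1. *)
Lemma lamexp_mobius g z w : g \in unitmx -> Omega z ->
  lamexp (mobius g z) (w / autj g z) = lamexp z w / autj g z.
Proof.
move=> gu hz; set j := autj g z; have j0 : j != 0 by apply: autj_neq0.
have vj : 0 < v j by rewrite abs_gt0.
have gK i : act_row (invmx g) (act_row g i) = i by rewrite act_rowM mulmxV // act_row1.
have gK' i : act_row g (act_row (invmx g) i) = i by rewrite act_rowM mulVmx // act_row1.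
apply: latexp_netE; first exact: polyN2_uniq.
- exact: polyN2_sub.
(* Properness of the new lattice is transported from that of z by the same permutation. *)
- move=> B; have [N hN] := latform_proper (B * v j) hz.
  have [M hM] := polyN2_bound [seq act_row (invmx g) i | i <- polyN2 N].
  exists M => i hi; rewrite latform_mobius // abs_div ler_pdivlMr //.
  apply: hN; apply: contra hi => hi; apply: hM; rewrite -[i]gK.
  exact: map_f.
move=> e e0 N.
have e1 : 0 < e * v j by rewrite mulr_gt0.
have := latexp_net polyN2_uniq polyN2_sub (fun B => latform_proper B hz) w e1.
move=> [N1 hN1]; have [N2 hN2] := polyN2_bound [seq act_row g i | i <- polyN2 N].
pose N3 := maxn N1 N2.
exists [seq act_row (invmx g) i | i <- polyN2 N3]; split.
- by rewrite map_inj_uniq ?polyN2_uniq //; apply: can_inj gK'.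
- move=> i hi; rewrite -[i]gK; apply: map_f; apply: (polyN2_sub (leq_maxr N1 N2)).
  by apply: hN2; apply: map_f.
have -> : latprod (latform (mobius g z)) [seq act_row (invmx g) i | i <- polyN2 N3] (w / j) =
    latprod (latform z) (polyN2 N3) w / j.
  rewrite /latprod big_map mulrAC; congr (_ * _ / _); apply: eq_bigr => i _.
  rewrite latform_mobius // gK' -/j invfM invrK.
  by rewrite [_^-1 * j]mulrC mulrA divfK.
rewrite -mulrBl abs_div ltr_pdivrMr //; apply: hN1; first exact: polyN2_uniq.
by apply: polyN2_sub; rewrite leq_maxl.
Qed.

(** * The Moore determinant of the [T]-division points *)

Definition moore z : C :=
  let e1 := lamexp z (z / T) in let e2 := lamexp z T^-1 in
  e2 * e1 ^+ q - e2 ^+ q * e1.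

Lemma poly_split0 a : exists b, a = (a`_0)%:P + 'X * b.
Proof.
exists (\poly_(i < size a) a`_i.+1); apply/polyP => i; rewrite coefD coefC coefXM coef_poly.
case: i => [|i] /=; rewrite ?addr0 // add0r; case: ltnP => // hi.
by rewrite nth_default // leqW.
Qed.

(** Modulo the lattice, a T-division point depends only on the residues of a and b modulo T. *)
Lemma lamexp_division z a b : Omega z ->
  lamexp z ((iA C a * z + iA C b) / T) =
  ic C a`_0 * lamexp z (z / T) + ic C b`_0 * lamexp z T^-1.
Proof.
move=> hz; have [hD hZ] := lamexp_linear hz.
have [a' Ea] := poly_split0 a; have [b' Eb] := poly_split0 b.
have -> : (iA C a * z + iA C b) / T =
    ic C a`_0 * (z / T) + ic C b`_0 * T^-1 + latform z (a', b').
  rewrite {1}Ea {1}Eb /latform /= !rmorphD !rmorphM /= -!/(ic C _).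
  by field; exact: iAX_neq0.
by rewrite hD lamexp_latform addr0 hD !hZ.
Qed.

(** By [lamexp_division], g acts on the two division points through its reduction modulo T, whose
    entries are fixed by Frobenius, so the Moore determinant is multiplied by the determinant of the
    reduction. This is det g itself, which is a constant. The scaling by 1 / j in degrees 1 and q
    gives the weight q + 1. *)
Lemma moore_mobius g z : g \in unitmx -> Omega z ->
  moore (mobius g z) = iA C (\det g) / autj g z ^+ q.+1 * moore z.
Proof.
move=> gu hz; set j := autj g z; have j0 : j != 0 by apply: autj_neq0.
have h1 : lamexp (mobius g z) (mobius g z / T) =
    (ic C (g 0 0)`_0 * lamexp z (z / T) + ic C (g 0 1)`_0 * lamexp z T^-1) / j.
  by rewrite -lamexp_division // -lamexp_mobius // /mobius -/(autj g z) -/j mulrAC.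
have h2 : lamexp (mobius g z) T^-1 =
    (ic C (g 1 0)`_0 * lamexp z (z / T) + ic C (g 1 1)`_0 * lamexp z T^-1) / j.
  by rewrite -lamexp_division // -lamexp_mobius // -/(autj g z) -/j mulrAC mulfV // mul1r.
have hdet : iA C (\det g) = ic C (g 0 0)`_0 * ic C (g 1 1)`_0
                           - ic C (g 0 1)`_0 * ic C (g 1 0)`_0.
  have : size (\det g) == 1%N.
    by move: gu; rewrite unitmxE poly_unitE => /andP[].
  move=> /size_poly1P[k k0 hk]; rewrite -!rmorphM -rmorphB /ic; congr (iA C _).
  rewrite hk; congr (_%:P); have := congr1 (fun p : {poly Fq} => p`_0) hk.
  by rewrite det2E coefB !coef0M coefC /= => <-.
rewrite /moore h1 h2 hdet !exprMn !FrobeniusD !exprMn !icXq exprVn exprS.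
have jq : j ^+ q != 0 by rewrite expf_neq0.
by field; rewrite jq.
Qed.

Lemma moore_prod z : Omega z ->
  moore z = lamexp z T^-1 * \prod_(e : Fq) lamexp z ((z - ic C e) / T).
Proof.
move=> hz; rewrite /moore; set e1 := lamexp z (z / T); set e2 := lamexp z T^-1.
rewrite (eq_bigr (fun e => e1 - ic C e * e2)) => [|e _].
  have -> : e2 ^+ q = e2 * e2 ^+ q.-1 by rewrite -exprS prednK ?q_gt0.
  by rewrite prod_sub_ic mulrBr mulrA.
have := lamexp_division 1 (- e%:P) hz.
by rewrite rmorph1 mul1r rmorphN /= -/(ic C e) => ->; rewrite coef1 coefN coefC /= rmorph1 mul1r rmorphN mulNr.
Qed.

(** Every factor in [moore_prod] is the lattice exponential at a T-division point that is not in the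
    lattice: by [key], lying in the lattice would force both coordinates of the numerator to be
    divisible by T. *)
Lemma moore_neq0 z : Omega z -> moore z != 0.
Proof.
have key c d i : Omega z -> (iA C c * z + iA C d) / T = latform z i -> c`_0 = 0 /\ d`_0 = 0.
  move=> hz; rewrite /latform => h.
  have h' : latform z (c - 'X * i.1, d - 'X * i.2) = 0.
    rewrite /latform /= !rmorphB !rmorphM.
    transitivity (iA C c * z + iA C d - T * (iA C i.1 * z + iA C i.2)); first by ring.
    by rewrite -h [T * _]mulrC divfK ?subrr ?iAX_neq0.
  have : (c - 'X * i.1, d - 'X * i.2) == 0.
    by apply: contraT => /(latform_neq0 hz); rewrite h' eqxx.
  move=> /eqP[/eqP h1 /eqP h2]; rewrite !subr_eq0 in h1 h2.
  by rewrite (eqP h1) (eqP h2) !coefXM.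
move=> hz; rewrite moore_prod // mulf_neq0 //.
  apply: lamexp_neq0 => // i; apply/negP => /eqP h.
  have := key 0 1 i hz; rewrite rmorph0 mul0r add0r rmorph1 mul1r => /(_ h)[_].
  by rewrite coef1 => /eqP; rewrite oner_eq0.
apply/prodf_neq0 => e _; apply: lamexp_neq0 => // i; apply/negP => /eqP h.
have := key 1 (- e%:P) i hz; rewrite rmorph1 mul1r rmorphN /= => /(_ h)[].
by rewrite coef1 => /eqP; rewrite oner_eq0.
Qed.

End HalfPlane.

(** * Power series on open discs *)

Section PowerSeries.
Variables (Fq : finFieldType) (R : realType) (C : Cinfty Fq R).
Local Notation v := (@Cabs Fq R C).
Implicit Types (t x y : C) (f g u : C -> C) (a b : nat -> C) (rho B : R).

(** [B] bounds the Gauss norm on the disc of radius [rho]. Carrying it in the predicate gives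
    quantitative control through products, inverses and limits; the values of [f] outside the open
    disc are left free. *)
Definition power_series rho B f : Prop :=
  exists a, (forall j, v (a j) * rho ^+ j <= B) /\
    forall t, v t < rho -> vcvg v (fun N => \sum_(j < N) a j * t ^+ j) (f t).

Lemma power_series_ext rho B f g : (forall t, v t < rho -> f t = g t) ->
  power_series rho B f -> power_series rho B g.
Proof. by move=> h [a [h1 h2]]; exists a; split=> // t ht; rewrite -h //; apply: h2. Qed.

Lemma power_series_le rho B B' f : B <= B' -> power_series rho B f -> power_series rho B' f.
Proof. by move=> h [a [h1 h2]]; exists a; split=> // j; apply: le_trans h. Qed.

Lemma power_series_ge0 rho B f : power_series rho B f -> 0 <= B.
Proof. by move=> [a [/(_ 0%N) h _]]; apply: le_trans h; rewrite expr0 mulr1 Cabs_ge0. Qed.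

Lemma power_series_bound rho B f t : power_series rho B f -> v t < rho -> v (f t) <= B.
Proof.
move=> hf; have B0 := power_series_ge0 hf; have [a [h1 h2]] := hf => ht.
apply: (vcvg_abs_le (N := 0) (h2 _ ht)) => N _; apply: abs_sum_le => // j _.
apply: le_trans (h1 j); rewrite CabsM absX ler_wpM2l ?Cabs_ge0 //.
have rho0 : 0 <= rho by apply: le_trans (Cabs_ge0 _) (ltW ht).
by apply: lerXn2r; rewrite ?nnegrE ?Cabs_ge0 // ltW.
Qed.

Lemma vcvg_finite N0 (u : nat -> C) (l : C) :
  (forall k, (N0 <= k)%N -> u k = l) -> vcvg v u l.
Proof. by move=> h; apply: (vcvg_near (N := N0)) (vcvg_cst l) => k /h. Qed.

Lemma power_series_cst rho c : 0 < rho -> power_series rho (v c) (fun=> c).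
Proof.
move=> r0; exists (fun j => if j == 0%N then c else 0); split=> [[|j] /=|t ht].
- by rewrite expr0 mulr1.
- by rewrite abs0 mul0r Cabs_ge0.
apply: (vcvg_finite (N0 := 1)) => -[//|N] _; rewrite big_ord_recl /= expr0 mulr1.
by rewrite big1 ?addr0 // => i _; rewrite mul0r.
Qed.

Lemma power_series_id rho : 0 < rho -> power_series rho rho id.
Proof.
move=> r0; exists (fun j => if j == 1%N then 1 else 0); split=> [[|[|j]] /=|t ht].
- by rewrite abs0 mul0r ltW.
- by rewrite abs1 mul1r expr1.
- by rewrite abs0 mul0r ltW.
apply: (vcvg_finite (N0 := 2)) => -[//|[//|N]] _.
rewrite !big_ord_recl /= mul0r add0r mul1r expr1.
by rewrite big1 ?addr0 // => i _; rewrite mul0r.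
Qed.

Lemma power_series0 rho B : 0 < rho -> 0 <= B -> power_series rho B (fun=> 0).
Proof.
by move=> r0 B0; apply: (power_series_le _ (power_series_cst 0 r0)); rewrite abs0.
Qed.

Lemma power_seriesD rho B f g : 0 < rho ->
  power_series rho B f -> power_series rho B g -> power_series rho B (fun t => f t + g t).
Proof.
move=> r0 [a [ha1 ha2]] [b [hb1 hb2]]; exists (fun j => a j + b j); split=> [j|t ht].
  rewrite -ler_pdivlMr ?exprn_gt0 //; apply: absD_le; rewrite ler_pdivlMr ?exprn_gt0 //.
apply: vcvg_ext (vcvgD (ha2 t ht) (hb2 t ht)) => N.
by rewrite -big_split; apply: eq_bigr => j _; rewrite mulrDl.
Qed.

Lemma power_seriesN rho B f : power_series rho B f -> power_series rho B (fun t => - f t).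
Proof.
move=> [a [ha1 ha2]]; exists (fun j => - a j); split=> [j|t ht]; first by rewrite absN.
by apply: vcvg_ext (vcvgN (ha2 t ht)) => N; rewrite -sumrN; apply: eq_bigr => j _; rewrite mulNr.
Qed.

Lemma power_seriesB rho B f g : 0 < rho ->
  power_series rho B f -> power_series rho B g -> power_series rho B (fun t => f t - g t).
Proof. by move=> r0 hf /power_seriesN; apply: power_seriesD. Qed.

Lemma geometric_small (th B : R) : 0 <= th -> th < 1 -> forall e, 0 < e ->
  exists N, forall k, (N <= k)%N -> B * th ^+ k < e.
Proof.
move=> t0 t1 e e0; have [->|tn0] := eqVneq th 0.
  by exists 1%N => -[//|k] _; rewrite expr0n mulr0.
have tp : 0 < th by rewrite lt0r tn0.
pose h := th^-1 - 1; have h0 : 0 < h by rewrite subr_gt0 invf_gt1.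
have bern k : k%:R * h <= th ^- k.
  suff : 1 + k%:R * h <= th ^- k by move=> h1; apply: le_trans h1; rewrite lerDr ler01.
  elim: k => [|k IH]; first by rewrite mul0r addr0 expr0 invr1.
  rewrite exprS invfM; have -> : th^-1 = 1 + h by rewrite /h addrC subrK.
  have kh : 0 <= k%:R * h by rewrite mulr_ge0 // ltW.
  apply: le_trans (_ : (1 + h) * (1 + k%:R * h) <= _).
    by rewrite -natr1; nra.
  by rewrite ler_wpM2l // addr_ge0 // ltW.
pose N := Num.bound (`|B| / (e * h)); exists N => k hk.
have thk : 0 < th ^+ k by rewrite exprn_gt0.
rewrite -ltr_pdivlMr //; apply: lt_le_trans (_ : e * (k%:R * h) <= _); last first.
  by rewrite ler_wpM2l ?(ltW e0).
apply: le_lt_trans (ler_norm B) _; rewrite mulrCA -ltr_pdivrMr ?mulr_gt0 //.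
apply: lt_le_trans (archi_boundP _) _; first by rewrite divr_ge0 // mulr_ge0 ?ltW.
by rewrite ler_nat.
Qed.

Lemma power_seriesM rho B B' f g : 0 < rho ->
  power_series rho B f -> power_series rho B' g ->
  power_series rho (B * B') (fun t => f t * g t).
Proof.
move=> r0 hf hg; have B0 := power_series_ge0 hf; have B'0 := power_series_ge0 hg.
have [a [ha1 ha2]] := hf; have [b [hb1 hb2]] := hg.
have term i j : v (a i * b j) * rho ^+ (i + j) <= B * B'.
  rewrite CabsM exprD mulrACA; by apply: ler_pM; rewrite ?mulr_ge0 ?Cabs_ge0 ?exprn_ge0 ?(ltW r0).
have rX k : 0 < rho ^+ k by rewrite exprn_gt0.
exists (fun j => \sum_(i < j.+1) a i * b (j - i)%N); split=> [j|t ht].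
  rewrite -ler_pdivlMr //; apply: abs_sum_le; first by rewrite divr_ge0 ?mulr_ge0 ?(ltW (rX _)).
  move=> i _; rewrite ler_pdivlMr //; apply: le_trans (term i (j - i)%N).
  by rewrite subnKC // -ltnS.
have th0 : 0 <= v t / rho by rewrite divr_ge0 ?Cabs_ge0 // ltW.
have th1 : v t / rho < 1 by rewrite ltr_pdivrMr // mul1r.
(* The product of two partial sums differs from the partial sum of the Cauchy product only in
   degrees at least N, where each term is at most B B' (|t| / rho)^N. *)
have sm : vcvg v (fun N => (\sum_(j < N) a j * t ^+ j) * (\sum_(j < N) b j * t ^+ j)
    - \sum_(j < N) (\sum_(i < j.+1) a i * b (j - i)%N) * t ^+ j) 0.
  move=> e e0; have [N hN] := geometric_small (B * B') th0 th1 e0.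
  exists N => k /hN; rewrite subr0; apply: le_lt_trans.
  pose P := \poly_(j < k) a j; pose Q := \poly_(j < k) b j.
  have -> : (\sum_(j < k) a j * t ^+ j) = P.[t] by rewrite horner_poly.
  have -> : (\sum_(j < k) b j * t ^+ j) = Q.[t] by rewrite horner_poly.
  rewrite -hornerM (@horner_coef_wide _ (k + k)); last first.
    apply: leq_trans (size_polyMleq _ _) _; apply: leq_trans (leq_pred _) _.
    by rewrite leq_add // size_poly.
  rewrite big_split_ord /=; set S1 := \sum_(i < k) _; set S2 := \sum_(i < k) _.
  have -> : \sum_(j < k) (\sum_(i < j.+1) a i * b (j - i)%N) * t ^+ j = S1.
    apply: eq_bigr => j _; congr (_ * _); rewrite coefM; apply: eq_bigr => i _.
    rewrite !coef_poly (leq_ltn_trans _ (ltn_ord j)) ?(leq_ltn_trans _ (ltn_ord j)) //.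
      exact: leq_subr.
    by rewrite -ltnS.
  rewrite addrAC subrr add0r; apply: abs_sum_le.
    by rewrite !mulr_ge0 ?exprn_ge0 ?divr_ge0 ?Cabs_ge0 // ltW.
  move=> i _; rewrite CabsM absX.
  have h1 : v (P * Q)`_(k + i) <= B * B' / rho ^+ (k + i).
    rewrite coefM; apply: abs_sum_le; first by rewrite divr_ge0 ?mulr_ge0 ?(ltW (rX _)).
    move=> l _; rewrite ler_pdivlMr // !coef_poly.
    have [hl|_] := ltnP l k; last by rewrite mul0r abs0 mul0r mulr_ge0.
    have [hl'|_] := ltnP (k + i - l) k; last by rewrite mulr0 abs0 mul0r mulr_ge0.
    by apply: le_trans (term l (k + i - l)%N); rewrite subnKC // -ltnS.
  apply: le_trans (ler_wpM2r _ h1) _; first by rewrite exprn_ge0 ?Cabs_ge0.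
  rewrite mulrAC -[X in X <= _]mulrA -expr_div_n ler_wpM2l ?mulr_ge0 //.
  by rewrite exprD ler_piMr ?exprn_ge0 // exprn_ile1 // ltW.
have := vcvgB (vcvgM (ha2 t ht) (hb2 t ht)) sm; rewrite subr0.
by apply: vcvg_ext => N /=; rewrite subKr.
Qed.

Lemma power_seriesZ rho B c f : 0 < rho ->
  power_series rho B f -> power_series rho (v c * B) (fun t => c * f t).
Proof. by move=> r0; apply/power_seriesM/power_series_cst. Qed.

Lemma power_seriesX rho B f k : 0 < rho ->
  power_series rho B f -> power_series rho (B ^+ k) (fun t => f t ^+ k).
Proof.
move=> r0 hf; elim: k => [|k IH].
  by rewrite expr0 -(abs1 C); apply: (power_series_cst 1).
by rewrite exprS; apply: power_series_ext (power_seriesM r0 hf IH) => t _; rewrite exprS.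
Qed.

Lemma power_series_prod1 rho B I (s : seq I) (P : pred I) (F : I -> C -> C) :
  0 < rho -> 0 <= B -> B <= 1 ->
  (forall i, P i -> power_series rho B (fun t => F i t - 1)) ->
  power_series rho B (fun t => \prod_(i <- s | P i) F i t - 1).
Proof.
move=> r0 B0 B1 h; elim: s => [|i s IH].
  by apply: power_series_ext (power_series0 r0 B0) => t _; rewrite big_nil subrr.
have [Pi|nPi] := boolP (P i); last first.
  by apply: power_series_ext IH => t _; rewrite big_cons (negbTE nPi).
have h2 := power_seriesM r0 (h i Pi) IH.
have h3 : power_series rho B (fun t => (F i t - 1) * (\prod_(i <- s | P i) F i t - 1)).
  by apply: power_series_le h2; rewrite ler_piMr.
apply: power_series_ext (power_seriesD r0 h3 (power_seriesD r0 (h i Pi) IH)) => t _.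
by rewrite big_cons Pi; ring.
Qed.

(** Completeness for the Gauss norm: the coefficients converge, uniformly once weighted by rho^j
    ([tail]), so the limit may be taken under the sum. *)
Lemma power_series_lim rho B (eps : nat -> R) (F : nat -> C -> C) : 0 < rho ->
  (forall e, 0 < e -> exists N, forall k, (N <= k)%N -> eps k < e) ->
  (forall k, eps k <= B) -> power_series rho B (F 0%N) ->
  (forall k, power_series rho (eps k) (fun t => F k.+1 t - F k t)) ->
  exists2 f, power_series rho B f &
    forall t, v t < rho -> vcvg v (F^~ t) (f t).
Proof.
move=> r0 heps epsB [a0 [ha0 ca0]] hd.
have rX k : 0 < rho ^+ k by rewrite exprn_gt0.
have [d hdd] := choice hd.
pose A k j := a0 j + \sum_(i < k) d i j.
have AS k j : A k.+1 j - A k j = d k j.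
  by rewrite /A big_ord_recr /=; ring.
have A0 j : A 0%N j = a0 j by rewrite /A big_ord0 addr0.
have cA k t : v t < rho -> vcvg v (fun N => \sum_(j < N) A k j * t ^+ j) (F k t).
  move=> ht; elim: k => [|k IH].
    by apply: vcvg_ext (ca0 t ht) => N; apply: eq_bigr => j _; rewrite A0.
  have := vcvgD IH ((hdd k).2 t ht); rewrite addrC subrK; apply: vcvg_ext => N.
  by rewrite -big_split; apply: eq_bigr => j _ /=; rewrite -mulrDl -AS addrC subrK.
have dle k j : v (A k.+1 j - A k j) <= eps k / rho ^+ j.
  by rewrite AS ler_pdivlMr //; apply: (hdd k).1.
have hl j : exists l, vcvg v (fun k => A k j) l.
  apply: (vcvg_ex (eps := fun k => eps k / rho ^+ j)) => // e e0.
  have [N hN] := heps (e * rho ^+ j) (mulr_gt0 e0 (rX j)).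
  by exists N => k /hN h; rewrite ltr_pdivrMr.
have [l hl'] := choice hl.
have tail (e : R) : 0 < e -> exists K, forall k j, (K <= k)%N -> v (A k j - l j) * rho ^+ j <= e.
  move=> e0; have [K hK] := heps e e0; exists K => k j hk.
  rewrite -ler_pdivlMr // abs_subC; apply: (vcvg_le (N := k) (hl' j)) => i /subnKC <-.
  elim: (i - k)%N => [|m IH]; first by rewrite addn0 subrr abs0 divr_ge0 ?ltW.
  apply: abs_chain IH; rewrite addnS; apply: le_trans (dle _ _) _.
  by rewrite ler_pM2r ?invr_gt0 //; apply/ltW/hK/(leq_trans hk)/leq_addr.
have Al k j : v (A k j) * rho ^+ j <= B.
  rewrite -ler_pdivlMr //; elim: k => [|k IH]; first by rewrite A0 ler_pdivlMr.
  rewrite -[A k.+1 j](subrK (A k j)); apply: absD_le => //; apply: le_trans (dle _ _) _.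
  by rewrite ler_pM2r ?invr_gt0.
have cF t : exists y, v t < rho -> vcvg v (F^~ t) y.
  have [ht|ht] := ltP (v t) rho; last by exists 0.
  have [//|y hy] := @vcvg_ex _ _ _ eps (F^~ t) heps; last by exists y.
  by move=> k; apply: (power_series_bound (hd k) ht).
have [f hf] := choice cF.
exists f => //; exists l; split=> [j|t ht].
  rewrite -ler_pdivlMr //; apply: (vcvg_abs_le (N := 0) (hl' j)) => k _.
  by rewrite ler_pdivlMr.
move=> e e0; have e2 : 0 < e / 2 by rewrite divr_gt0.
have lte : e / 2 < e by rewrite ltr_pdivrMr // ltr_pMr // ltr1n.
have [K hK] := tail _ e2; have [K' hK'] := hf t ht e e0.
pose k := maxn K K'; have [N hN] := cA k t ht e e0.
exists N => m hm; apply: (abs_chain_lt (y := F k t)); last by apply/hK'/leq_maxr.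
apply: (abs_chain_lt (y := \sum_(j < m) A k j * t ^+ j)); last exact: hN.
apply: le_lt_trans lte; rewrite -sumrB; apply: abs_sum_le; first exact: ltW.
move=> j _; rewrite -mulrBl CabsM absX abs_subC.
apply: le_trans (hK k j (leq_maxl _ _)); rewrite ler_wpM2l ?Cabs_ge0 //.
by apply: lerXn2r; rewrite ?nnegrE ?Cabs_ge0 ?ltW.
Qed.

Lemma power_series_inv1B rho B u : 0 < rho -> B < 1 ->
  power_series rho B u -> power_series rho 1 (fun t => (1 - u t)^-1).
Proof.
move=> r0 B1 hu; have B0 := power_series_ge0 hu.
pose F k t := \sum_(i < k.+1) u t ^+ i.
have [||||f hf cf] := @power_series_lim rho 1 (fun k => B ^+ k.+1) F r0.
- move=> e e0; have [N hN] := geometric_small 1 B0 B1 e0; exists N => k hk.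
  by rewrite -[_ ^+ _]mul1r; apply: hN; apply: leqW.
- by move=> k; rewrite exprn_ile1 // ltW.
- rewrite -(abs1 C); apply: power_series_ext (power_series_cst 1 r0) => t _.
  by rewrite /F big_ord1 expr0.
- move=> k; apply: power_series_ext (power_seriesX k.+1 r0 hu) => t _.
  by rewrite /F [in RHS]big_ord_recr /= addrAC subrr add0r.
apply: power_series_ext hf => t ht; have u1 := power_series_bound hu ht.
have n0 : 1 - u t != 0.
  rewrite subr_eq0; apply/negP => /eqP E; move: (le_lt_trans u1 B1).
  by rewrite -E abs1 ltxx.
apply: (mulfI n0); rewrite mulfV //.
apply: vcvg_unique (vcvgZ (1 - u t) (cf t ht)) _.
apply: vcvg_ext (_ : vcvg v (fun k => 1 - u t ^+ k.+1) 1) => [k|].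
  rewrite /F -[LHS]opprB subrX1 -mulNr opprB; by [].
move=> e e0; have [N hN] := geometric_small 1 B0 B1 e0; exists N => k hk.
rewrite addrAC subrr sub0r absN absX; apply: le_lt_trans (hN k.+1 _); last exact: leqW.
by rewrite mul1r; apply: lerXn2r; rewrite ?nnegrE ?Cabs_ge0.
Qed.

Lemma power_series_coef0 rho f a : 0 < rho ->
  (forall t, v t < rho -> vcvg v (fun N => \sum_(j < N) a j * t ^+ j) (f t)) -> f 0 = a 0%N.
Proof.
move=> r0 h; apply: vcvg_unique (h 0 _) _; first by rewrite abs0.
apply: (vcvg_finite (N0 := 1)) => -[//|N] _; rewrite big_ord_recl /= expr0 mulr1.
by rewrite big1 ?addr0 // => i _; rewrite exprS mul0r mulr0.
Qed.

Lemma power_series_shrink rho rho' B f : 0 < rho' -> rho' <= rho ->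
  power_series rho B f -> power_series rho' B f.
Proof.
move=> r0 rr [a [h1 h2]]; exists a; split=> [j|t ht]; last exact/h2/(lt_le_trans ht).
apply: le_trans (h1 j); rewrite ler_wpM2l ?Cabs_ge0 //.
by apply: lerXn2r; rewrite ?nnegrE ?(ltW r0) // (le_trans (ltW r0)).
Qed.

(** Schwarz lemma: without a constant term, every coefficient gains at least one factor rho' /
    rho. *)
Lemma power_series_shrink0 rho rho' B f : 0 < rho' -> rho' <= rho -> f 0 = 0 ->
  power_series rho B f -> power_series rho' (B * (rho' / rho)) f.
Proof.
move=> r0 rr f0 hf; have B0 := power_series_ge0 hf; have [a [h1 h2]] := hf.
have rho0 : 0 < rho by apply: lt_le_trans rr.
have a0 : a 0%N = 0 by rewrite -(power_series_coef0 rho0 h2).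
exists a; split=> [[|j]|t ht]; last exact/h2/(lt_le_trans ht).
  by rewrite a0 abs0 mul0r mulr_ge0 ?divr_ge0 ?(ltW r0) ?(ltW rho0).
have -> : rho' ^+ j.+1 = rho ^+ j.+1 * (rho' / rho) ^+ j.+1.
  by rewrite -exprMn mulrC divfK ?gt_eqF.
have q0 : 0 <= rho' / rho by rewrite divr_ge0 ?ltW.
rewrite mulrA; apply: ler_pM; rewrite ?mulr_ge0 ?Cabs_ge0 ?exprn_ge0 ?(ltW rho0) //.
rewrite exprS ler_piMr // exprn_ile1 // ler_pdivrMr // mul1r //.
Qed.

Definition germ f : Prop := exists rho B, 0 < rho /\ power_series rho B f.
Definition unit_germ f : Prop := germ f /\ f 0 != 0.

Lemma unit_germ_cst c : c != 0 -> unit_germ (fun=> c).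
Proof. by move=> c0; split=> //; exists 1, (v c); split=> //; apply: power_series_cst. Qed.

Lemma unit_germM f g : unit_germ f -> unit_germ g -> unit_germ (fun t => f t * g t).
Proof.
move=> [[r1 [B1 [r10 h1]]] f0] [[r2 [B2 [r20 h2]]] g0]; split; last by rewrite mulf_neq0.
pose r := Num.min r1 r2; have r0 : 0 < r by rewrite lt_min r10.
exists r, (B1 * B2); split=> //; apply: power_seriesM => //.
  by apply: power_series_shrink h1; rewrite // ge_min lexx.
by apply: power_series_shrink h2; rewrite // ge_min lexx orbT.
Qed.

Lemma unit_germV f : unit_germ f -> unit_germ (fun t => (f t)^-1).
Proof.
move=> [[r [B [r0 hf]]] f0]; split; last by rewrite invr_eq0.
have B0 := power_series_ge0 hf.
pose u t := 1 - f t / f 0.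
have [B' hu] : exists B', power_series r B' u.
  exists (Num.max 1 (v (f 0)^-1 * B)); apply: power_seriesB => //.
    apply: power_series_le (power_series_cst 1 r0); by rewrite abs1 le_max lexx.
  apply: power_series_ext (fun t => (f 0)^-1 * f t) _ _ _.
    by move=> t _; rewrite mulrC.
  by apply: power_series_le (power_seriesZ _ r0 hf); rewrite le_max lexx orbT.
have B'0 := power_series_ge0 hu.
have u0 : u 0 = 0 by rewrite /u mulfV // subrr.
(* On this radius the Schwarz lemma brings the norm of [u] below B' / (B' + 1) / 2 < 1/2, so that
   the geometric series applies. *)
pose r' := Num.min r (r / (B' + 1) / 2).
have r'0 : 0 < r' by rewrite lt_min r0 !divr_gt0 ?ltr_wpDl.
have hu' := power_series_shrink0 r'0 (_ : r' <= r) u0 hu.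
have {}hu' : power_series r' 2^-1 u.
  apply: power_series_le (hu' _); last by rewrite ge_min lexx.
  apply: le_trans (_ : B' * ((B' + 1)^-1 / 2) <= _).
    rewrite ler_wpM2l // ler_pdivrMr //.
    have -> : (B' + 1)^-1 / 2 * r = r / (B' + 1) / 2 by ring.
    by rewrite ge_min lexx orbT.
  rewrite mulrA ler_piMl ?invr_ge0 // ler_pdivrMr ?ltr_wpDl // mul1r.
  by rewrite lerDl ler01.
have h2 : (2^-1 : R) < 1 by rewrite invf_lt1 ?ltr1n.
exists r', (v (f 0)^-1 * 1); split=> //.
apply: power_series_ext (power_seriesZ (f 0)^-1 r'0 (power_series_inv1B r'0 h2 hu')) => t _.
by rewrite /u subKr invfM invrK mulrCA mulVf ?mulr1.
Qed.

Lemma unit_germXz f (k : int) : unit_germ f -> unit_germ (fun t => f t ^ k).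
Proof.
have nat_case (g : C -> C) (m : nat) : unit_germ g -> unit_germ (fun t => g t ^+ m).
  move=> hg; elim: m => [|m IH].
    rewrite (_ : (fun t => _) = (fun=> 1)); last by apply/funext => t; rewrite expr0.
    by apply: unit_germ_cst; rewrite oner_neq0.
  rewrite (_ : (fun t => _) = (fun t => g t * g t ^+ m)); last by apply/funext => t; rewrite exprS.
  exact: unit_germM.
case: k => k hf; first exact: nat_case.
have := nat_case _ k.+1 (unit_germV hf).
by congr unit_germ; apply/funext => t; rewrite NegzE -exprnN exprVn.
Qed.

End PowerSeries.

(** * Expansions at infinity *)

Section Expansion.
Variables (Fq : finFieldType) (R : realType) (C : Cinfty Fq R).
Local Notation v := (@Cabs Fq R C).
Local Notation q := #|Fq|.
Local Notation qR := (#|Fq|%:R : R).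
Local Notation T := (iA C 'X).
Local Notation lam := (lam C).
Implicit Types (t x y z w : C) (a b c p : {poly Fq}) (rho B : R) (f tau : C -> C).

Definition theta : C := - T / lam ^+ q.-1.

Lemma theta_neq0 : theta != 0.
Proof. by rewrite /theta mulf_neq0 ?oppr_eq0 ?iAX_neq0 // invr_eq0 expf_neq0 // lam_neq0. Qed.

Lemma q_pred x : x ^+ q = x * x ^+ q.-1.
Proof. by rewrite -exprS prednK ?q_gt0. Qed.

Lemma cexpT_theta x : cexp (T * x) = T * cexp x + theta * cexp x ^+ q.
Proof.
have l0 : lam ^+ q.-1 != 0 by rewrite expf_neq0 // lam_neq0.
by rewrite cexpT expr_div_n q_pred /theta; field.
Qed.

(** A bound for 1 / cexp z. The first term keeps powers from growing, the second gives |lam / cexp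
    z| <= 1 in [moore_expansion], and the third makes the [u] of [inv_cexp] of norm at most q^-2 * q
    = q^-1. *)
Definition small_radius : R := Num.min (Num.min 1 (v lam)^-1) (v theta / qR ^+ 2).

Lemma small_radius_gt0 : 0 < small_radius.
Proof.
rewrite !lt_min ltr01 invr_gt0 abs_gt0 lam_neq0 divr_gt0 ?abs_gt0 ?theta_neq0 //.
by rewrite exprn_gt0 ?qR_gt0.
Qed.

Lemma small_radius_le1 : small_radius <= 1.
Proof. by rewrite !ge_min lexx. Qed.

Lemma small_radiusX B k : 0 <= B -> B <= small_radius -> (0 < k)%N -> B ^+ k <= small_radius.
Proof.
move=> B0 h; case: k => // k _; rewrite exprS; apply: le_trans (h).
by rewrite ler_piMr // exprn_ile1 //; apply: le_trans h small_radius_le1.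
Qed.

Lemma q_pred_gt0 : (0 < q.-1)%N.
Proof. by rewrite -ltnS prednK ?q_gt0 ?q_gt1. Qed.

Lemma theta_radius B : 0 <= B -> B <= small_radius -> v theta^-1 * B ^+ q.-1 <= qR ^- 2.
Proof.
move=> B0 h; have := small_radiusX B0 h q_pred_gt0; rewrite absV.
move=> h1; rewrite mulrC ler_pdivrMr ?abs_gt0 ?theta_neq0 //; apply: le_trans h1 _.
by rewrite /small_radius ge_min; apply/orP; right; rewrite mulrC.
Qed.

(* With [c = e + T b], [1 / cexp (c z)] is obtained from [1 / cexp (b z)] by
   inverting [1 + u] with [u] of norm less than 1. *)
Lemma inv_cexp rho tau c : 0 < rho -> power_series rho small_radius tau -> c != 0 ->
  exists J K B, [/\ power_series rho (qR ^- (size c).-1) J, power_series rho B K,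
    K 0 != 0, forall t, v t < rho -> tau t * J t = tau t ^+ anorm c * K t
    & forall t z, v t < rho -> tau t * cexp z = 1 -> tau t * J t * cexp (iA C c * z) = 1].
Proof.
(* Two series are carried along: [J] has the bound q^-(deg c) that makes the products over c
   converge, while [K], which does not vanish at 0, records the exact order |c| in [tau]. *)
move=> r0 htau; have [n] := ubnP (size c); elim: n c => // n IH c hn c0.
have [b Ec] := poly_split0 c; set e := c`_0 in Ec.
have [b0|b0] := eqVneq b 0.
  have e0 : e != 0 by apply: contra c0 => /eqP e0; rewrite Ec e0 b0 mulr0 addr0.
  have s1 : size c = 1%N by rewrite Ec b0 mulr0 addr0 size_polyC e0.
  exists (fun=> (ic C e)^-1), (fun=> (ic C e)^-1), 1.
  have ps : power_series rho 1 (fun=> (ic C e)^-1).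
    by rewrite -(_ : v (ic C e)^-1 = 1); [apply: power_series_cst|rewrite absV abs_ic ?invr1].
  rewrite s1 expr0 invr1; split=> //.
  - by rewrite invr_eq0 fmorph_eq0.
  - by move=> t _; rewrite /anorm s1 expn0 expr1.
  move=> t z _ h; rewrite Ec b0 mulr0 addr0 cexpZ mulrA divfK ?fmorph_eq0 //.
have sc : size c = (size b).+1.
  rewrite Ec addrC size_polyDl; first by rewrite mulrC size_mulX.
  rewrite mulrC size_mulX //; apply: leq_ltn_trans (size_polyC_leq1 _) _.
  by rewrite ltnS size_poly_gt0.
have sbn : (size b < n)%N by rewrite -ltnS -sc.
have [J [K [B [hJ hK K0 hJK hJc]]]] := IH b sbn b0.
have sb : (0 < size b)%N by rewrite size_poly_gt0.
have q1 k : qR ^- k <= 1.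
  by rewrite invf_le1 ?exprn_gt0 ?qR_gt0 // exprn_ege1 // ltW ?qR_gt1.
have J1 : power_series rho 1 J by apply: power_series_le hJ.
pose I t := tau t * J t.
have hI : power_series rho small_radius I.
  by rewrite -[small_radius]mulr1; apply: power_seriesM.
have sr0 := ltW small_radius_gt0.
have hIq := power_seriesX q.-1 r0 hI.
(* With y = cexp z and yb = cexp (b z) = 1 / I, one has cexp (c z) = theta yb^q + T yb + e y.
   Dividing by theta yb^q leaves 1 - u, because y I = J. *)
pose u t := theta^-1 * (- (I t ^+ q.-1 * (T + ic C e * J t))).
have hu : power_series rho qR^-1 u.
  have h1 : power_series rho qR (fun t => T + ic C e * J t).
    apply: power_seriesD => //; first by rewrite -(abs_iAX C); apply: power_series_cst.
    apply: power_series_le (power_seriesZ _ r0 J1); rewrite mulr1.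
    by apply: le_trans (abs_ic_le C e) _; rewrite ltW ?qR_gt1.
  apply: power_series_le (power_seriesZ theta^-1 r0 (power_seriesN (power_seriesM r0 hIq h1))).
  rewrite mulrA -ler_pdivlMr ?qR_gt0 //; apply: le_trans (theta_radius sr0 (lexx _)) _.
  by rewrite -invfM -expr2.
have qV1 : (qR)^-1 < 1 by rewrite invf_lt1 ?qR_gt0 ?qR_gt1.
have hv := power_series_inv1B r0 qV1 hu.
have u1 t : v t < rho -> 1 - u t != 0.
  move=> ht; have := le_lt_trans (power_series_bound hu ht) qV1.
  by rewrite subr_eq0; apply: contraL => /eqP<-; rewrite abs1 ltxx.
exists (fun t => theta^-1 * (I t ^+ q.-1 * (J t * (1 - u t)^-1))),
       (fun t => theta^-1 * (K t ^+ q * (1 - u t)^-1)), (v theta^-1 * (B ^+ q * 1)).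
split.
- have := power_seriesZ theta^-1 r0 (power_seriesM r0 hIq (power_seriesM r0 hJ hv)).
  apply: power_series_le; rewrite mulr1 mulrA.
  have -> : qR ^- (size c).-1 = qR^-1 * qR ^- (size b).-1.
    by rewrite sc -invfM -exprS prednK.
  rewrite ler_wpM2r ?invr_ge0 ?exprn_ge0 ?ler0n //.
  apply: le_trans (theta_radius sr0 (lexx _)) _.
  rewrite lef_pV2 ?posrE ?exprn_gt0 ?qR_gt0 // expr2 ler_peMl ?ltW ?qR_gt0 ?qR_gt1 //.
- by apply: power_seriesZ => //; apply: power_seriesM => //; apply: power_seriesX.
- rewrite mulf_neq0 ?invr_eq0 ?theta_neq0 // mulf_neq0 ?expf_neq0 // invr_eq0.
  by apply: u1; rewrite abs0.
- move=> t ht; have := hJK t ht; rewrite -/(I t) => EI.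
  have -> : anorm c = (anorm b * q)%N.
    by rewrite /anorm sc /= -{1}[size b]prednK // expnSr.
  rewrite exprM; transitivity (theta^-1 * (I t ^+ q * (1 - u t)^-1)).
    by rewrite q_pred /I; ring.
  by rewrite EI exprMn; ring.
move=> t z ht hz; have hb := hJc t z ht hz; have ut := u1 t ht.
have -> : iA C c * z = ic C e * z + T * (iA C b * z).
  by rewrite {1}Ec rmorphD rmorphM mulrDl mulrA.
rewrite cexpD cexpZ cexpT_theta.
set y := cexp z in hz *; set yb := cexp _ in hb *.
have th0 := theta_neq0.
rewrite -/(I t) in hb.
have E1 : I t ^+ q.-1 * yb ^+ q.-1 = 1 by rewrite -exprMn hb expr1n.
have -> : tau t * (theta^-1 * (I t ^+ q.-1 * (J t * (1 - u t)^-1))) *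
    (ic C e * y + (T * yb + theta * yb ^+ q)) =
    (theta^-1 * (ic C e * (tau t * y) * J t * I t ^+ q.-1 + T * I t ^+ q.-1 * (I t * yb)) +
     (I t * yb) * (I t ^+ q.-1 * yb ^+ q.-1)) * (1 - u t)^-1.
  by rewrite q_pred /I; field; rewrite th0 ut.
rewrite hz hb E1 !mulr1 /u.
have -> : theta^-1 * (ic C e * J t * I t ^+ q.-1 + T * I t ^+ q.-1) + 1 = 1 - u t.
  by rewrite /u; ring.
by rewrite mulfV.
Qed.

Lemma prod_add_ic x y : \prod_(e : Fq) (x + ic C e * y) = x ^+ q - y ^+ q.-1 * x.
Proof.
rewrite -prod_sub_ic (reindex_inj oppr_inj) /=.
by apply: eq_bigr => e _; rewrite rmorphN mulNr.
Qed.

Lemma moore_prodD z : Omega z ->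
  moore z = lamexp z T^-1 * \prod_(e : Fq) lamexp z ((z + ic C e) / T).
Proof.
move=> hz; rewrite moore_prod // (reindex_inj oppr_inj) /=.
by congr (_ * _); apply: eq_bigr => e _; rewrite rmorphN opprK.
Qed.

Lemma prod_division_factor s Y : Y != 0 ->
  \prod_(e : Fq) (1 - (s + ic C e * lam) / Y) =
  1 - lam ^+ q.-1 * Y^-1 ^+ q.-1 - (s ^+ q - lam ^+ q.-1 * s) * Y^-1 ^+ q.
Proof.
move=> Y0; rewrite (eq_bigr (fun e => (Y - s - ic C e * lam) * Y^-1)) => [|e _]; last first.
  by field.
rewrite big_split /= prod_sub_ic prodr_const FrobeniusB.
have -> : #|(xpredT : pred Fq)| = q by apply: eq_card.
rewrite !exprVn !q_pred; have Yq : Y ^+ q.-1 != 0 by rewrite expf_neq0.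
by field; rewrite ?Y0 ?Yq.
Qed.

(** The individual factors of [moore_prodD] involve s = cexp (z / T), which is not a series in tau =
    1 / cexp z. Multiplying over e leaves only s^q - lam^(q-1) s, which equals cexp z / theta. The
    terms outside the products over c then give lam / theta * cexp z, and the rest is [W]. *)
Lemma moore_expansion rho tau : 0 < rho -> power_series rho small_radius tau -> tau 0 = 0 ->
  exists W, [/\ power_series rho 1 W, W 0 = 1
    & forall t z, v t < rho -> Omega z -> tau t * cexp z = 1 ->
        tau t * moore z = lam / theta * W t].
Proof.
move=> r0 htau tau0; have th0 := theta_neq0.
have q1 k : qR ^- k <= 1.
  by rewrite invf_le1 ?exprn_gt0 ?qR_gt0 // exprn_ege1 // ltW ?qR_gt1.
have qk0 k : 0 <= qR ^- k by rewrite invr_ge0 exprn_ge0 ?ler0n.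
have exJ c : exists Jc, c != 0 -> power_series rho (qR ^- (size c).-1) Jc /\
    forall t z, v t < rho -> tau t * cexp z = 1 -> tau t * Jc t * cexp (iA C c * z) = 1.
  have [->|c0] := eqVneq c 0; first by exists (fun=> 0).
  by have [Jc [K [B [h1 _ _ _ h2]]]] := inv_cexp r0 htau c0; exists Jc.
have [J hJ] := choice exJ.
pose I c t := tau t * J c t.
(* The q + 1 factors with index c, collected by [prod_division_factor]. The large cexp z disappears
   because cexp z * I c = J c. At c = 0 the convention 1 / 0 = 0 makes them 1. *)
pose F c t := if c == 0 then 1 else (1 - lam * I c t) *
  (1 - lam ^+ q.-1 * I c t ^+ q.-1 - theta^-1 * (I c t ^+ q.-1 * J c t)).
have hF N c : c != 0 -> (N < size c)%N -> power_series rho (qR ^- N) (fun t => F c t - 1).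
  move=> c0 sc; have [hJc _] := hJ c c0.
  have {}hJc : power_series rho (qR ^- N) (J c).
    apply: power_series_le hJc; rewrite lef_pV2 ?posrE ?exprn_gt0 ?qR_gt0 //.
    rewrite ler_eXn2l ?qR_gt1 // -ltnS prednK // (leq_trans _ sc) //.
  have sr0 := ltW small_radius_gt0.
  have lsr : v lam * small_radius <= 1.
    rewrite mulrC -ler_pdivlMr ?abs_gt0 ?lam_neq0 // mul1r /small_radius.
    by rewrite !ge_min lexx orbT.
  have hI := power_seriesM r0 htau hJc.
  have hlI : power_series rho (qR ^- N) (fun t => lam * I c t).
    apply: power_series_le (power_seriesZ lam r0 hI); rewrite mulrA.
    by rewrite ler_piMl.
  have hq : (qR ^- N) ^+ q.-1 <= qR ^- N.
    have := q_pred_gt0; case: (q.-1) => // k _; rewrite exprS ler_piMr //.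
    by rewrite exprn_ile1.
  have hlIq : power_series rho (qR ^- N) (fun t => lam ^+ q.-1 * I c t ^+ q.-1).
    apply: power_series_ext (power_series_le hq (power_seriesX q.-1 r0 hlI)) => t _.
    by rewrite exprMn.
  have hI1 : power_series rho small_radius (I c).
    by apply: power_series_le hI; rewrite ler_piMr.
  have hIJ : power_series rho (qR ^- N) (fun t => theta^-1 * (I c t ^+ q.-1 * J c t)).
    apply: power_series_le (power_seriesZ _ r0 (power_seriesM r0 (power_seriesX q.-1 r0 hI1) hJc)).
    rewrite mulrA ler_piMl //; apply: le_trans (theta_radius sr0 (lexx _)) (q1 _).
  pose A t := lam * I c t.
  pose D t := lam ^+ q.-1 * I c t ^+ q.-1 + theta^-1 * (I c t ^+ q.-1 * J c t).
  have hD : power_series rho (qR ^- N) D by apply: power_seriesD.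
  have hAD : power_series rho (qR ^- N) (fun t => A t * D t).
    by apply: power_series_le (power_seriesM r0 hlI hD); rewrite ler_piMl.
  apply: power_series_ext (power_seriesB r0 hAD (power_seriesD r0 hlI hD)) => t _.
  by rewrite /F (negbTE c0) /A /D; ring.
have F1 c : power_series rho 1 (fun t => F c t - 1).
  have [->|c0] := eqVneq c 0.
    by apply: power_series_ext (@power_series0 _ _ C _ _ r0 ler01) => t _; rewrite /F eqxx subrr.
  by have := @hF 0%N c c0; rewrite expr0 invr1; apply; rewrite size_poly_gt0.
pose f N t := \prod_(c <- polyN Fq N) F c t.
have hf N : power_series rho 1 (f N).
  have h := power_series_prod1 (polyN Fq N) r0 ler01 (lexx _) (fun c (_ : xpredT c) => F1 c).
  have h1 := power_series_cst (1 : C) r0; rewrite abs1 in h1.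
  by apply: power_series_ext (power_seriesD r0 h h1) => t _; rewrite subrK.
have fS N t : f N.+1 t = f N t * \prod_(c <- polyN Fq N.+1 | c \notin polyN Fq N) F c t.
  rewrite /f (bigID (mem (polyN Fq N))) /=; congr (_ * _).
  rewrite -big_filter; apply: perm_big; apply: uniq_perm; rewrite ?filter_uniq ?polyN_uniq //.
  by move=> c; rewrite mem_filter !mem_polyN; case: (leqP (size c) N) => //= h; rewrite leqW.
have [W hW cW] : exists2 W, power_series rho 1 W &
    forall t, v t < rho -> vcvg v (f^~ t) (W t).
  apply: (@power_series_lim _ _ _ rho 1 (fun N => qR ^- N)) => //.
    by move=> e; apply: exists_qN_lt.
  move=> N; have h2 : power_series rho (qR ^- N)
      (fun t => \prod_(c <- polyN Fq N.+1 | c \notin polyN Fq N) F c t - 1).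
    apply: power_series_prod1 => // c; rewrite mem_polyN -ltnNge => sc.
    by apply: hF => //; rewrite -size_poly_gt0 (leq_ltn_trans _ sc).
  have := power_seriesM r0 (hf N) h2; rewrite mul1r; apply: power_series_ext => t _.
  by rewrite fS mulrBr mulr1.
exists W; split=> //.
  apply: vcvg_unique (cW 0 _) _; first by rewrite abs0.
  apply: vcvg_ext (vcvg_cst _) => N; rewrite /f big1 // => c _; rewrite /F /I tau0.
  case: eqP => // _; rewrite !mul0r mulr0 subr0 expr0n.
  by rewrite gtn_eqF ?q_pred_gt0 //= !mul0r !mulr0 !subr0 mulr1.
move=> t z ht hz htz.
pose Y c := cexp_mult z c; pose s := cexp (z / T).
have Es : s ^+ q - lam ^+ q.-1 * s = theta^-1 * cexp z.
  have : cexp z = T * s + theta * s ^+ q by rewrite -cexpT_theta mulrC divfK ?iAX_neq0.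
  move=> ->; rewrite /theta; have l0 : lam ^+ q.-1 != 0 by rewrite expf_neq0 // lam_neq0.
  by field; rewrite l0 oppr_eq0; exact: iAX_neq0.
have IY c : c != 0 -> (Y c)^-1 = I c t.
  move=> c0; have [_ /(_ t z ht htz)] := hJ c c0; rewrite -/(I c t) => h.
  have Y0 : Y c != 0 by apply: contraTneq (oner_neq0 C) => Y0; rewrite -h /Y in Y0 *; rewrite -[cexp _]/(cexp_mult z c) Y0 mulr0 eqxx.
  by apply: (mulIf Y0); rewrite mulVf.
have Fe c : F c t = (1 - lam / Y c) * \prod_(e : Fq) (1 - (s + ic C e * lam) / Y c).
  have [->|c0] := eqVneq c 0.
    rewrite /F eqxx /Y (lattice_map0 (cexp_mult_lattice hz)) invr0 mulr0 subr0 mul1r.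
    by rewrite big1 // => e _; rewrite mulr0 subr0.
  have Yc0 : Y c != 0 := lattice_map_neq0 (cexp_mult_lattice hz) c0.
  rewrite prod_division_factor // Es IY // /F (negbTE c0).
  have : I c t * cexp z = J c t by rewrite /I mulrAC htz mul1r.
  by rewrite [_ ^+ q]q_pred => <-; ring.
rewrite moore_prodD //.
have cl e : vcvg v (fun N => latprod Y (polyN Fq N) (s + ic C e * lam)) (lamexp z ((z + ic C e) / T)).
  rewrite lamexpE // mulrDl cexpD cexpZ; exact: cexp_mult_cvg.
have cl0 : vcvg v (fun N => latprod Y (polyN Fq N) lam) (lamexp z T^-1).
  rewrite lamexpE //; exact: cexp_mult_cvg.
have := vcvgZ (tau t) (vcvgM cl0 (vcvg_prod (index_enum Fq) (P := xpredT) (fun e _ => cl e))).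
move=> h; apply: vcvg_unique h _; apply: vcvg_ext (vcvgZ (lam / theta) (cW t ht)) => N.
rewrite /latprod big_split /= prod_add_ic Es exchange_big /= /f.
under [X in _ * X = _]eq_bigr do rewrite Fe.
rewrite big_split /=.
set P1 := \prod_(c <- _) _; set P2 := \prod_(c <- _) _.
transitivity (lam * theta^-1 * (tau t * cexp z) * (P1 * P2)); first by rewrite htz mulr1.
by ring.
Qed.

(** [inv_cexp] passes from 1 / cexp (z / l) = l t to 1 / cexp (a z / l), which has order |a| in t.
    The translation by y0 alters it by a unit factor, and [moore_expansion] applies to the
    result. *)
Lemma inv_moore_expansion (l a : {poly Fq}) y0 : l != 0 -> a != 0 ->
  exists F rho, [/\ unit_germ F, 0 < rho &
    forall z, let t := (iA C l * cexp (z / iA C l))^-1 in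
      let z' := iA C a * (z / iA C l) + y0 in
      t != 0 -> v t < rho -> Omega z' -> (moore z')^-1 = t ^+ anorm a * F t].
Proof.
move=> l0 a0; set L := iA C l; have L0 : L != 0 by rewrite iA_eq0.
have vL : 0 < v L by rewrite abs_gt0.
(* The radius makes l t smaller than [small_radius] and keeps k I at norm at most 1/2, so that 1 + k
   I is invertible. *)
pose k := cexp y0; pose m := Num.max 1 (v k); have m0 : 0 < m by rewrite lt_max ltr01.
pose rho := Num.min small_radius (2^-1 / m) / v L.
have n0 : 0 < Num.min small_radius (2^-1 / m).
  by rewrite lt_min small_radius_gt0 divr_gt0 // invr_gt0.
have r0 : 0 < rho by rewrite divr_gt0.
have Lr : v L * rho = Num.min small_radius (2^-1 / m) by rewrite mulrC divfK ?gt_eqF.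
pose tau0 t := L * t.
have htau0 : power_series rho (v L * rho) tau0 by apply/power_seriesZ/power_series_id.
have htau0' : power_series rho small_radius tau0.
  by apply: power_series_le htau0; rewrite Lr ge_min lexx.
have [J [K [B [hJ hK K0 hJK hJc]]]] := inv_cexp r0 htau0' a0.
have q1 j : qR ^- j <= 1.
  by rewrite invf_le1 ?exprn_gt0 ?qR_gt0 // exprn_ege1 // ltW ?qR_gt1.
pose I t := tau0 t * J t.
have hI : power_series rho (v L * rho) I.
  apply: power_series_le (power_seriesM r0 htau0 hJ).
  by rewrite ler_piMr // mulr_ge0 // ltW.
have hkI : power_series rho 2^-1 (fun t => - k * I t).
  apply: power_series_le (power_seriesZ _ r0 hI); rewrite absN Lr.
  apply: le_trans (_ : m * (2^-1 / m) <= _); last by rewrite mulrC divfK ?gt_eqF.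
  apply: ler_pM; rewrite ?Cabs_ge0 ?(ltW n0) ?le_max ?ge_min ?lexx ?orbT //.
have h2 : (2^-1 : R) < 1 by rewrite invf_lt1 ?ltr1n.
have hv := power_series_inv1B r0 h2 hkI.
(* By additivity cexp z' = 1 / I + k, whose inverse is I / (1 + k I). *)
pose tau t := I t * (1 - - k * I t)^-1.
have htau : power_series rho small_radius tau.
  apply: power_series_le (power_seriesM r0 hI hv).
  by rewrite mulr1 Lr ge_min lexx.
have tau_0 : tau 0 = 0 by rewrite /tau /I /tau0 mulr0 !mul0r.
have [W [hW W0 hM]] := moore_expansion r0 htau tau_0.
have I0 : I 0 = 0 by rewrite /I /tau0 mulr0 mul0r.
exists (fun t => L ^+ anorm a * (theta / lam) * K t * (1 - - k * I t)^-1 * (W t)^-1), rho.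
split=> //.
  apply: unit_germM; last first.
    by apply: unit_germV; split; [exists rho, 1 | rewrite W0 oner_neq0].
  apply: unit_germM; last first.
    split; first by exists rho, 1.
    by rewrite I0 mulr0 subr0 invr1 oner_neq0.
  apply: unit_germM; last by split=> //; exists rho, B.
  apply: unit_germ_cst; rewrite mulf_neq0 ?expf_neq0 //.
  by rewrite mulf_neq0 ?theta_neq0 // invr_eq0 lam_neq0.
move=> z t z' t0 ht hz'.
have e0 : tau0 t * cexp (z / L) = 1.
  move: t0; rewrite /tau0 /t invr_eq0 mulf_eq0 negb_or => /andP[_ c0].
  by rewrite invfM mulrA mulfV // mul1r mulVf.
have e1 := hJc t _ ht e0; rewrite -/(I t) in e1.
have u0 : 1 - - k * I t != 0.
  have := le_lt_trans (power_series_bound hkI ht) h2.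
  by rewrite subr_eq0; apply: contraL => /eqP<-; rewrite abs1 ltxx.
have e2 : tau t * cexp z' = 1.
  rewrite /tau /z' cexpD -/k mulrAC mulrDr e1.
  have -> : 1 + I t * k = 1 - - k * I t by ring.
  by rewrite mulfV.
have E := hM t z' ht hz' e2.
have tau_n0 : tau t != 0 by apply: contra_eq_neq e2 => ->; rewrite mul0r eq_sym oner_neq0.
have mz := moore_neq0 hz'.
have lam0 := lam_neq0 C; have th0 := theta_neq0.
have Wt0 : W t != 0.
  have : tau t * moore z' != 0 by rewrite mulf_neq0.
  by rewrite E mulf_eq0 negb_or => /andP[].
have EJ := hJK t ht; rewrite -/(I t) in EJ.
have -> : (moore z')^-1 = tau t * (theta / lam) * (W t)^-1.
  apply: (mulfI (mulf_neq0 tau_n0 mz)); rewrite {1}mulfK // E.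
  by field; rewrite th0 lam0 Wt0.
rewrite /tau /=; set V := (1 - _)^-1.
by rewrite EJ /tau0 exprMn; ring.
Qed.

End Expansion.

(** * Stabilizers of the cusps *)

Section Stabilizer.
Variable (Fq : finFieldType).
Implicit Types (n d u w b k : {poly Fq}) (g : 'M[{poly Fq}]_2).

Lemma detg_neq0 g : g \in unitmx -> \det g != 0.
Proof. by rewrite unitmxE; apply: contraTneq => ->; rewrite unitr0. Qed.

Lemma invmx2_col0 g : g \in unitmx ->
  invmx g 0 0 = (\det g)^-1 * g 1 1 /\ invmx g 1 0 = - ((\det g)^-1 * g 1 0).
Proof.
move=> gu; have := congr1 (fun M : 'M_2 => M 0 0) (mulmxV gu).
have := congr1 (fun M : 'M_2 => M 1 0) (mulmxV gu).
rewrite !mulmx2E !mxE /= => h1 h2.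
have du : \det g \is a GRing.unit by rewrite -unitmxE.
split; apply: (mulrI du).
  rewrite mulrA divrr // mul1r det2E -[RHS]mulr1 -[X in _ = _ * X]h2.
  have -> : g 1 1 * (g 0 0 * invmx g 0 0 + g 0 1 * invmx g 1 0) =
    (g 0 0 * g 1 1 - g 0 1 * g 1 0) * invmx g 0 0 +
    g 0 1 * (g 1 0 * invmx g 0 0 + g 1 1 * invmx g 1 0) by ring.
  by rewrite h1 mulr0 addr0.
rewrite mulrN mulrA divrr // mul1r det2E -[X in _ = - X]mulr1 -[X in _ = - (_ * X)]h2.
have -> : - (g 1 0 * (g 0 0 * invmx g 0 0 + g 0 1 * invmx g 1 0)) =
    (g 0 0 * g 1 1 - g 0 1 * g 1 0) * invmx g 1 0 -
    g 0 0 * (g 1 0 * invmx g 0 0 + g 1 1 * invmx g 1 0) by ring.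
by rewrite h1 mulr0 subr0.
Qed.

Lemma cusp_stabE n g (e : Fq) b : g \in unitmx ->
  cusp_stab n g e b = (e != 0) && (n %| g 1 0 * (g 1 1 * (e - 1)%:P - g 1 0 * b)).
Proof.
move=> gu; rewrite /cusp_stab /Gamma0 !unitmx_mul unitmx_inv gu andbT /=.
congr (_ && _).
  rewrite unitmxE det2E !mxE /= mulr1 mulr0 subr0 poly_unitE size_polyC coefC /=.
  by rewrite unitfE; case: (e == 0).
have [h0 h1] := invmx2_col0 gu; rewrite !mulmx2E h0 h1 !mxE /=.
have du : \det g \is a GRing.unit by rewrite -unitmxE.
have -> : (g 1 0 * e%:P + g 1 1 * 0) * ((\det g)^-1 * g 1 1) +
     (g 1 0 * b + g 1 1 * 1) * - ((\det g)^-1 * g 1 0) =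
   (\det g)^-1 * (g 1 0 * (g 1 1 * (e - 1)%:P - g 1 0 * b)).
  by rewrite rmorphB /=; ring.
have : (\det g)^-1 \is a GRing.unit by rewrite unitrV.
rewrite poly_unitE => /andP[/size_poly1P[k k0 ->] _].
by rewrite mul_polyC dvdpZr.
Qed.

Lemma dvdp_mul_gcd n k b : n != 0 -> (n %| k * b) = (n %/ gcdp n k %| b).
Proof.
move=> n0; have g0 : gcdp n k != 0 by rewrite gcdp_eq0 negb_and n0.
have En : n %/ gcdp n k * gcdp n k = n by rewrite divpK ?dvdp_gcdl.
have Ek : k %/ gcdp n k * gcdp n k = k by rewrite divpK ?dvdp_gcdr.
transitivity ((n %/ gcdp n k * gcdp n k) %| (k %/ gcdp n k * gcdp n k) * b).
  by rewrite En Ek.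
rewrite mulrAC dvdp_mul2r // Gauss_dvdpr //.
by rewrite coprimep_div_gcd // n0.
Qed.

Lemma polyN_multiples N (l : {poly Fq}) : l != 0 ->
  perm_eq [seq b <- polyN Fq (N + (size l).-1) | l %| b] [seq l * a | a <- polyN Fq N].
Proof.
move=> l0; apply: uniq_perm; first by rewrite filter_uniq ?polyN_uniq.
  by rewrite map_inj_uniq ?polyN_uniq //; apply: mulfI.
move=> b; rewrite mem_filter mem_polyN; apply/andP/mapP.
  move=> [lb sb]; exists (b %/ l); last by rewrite mulrC divpK.
  by rewrite mem_polyN size_divp // leq_subLR addnC.
move=> [a]; rewrite mem_polyN => ha ->; split; first exact: dvdp_mulIl.
have [->|a0] := eqVneq a 0; first by rewrite mulr0 size_poly0.
rewrite size_mul //; move: l0; rewrite -size_poly_gt0 => sl.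
by rewrite -[size l in X in (X <= _)%N]prednK //= addnC leq_add2r.
Qed.

(** The width of the cusp g(oo): n divides u^2 b exactly when this quotient divides b. *)
Definition stab_gen n g := n %/ gcdp n (g 1 0 ^+ 2).

Lemma cusp_stab_gen n g b : n != 0 -> g \in unitmx ->
  cusp_stab n g 1 b = (stab_gen n g %| b).
Proof.
move=> n0 gu; rewrite cusp_stabE // oner_neq0 subrr polyC0 mulr0 sub0r mulrN dvdpNr.
by rewrite mulrA -expr2 dvdp_mul_gcd.
Qed.

Lemma stab_gen_neq0 n g : n != 0 -> stab_gen n g != 0.
Proof. by move=> n0; rewrite dvdp_div_eq0 ?dvdp_gcdl. Qed.

Lemma unitmx_coprime_col0 g : g \in unitmx -> coprimep (g 0 0) (g 1 0).
Proof.
move=> gu; apply/Bezout_coprimepP; exists (g 1 1, - g 0 1) => /=.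
have : size (\det g) == 1%N by move: gu; rewrite unitmxE poly_unitE => /andP[].
by rewrite det2E size_poly_eq1 mulNr [g 1 1 * _]mulrC.
Qed.

Lemma unitmx_coprime_row1 g : g \in unitmx -> coprimep (g 1 1) (g 1 0).
Proof.
move=> gu; apply/Bezout_coprimepP; exists (g 0 0, - g 0 1) => /=.
have : size (\det g) == 1%N by move: gu; rewrite unitmxE poly_unitE => /andP[].
by rewrite det2E size_poly_eq1 mulNr.
Qed.

Lemma Bezout1 (a b : {poly Fq}) : coprimep a b -> exists x y, x * a + y * b = 1.
Proof.
move=> /Bezout_eq1_coprimepP[[x y] /= h]; by exists x, y.
Qed.

Definition mx2 (a b c d : {poly Fq}) : 'M[{poly Fq}]_2 :=
  \matrix_(i, j) if i == 0 then (if j == 0 then a else b) else (if j == 0 then c else d).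

Lemma mx2_unit a b c d : a * d - b * c = 1 -> mx2 a b c d \in unitmx.
Proof. by move=> h; rewrite unitmxE det2E !mxE /= h unitr1. Qed.

Lemma det_mx2 a b c d : \det (mx2 a b c d) = a * d - b * c.
Proof. by rewrite det2E !mxE. Qed.

Lemma mx2E a b c d : (mx2 a b c d 0 0 = a) * (mx2 a b c d 0 1 = b) *
  (mx2 a b c d 1 0 = c) * (mx2 a b c d 1 1 = d).
Proof. by rewrite !mxE. Qed.

(* [diag(d, 1) g = gam (al be ; 0 de)] with [gam] in [SL_2(A)]. *)
Lemma hermite_diag d g : d != 0 -> g \in unitmx ->
  exists (gam : 'M[{poly Fq}]_2) (be de : {poly Fq}), let al := gcdp d (g 1 0) in
  [/\ gam \in unitmx, \det gam = 1, al * de = d * \det g &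
   [/\ gam 0 0 * al = d * g 0 0, gam 0 0 * be + gam 0 1 * de = d * g 0 1,
       gam 1 0 * al = g 1 0 & gam 1 0 * be + gam 1 1 * de = g 1 1]].
Proof.
move=> d0 gu; set x := g 0 0; set y := g 0 1; set u := g 1 0; set w := g 1 1.
set al := gcdp d u; have al0 : al != 0 by rewrite gcdp_eq0 negb_and d0.
have ad : al %| d by apply: dvdp_gcdl. have au : al %| u by apply: dvdp_gcdr.
pose x' := d %/ al * x; pose u' := u %/ al.
have cop : coprimep x' u'.
  rewrite coprimepMl; apply/andP; split; first by rewrite coprimep_div_gcd // d0.
  apply: coprimep_dvdl (unitmx_coprime_col0 gu); rewrite -[X in _ %| X](divpK au).
  exact: dvdp_mulIl.
have [r [s rs]] := Bezout1 cop.
have Ex : x' * al = d * x by rewrite /x' mulrAC divpK.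
have Eu : u' * al = u by rewrite divpK.
exists (mx2 x' (- s) u' r), (r * d * y + s * w), (x' * w - u' * d * y) => /=.
rewrite !mx2E det_mx2; split.
- by apply: mx2_unit; rewrite mulNr opprK -rs; ring.
- by rewrite mulNr opprK -rs; ring.
- rewrite det2E -/x -/y -/u -/w.
  have -> : al * (x' * w - u' * d * y) = (x' * al) * w - (u' * al) * d * y by ring.
  by rewrite Ex Eu; ring.
split=> //.
  transitivity (d * y * (r * x' + s * u')); first by ring.
  by rewrite rs mulr1.
transitivity (w * (r * x' + s * u')); first by ring.
by rewrite rs mulr1.
Qed.

Lemma anorm_gt0 d : (0 < anorm d)%N.
Proof. by rewrite expn_gt0 (q_gt0 Fq). Qed.

Lemma anormM (a b : {poly Fq}) : a != 0 -> b != 0 -> anorm (a * b) = (anorm a * anorm b)%N.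
Proof.
move=> a0 b0; rewrite /anorm size_mul // -expnD; congr (_ ^ _)%N.
by move: a0 b0; rewrite -!size_poly_gt0; case: (size a) => // m; case: (size b) => // k;
  rewrite addnS addSn.
Qed.

Lemma anormX (a : {poly Fq}) (k : nat) : a != 0 -> anorm (a ^+ k) = (anorm a ^ k)%N.
Proof.
move=> a0; elim: k => [|k IH]; first by rewrite expr0 /anorm size_poly1.
by rewrite exprS anormM ?expf_neq0 // IH expnS.
Qed.

Lemma anorm_eqp (a b : {poly Fq}) : a %= b -> anorm a = anorm b.
Proof. by move=> /eqp_size E; rewrite /anorm E. Qed.

(** This makes the coefficient [a] in [moore_cusp] a polynomial. With gcd(d, u) = r d + s u, every
    term of (r d + s u)^2 n is divisible by d gcd(n, u^2). *)
Lemma stab_gen_dvd n d g : n != 0 -> d %| n ->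
  d %| gcdp d (g 1 0) ^+ 2 * stab_gen n g.
Proof.
move=> n0 dn; set u := g 1 0.
have g0 : gcdp n (u ^+ 2) != 0 by rewrite gcdp_eq0 negb_and n0.
rewrite -(@dvdp_mul2r _ (gcdp n (u ^+ 2))) // -mulrA divpK ?dvdp_gcdl //.
have [[r s] /= rs] := Bezoutp d u.
have : gcdp d u ^+ 2 %= (r * d + s * u) ^+ 2 by rewrite eqp_exp // eqp_sym.
move=> E; rewrite (eqp_dvdr _ (eqp_mulr _ E)).
have -> : (r * d + s * u) ^+ 2 * n =
  (d * (r ^+ 2 * d + r * s * u + r * s * u)) * n + (s ^+ 2) * (n * u ^+ 2) by ring.
apply: dvdp_add; last by apply: dvdp_mull; apply: dvdp_mul => //; apply: dvdp_gcdr.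
by apply: dvdp_mul; [exact: dvdp_mulr | exact: dvdp_gcdl].
Qed.

End Stabilizer.

(** * Orders at the cusps *)

Section CuspOrder.
Variables (Fq : finFieldType) (R : realType) (C : Cinfty Fq R).
Local Notation v := (@Cabs Fq R C).
Local Notation q := #|Fq|.
Local Notation qR := (#|Fq|%:R : R).
Local Notation T := (iA C 'X).
Implicit Types (t x y z w : C) (n a b c d p : {poly Fq}) (g : 'M[{poly Fq}]_2).

Lemma OmegaP z : Omega z <-> exists2 e : R, 0 < e & forall k, e <= v (z - Cemb C k).
Proof.
split=> [hz|[e e0 he] /(_ e e0) [_ [k _ <-]]]; last by rewrite ltNge he.
apply: contrapT => h; apply: hz => e e0; apply: contrapT => h2; apply: h.
exists e => // k; rewrite leNgt; apply/negP => h3; apply: h2.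
by exists (Cemb C k) => //; exists k.
Qed.

Lemma Omega_affine z (p s : {fraction {poly Fq}}) : p != 0 -> Omega z ->
  Omega (Cemb C p * z + Cemb C s).
Proof.
move=> p0 /OmegaP[e e0 he]; apply/OmegaP.
have p0' : Cemb C p != 0 by rewrite fmorph_eq0.
exists (v (Cemb C p) * e); first by rewrite mulr_gt0 // abs_gt0.
move=> k; have -> : Cemb C p * z + Cemb C s - Cemb C k =
    Cemb C p * (z - Cemb C ((k - s) / p)).
  by rewrite fmorph_div rmorphB; field.
by rewrite CabsM ler_wpM2l ?Cabs_ge0.
Qed.

Lemma Omega_scale d z : d != 0 -> Omega z -> Omega (iA C d * z).
Proof.
move=> d0 hz; have := @Omega_affine z (tofrac d) 0 _ hz.
by rewrite rmorph0 addr0; apply; rewrite -tofrac0 tofrac_eq.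
Qed.

Lemma imag_ge_Omega (r : R) z : 0 < r -> imag_ge r z -> Omega z.
Proof. by move=> r0 h /h; rewrite subrr abs0 leNgt r0. Qed.

Lemma imag_ge_le (r r' : R) z : r' <= r -> imag_ge r z -> imag_ge r' z.
Proof. by move=> h h' x /h'; apply: le_trans. Qed.

Lemma vcvg_unshift k (u : nat -> C) l : vcvg v (fun N => u (N + k)%N) l -> vcvg v u l.
Proof.
move=> h e /h[N hN]; exists (N + k)%N => m hm.
have hk : (k <= m)%N by apply: leq_trans hm; rewrite leq_addl.
by rewrite -(subnK hk); apply: hN; rewrite leq_subRL // addnC.
Qed.

Lemma exp_latticeE n g z : n != 0 -> g \in unitmx ->
  exp_lattice n g z = iA C (stab_gen n g) * cexp (z / iA C (stab_gen n g)).
Proof.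
move=> n0 gu; set l := stab_gen n g; have l0 : l != 0 by apply: stab_gen_neq0.
have L0 : iA C l != 0 by rewrite iA_eq0.
(* The multiples l a with a of degree less than N are the multiples of l of degree less than N + deg
   l, whence the shift. *)
apply: vlimE; apply: (@vcvg_unshift (size l).-1).
apply: vcvg_ext (vcvgZ (iA C l) (cexp_cvg (z / iA C l))) => N.
have pe := polyN_multiples N l0.
rewrite /latprod mulrA [iA C l * _]mulrC divfK //; congr (_ * _).
transitivity (\prod_(b <- polyN Fq (N + (size l).-1) | l %| b) (1 - z / iA C b)).
  rewrite -[RHS]big_filter (perm_big _ pe) [RHS]big_map; apply: eq_bigr => a _.
  by rewrite rmorphM invfM mulrA.
rewrite /polyN big_map big_enum_cond /= (bigID (fun b : 'rV_ _ => rVpoly b != 0)) /=.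
rewrite [X in _ * X]big1 ?mulr1; last first.
  by move=> b /andP[_]; rewrite negbK => /eqP->; rewrite rmorph0 invr0 mulr0 subr0.
by apply: eq_bigl => b; rewrite andbC cusp_stab_gen.
Qed.

Lemma t_paramE n g z : n != 0 -> g \in unitmx ->
  t_param n g z = (iA C (stab_gen n g) * cexp (z / iA C (stab_gen n g)))^-1.
Proof. by move=> n0 gu; rewrite /t_param exp_latticeE. Qed.

Lemma t_param_small n g (r : R) z : n != 0 -> g \in unitmx -> 0 < r -> imag_ge r z ->
  t_param n g z != 0 /\ v (t_param n g z) <= r^-1.
Proof.
move=> n0 gu r0 hz; rewrite t_paramE //; set L := iA C _.
have L0 : L != 0 by rewrite iA_eq0 stab_gen_neq0.
have vL : 0 < v L by rewrite abs_gt0.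
have h : r / v L <= v (cexp (z / L)).
  apply: cexp_ge; first by rewrite divr_gt0.
  move=> a; have -> : z / L - iA C a = (z - L * iA C a) / L by field.
  rewrite abs_div ler_pM2r ?invr_gt0 //; apply: hz.
  by rewrite -rmorphM; apply: range_Kinfty.
have h' : r <= v (L * cexp (z / L)) by rewrite CabsM mulrC -ler_pdivrMr.
have p := lt_le_trans r0 h'.
by rewrite invr_eq0 -abs_gt0 p absV lef_pV2 ?posrE.
Qed.

(** By [hermite_diag], d g(z) = gam((al z + be) / de) with gam in SL_2(A), so modularity reduces the
    cusp g(oo) to an expansion at infinity. The automorphy factor is kept; it cancels only in
    products of weight 0. *)
Lemma moore_cusp n d g : n != 0 -> d %| n -> g \in unitmx ->
  exists k F (r : R), [/\ (k * anorm d = anorm (gcdp d (g 1%R 0%R)) ^ 2 * anorm (stab_gen n g))%N,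
    unit_germ F, 0 < r & forall z, imag_ge r z ->
      (moore (iA C d * mobius g z))^-1 =
      autj g z ^+ q.+1 * (t_param n g z ^+ k * F (t_param n g z))].
Proof.
move=> n0 dn gu; have d0 : d != 0 by apply: contraTneq dn => ->; rewrite dvd0p.
set l := stab_gen n g; have l0 : l != 0 by apply: stab_gen_neq0.
have [gam [be [de [gamu gam1]]]] := hermite_diag d0 gu.
set al := gcdp d (g 1 0); have al0 : al != 0 by rewrite gcdp_eq0 negb_and d0.
move=> ade [h00 h01 h10 h11].
have det0 := detg_neq0 gu.
have de0 : de != 0.
  have : al * de != 0 by rewrite ade mulf_neq0.
  by rewrite mulf_eq0 negb_or => /andP[].
have dvd : d %| al ^+ 2 * l by apply: stab_gen_dvd.
have du : \det g \is a GRing.unit by rewrite -unitmxE.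
(* Chosen so that (al z + be) / de = a (z / l) + be / de, that is, a = al l / de with de = d det g /
   al. *)
pose a := al ^+ 2 * l %/ d * (\det g)^-1.
have Ea : a * de = al * l.
  apply: (mulfI (mulf_neq0 al0 d0)); rewrite /a.
  have -> : al * d * (al ^+ 2 * l %/ d * (\det g)^-1 * de) =
     (al ^+ 2 * l %/ d * d) * (al * de) * (\det g)^-1 by ring.
  by rewrite divpK // ade !mulrA mulrK //; ring.
have a0 : a != 0.
  have : a * de != 0 by rewrite Ea mulf_neq0.
  by rewrite mulf_eq0 negb_or => /andP[].
have nd : anorm (\det g) = 1%N.
  by move: du; rewrite poly_unitE => /andP[/eqP h _]; rewrite /anorm h.
exists (anorm a).
have [F [rho [hF rho0 hexp]]] := inv_moore_expansion (iA C be / iA C de) l0 a0.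
exists (fun t => (iA C de ^+ q.+1)^-1 * F t), (rho^-1 + 1); split.
- have e1 : (anorm al * anorm de = anorm d)%N.
    by rewrite -anormM // ade anormM // nd muln1.
  have e2 : (anorm a * anorm de = anorm al * anorm l)%N by rewrite -!anormM // Ea.
  by rewrite -e1 mulnCA e2 mulnA mulnn.
- by apply: unit_germM => //; apply: unit_germ_cst; rewrite invr_eq0 expf_neq0 // iA_eq0.
- by rewrite addr_gt0 // invr_gt0.
move=> z hz.
have r0 : 0 < rho^-1 + 1 by rewrite addr_gt0 // invr_gt0.
have hOm := imag_ge_Omega r0 hz.
have [t0 ht] := t_param_small n0 gu r0 hz.
have ht' : v (t_param n g z) < rho.
  apply: le_lt_trans ht _; rewrite invf_plt ?posrE //.
  by rewrite ltrDl.
have L0 : iA C l != 0 by rewrite iA_eq0.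
have De0 : iA C de != 0 by rewrite iA_eq0.
have j0 := autj_neq0 gu hOm.
pose z' := iA C a * (z / iA C l) + iA C be / iA C de.
have Ez' : z' = (iA C al * z + iA C be) / iA C de.
  have : iA C a * iA C de = iA C al * iA C l by rewrite -!rmorphM Ea.
  move=> E; apply: (mulIf De0); rewrite /z' divfK // mulrDl divfK //; congr (_ + _).
  by rewrite mulrAC E -mulrA [iA C l * _]mulrC divfK.
have hz' : Omega z'.
  have := @Omega_affine z (tofrac al / tofrac de) (tofrac be / tofrac de).
  rewrite !fmorph_div /= => h; rewrite Ez' mulrDl mulrAC; apply: h => //.
  by rewrite mulf_neq0 ?invr_eq0 -?tofrac0 ?tofrac_eq.
have jz : autj gam z' = autj g z / iA C de.
  apply: (mulIf De0); rewrite divfK // /autj Ez' mulrDl -mulrA divfK //.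
  rewrite -h10 -h11 rmorphD !rmorphM; ring.
have mz : iA C d * mobius g z = mobius gam z'.
  rewrite /mobius -/(autj g z) -/(autj gam z') jz.
  have -> : iA C (gam 0 0) * z' + iA C (gam 0 1) =
    iA C d * (iA C (g 0 0) * z + iA C (g 0 1)) / iA C de.
    apply: (mulIf De0); rewrite divfK // Ez' mulrDl -mulrA divfK //.
    have -> : iA C d * (iA C (g 0 0) * z + iA C (g 0 1)) =
      iA C (d * g 0 0) * z + iA C (d * g 0 1) by rewrite !rmorphM; ring.
    by rewrite -h00 -h01 rmorphD !rmorphM; ring.
  by field; rewrite j0 De0.
rewrite mz moore_mobius // gam1 rmorph1 jz.
have := hexp z; rewrite -t_paramE // -/z' => /(_ t0 ht' hz') E.
rewrite mul1r invfM E invrK expr_div_n.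
by rewrite -!mulrA; congr (_ * _); rewrite mulrCA.
Qed.

Definition tord n g (phi : C -> C) (m : int) : Prop :=
  exists F (r : R), [/\ unit_germ F, 0 < r & forall z, imag_ge r z ->
    phi z = t_param n g z ^ m * F (t_param n g z)].

Lemma tordM n g phi phi' m m' : n != 0 -> g \in unitmx ->
  tord n g phi m -> tord n g phi' m' -> tord n g (fun z => phi z * phi' z) (m + m').
Proof.
move=> n0 gu [F [r [hF r0 h]]] [F' [r' [hF' r0' h']]].
exists (fun t => F t * F' t), (Num.max r r'); split.
- exact: unit_germM.
- by rewrite lt_max r0.
have rm : 0 < Num.max r r' by rewrite lt_max r0.
move=> z hz; have [t0 _] := t_param_small n0 gu rm hz.
rewrite h; last by apply: imag_ge_le hz; rewrite le_max lexx.
rewrite h'; last by apply: imag_ge_le hz; rewrite le_max lexx orbT.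
by rewrite expfzDr // mulrACA.
Qed.

Lemma tordXz n g phi m (k : int) : tord n g phi m -> tord n g (fun z => phi z ^ k) (m * k).
Proof.
move=> [F [r [hF r0 h]]]; exists (fun t => F t ^ k), r; split=> //.
  exact: unit_germXz.
by move=> z /h ->; rewrite expfzMl exprz_exp.
Qed.

End CuspOrder.

Lemma fraction_repr (A : idomainType) (x : {fraction A}) :
  exists p s, s != 0 /\ x = tofrac p / tofrac s.
Proof.
elim/generic_quotient.quotW: x => r; exists (frac r).1, (frac r).2.
split; first exact: denom_ratioP.
have d0 := denom_ratioP r.
have t0 : tofrac (frac r).2 != 0 by rewrite -tofrac0 tofrac_eq denom_ratioP.
apply: (mulIf t0); rewrite divfK //; unlock FracField.tofrac.
rewrite -[LHS]FracField.pi_mul; apply/generic_quotient.eqmodP => /=.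
rewrite FracField.equivfE /FracField.mulf !numden_Ratio ?mulf_neq0 ?oner_neq0 //.
by rewrite !mulr1 mulrC.
Qed.

(** * Analytic functions on the half plane *)

Section Holomorphic.
Variables (Fq : finFieldType) (R : realType) (C : Cinfty Fq R).
Local Notation v := (@Cabs Fq R C).
Local Notation q := #|Fq|.
Local Notation qR := (#|Fq|%:R : R).
Local Notation T := (iA C 'X).
Implicit Types (t x y z w : C) (n d p : {poly Fq}) (m : nat) (h k : C -> C).

(** Approximate x by a fraction p / s and take the Euclidean quotient. *)
Lemma Kinfty_int_part x : Kinfty x -> exists a, v (x - iA C a) < 1.
Proof.
move=> /(_ 1 ltr01)[_ [k _ <-] hk]; have [p [s [s0 Ek]]] := fraction_repr k.
exists (p %/ s); apply: abs_chain_lt hk _.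
have S0 : iA C s != 0 by rewrite iA_eq0.
have -> : Cemb C k - iA C (p %/ s) = iA C (p %% s) / iA C s.
  rewrite Ek fmorph_div /= -!/(iA C _); apply: (mulIf S0); rewrite divfK // mulrBl divfK //.
  by rewrite -rmorphM -rmorphB {1}(divp_eq p s) addrAC subrr add0r.
rewrite abs_div ltr_pdivrMr ?abs_gt0 // mul1r.
have [->|r0] := eqVneq (p %% s) 0; first by rewrite rmorph0 abs0 abs_gt0.
rewrite !abs_iA // ltr_eXn2l ?qR_gt1 //.
have : (size (p %% s)%R < size s)%N by rewrite ltn_modp.
by move: r0; rewrite -size_poly_gt0; case: (size _) => // i _; case: (size s).
Qed.

Lemma KinftyZ x (k : {fraction {poly Fq}}) : Kinfty x -> Kinfty (Cemb C k * x).
Proof.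
have [->|k0] := eqVneq k 0; first by rewrite rmorph0 mul0r -(rmorph0 (Cemb C)) => _; apply: range_Kinfty.
have vk : 0 < v (Cemb C k) by rewrite abs_gt0 fmorph_eq0.
move=> hx e e0; have [_ [k' _ <-] hk'] := hx _ (divr_gt0 e0 vk).
exists (Cemb C (k * k')); first by exists (k * k').
by rewrite rmorphM -mulrBr CabsM mulrC -ltr_pdivlMr.
Qed.

(* A solution of [X ^ q - X = 1] is a unit whose residue is not in [Fq]. *)
Lemma exists_nonresidue : exists z : C, v z <= 1 /\ imag_ge 1 z.
Proof.
pose P : {poly C} := 'X^q - 'X - 1.
have sP : size P = q.+1.
  rewrite /P -addrA size_polyDl size_polyXn // -opprD size_polyN.
  by rewrite -polyC1 size_XaddC ltnS q_gt1.
have [z] : exists z, root P z.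
  by apply/closed_rootP; rewrite sP eqSS -lt0n q_gt0.
rewrite rootE !hornerE => /eqP E.
(* Translations by [Fq] permute the roots of X^q - X - 1, so this applies both to z and to z - e,
   where e is the constant that a too close point of [Kinfty] would provide. *)
have small y : y ^+ q - y - 1 = 0 -> v y <= 1 /\ 1 <= v y.
  move=> Ey; have E1 : y * (y ^+ q.-1 - 1) = 1.
    by rewrite mulrBr mulr1 -q_pred; apply/eqP; rewrite -subr_eq0 Ey.
  have := congr1 v E1; rewrite CabsM abs1 => E2.
  have [h|h|//] := ltgtP (v y) 1.
    have : v (y ^+ q.-1 - 1) <= 1.
      by apply: absB_le; rewrite ?abs1 // absX exprn_ile1 ?Cabs_ge0 // ltW.
    move=> h1; have : v y * v (y ^+ q.-1 - 1) < 1.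
      by apply: le_lt_trans h; rewrite ler_piMr ?Cabs_ge0.
    by rewrite E2 ltxx.
  have h1 : 1 < v (y ^+ q.-1) by rewrite absX exprn_egt1 // -lt0n q_pred_gt0.
  have : v (y ^+ q.-1 - 1) = v (y ^+ q.-1) by rewrite absB_eql // abs1.
  move=> E3; move: E2; rewrite E3 => E2.
  have : 1 < v y * v (y ^+ q.-1) by rewrite mulr_egt1.
  by rewrite E2 ltxx.
have [z1 _] := small _ E; exists z; split=> // x hx.
rewrite leNgt; apply/negP => hlt.
have [a ha] := Kinfty_int_part hx.
have h2 := abs_chain_lt hlt ha.
have [a0 Ea] : exists e, a = e%:P.
  have : v (iA C a) <= 1.
    rewrite -[iA C a](subKr z); apply: absB_le => //; exact: ltW.
  have [->|a0] := eqVneq a 0; first by exists 0; rewrite polyC0.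
  rewrite abs_iA // leNgt => h; have : (size a <= 1)%N.
    rewrite leqNgt; apply/negP => s1; move/negP: h; apply.
    by rewrite exprn_egt1 ?qR_gt1 // -lt0n -ltnS prednK // ltnW.
  by move/size1_polyC => ->; exists a`_0.
have := small (z - ic C a0).
rewrite FrobeniusB icXq.
have -> : z ^+ q - ic C a0 - (z - ic C a0) - 1 = z ^+ q - z - 1 by ring.
move=> /(_ E)[_]; rewrite leNgt => /negP; apply.
by rewrite Ea in h2.
Qed.

Lemma Omega_nonempty m : exists z : C, Omega_ m z.
Proof.
have [z [z1 z2]] := exists_nonresidue; exists z.
have q1 j : 1 <= qR ^+ j by rewrite exprn_ege1 // ltW ?qR_gt1.
split; first exact: le_trans z1 (q1 m).
by apply: imag_ge_le z2; rewrite invf_le1 ?exprn_gt0 ?qR_gt0.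
Qed.

Lemma imag_ge_nonempty (r : R) : exists z : C, imag_ge r z.
Proof.
have [z [_ z2]] := exists_nonresidue; have [N hN] := exists_qX_ge Fq r.
exists (T ^+ N * z) => x hx; apply: le_trans (hN N (leqnn _)) _.
have t0 : T ^+ N != 0 by rewrite expf_neq0 // iAX_neq0.
have -> : T ^+ N * z - x = T ^+ N * (z - x / T ^+ N) by field.
rewrite CabsM absX abs_iAX ler_peMr ?exprn_ge0 ?ler0n //; apply: z2.
have -> : x / T ^+ N = Cemb C (tofrac 'X ^- N) * x by rewrite fmorphV rmorphXn mulrC.
exact: KinftyZ.
Qed.

Lemma poly_bounded (P : {poly C}) (r : R) : 0 <= r ->
  exists2 B : R, 0 < B & forall z, v z <= r -> v P.[z] <= B.
Proof.
move=> r0; elim/poly_ind: P => [|P c [B B0 hB]].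
  by exists 1 => // z _; rewrite horner0 abs0 ler01.
exists (Num.max 1 (Num.max (B * r) (v c))); first by rewrite lt_max ltr01.
move=> z hz; rewrite !hornerE; apply: absD_le; rewrite !le_max ?lexx ?orbT //.
by rewrite CabsM ler_pM ?Cabs_ge0 ?hB ?orbT.
Qed.

(** Either |a| > q^m, and then |z - a| = |a|, or a is closer than q^-m to a point of [Kinfty] from
    which z keeps distance at least q^-m. *)
Lemma Omega_dist m (a : C) : ~ Omega_ m a -> exists2 b : R, 0 < b &
  forall z : C, Omega_ m z -> b <= v (z - a).
Proof.
move=> na; have Q0 : 0 < qR ^- m by rewrite invr_gt0 exprn_gt0 // qR_gt0.
have [h|h] := ltP (qR ^+ m) (v a).
  exists (v a); first by apply: lt_trans h; rewrite exprn_gt0 // qR_gt0.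
  by move=> z [hz _]; rewrite abs_subC absB_eql // (le_lt_trans hz).
exists (qR ^- m) => // z [_ hz].
have [x hx hax] : exists2 x, Kinfty x & v (a - x) < qR ^- m.
  apply: contrapT => hn; apply: na; split=> // x hx; rewrite leNgt; apply/negP => hlt.
  by apply: hn; exists x.
have h1 := hz _ hx.
have -> : z - a = (z - x) - (a - x) by ring.
by rewrite absB_eql // (lt_le_trans hax).
Qed.

(** Split Q into linear factors; its roots lie outside [Omega_ m], so each factor is bounded below
    by [Omega_dist]. *)
Lemma inv_poly_bounded m (Q : {poly C}) : (forall z, Omega_ m z -> Q.[z] != 0) ->
  exists2 B : R, 0 < B & forall z : C, Omega_ m z -> v (Q.[z])^-1 <= B.
Proof.
move=> hQ; have [z0 hz0] := Omega_nonempty m.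
have Q0 : Q != 0 by apply: contra_neq (hQ _ hz0) => ->; rewrite horner0.
have [r Er] := closed_field_poly_normal Q.
have hr a : a \in r -> ~ Omega_ m a.
  move=> ar /hQ; rewrite Er hornerZ horner_prod (big_rem a ar) /=.
  by rewrite hornerXsubC subrr mul0r mulr0 eqxx.
have [b b0 hb] : exists2 b : R, 0 < b &
    forall z : C, Omega_ m z -> b <= v (\prod_(a <- r) (z - a)).
  elim: r hr {Er} => [|a r IH] hr; first by exists 1 => // z _; rewrite big_nil abs1.
  have [|b b0 hb] := IH; first by move=> c cr; apply: hr; rewrite inE cr orbT.
  have [|b' b'0 hb'] := @Omega_dist m a; first by apply: hr; rewrite inE eqxx.
  exists (b' * b); first by rewrite mulr_gt0.
  by move=> z hz; rewrite big_cons CabsM ler_pM ?(ltW b0) ?(ltW b'0) ?hb ?hb'.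
have l0 : 0 < v (lead_coef Q) by rewrite abs_gt0 lead_coef_eq0.
exists (v (lead_coef Q) * b)^-1; first by rewrite invr_gt0 mulr_gt0.
move=> z hz; rewrite absV lef_pV2 ?posrE ?mulr_gt0 ?abs_gt0 ?hQ ?lead_coef_eq0 //.
rewrite {2}Er hornerZ horner_prod CabsM ler_pM2l //.
by under eq_bigr do rewrite hornerXsubC; apply: hb.
Qed.

Lemma holo_bounded m h : holo_on m h ->
  exists2 B : R, 0 < B & forall z, Omega_ m z -> v (h z) <= B.
Proof.
move=> /(_ 1 ltr01)[P [Q hPQ]].
have [B B0 hB] := poly_bounded P (exprn_ge0 m (ltW (qR_gt0 Fq R))).
have [|B' B'0 hB'] := @inv_poly_bounded m Q; first by move=> z /hPQ[].
exists (Num.max 1 (B * B')); first by rewrite lt_max ltr01.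
move=> z hz; have [_ h1] := hPQ z hz; rewrite -[h z](subrK (P.[z] / Q.[z])).
apply: absD_le; first by rewrite le_max (ltW h1).
by rewrite le_max CabsM ler_pM ?Cabs_ge0 ?hB' ?hB ?orbT //; case: hz.
Qed.

Lemma holo_ext m h k : (forall z, Omega_ m z -> h z = k z) -> holo_on m h -> holo_on m k.
Proof. by move=> E hh e /hh[P [Q hPQ]]; exists P, Q => z hz; rewrite -E //; apply: hPQ. Qed.

Lemma holo_frac m (P Q : {poly C}) : (forall z, Omega_ m z -> Q.[z] != 0) ->
  holo_on m (fun z => P.[z] / Q.[z]).
Proof. by move=> hQ e e0; exists P, Q => z hz; rewrite hQ // subrr abs0. Qed.

Lemma holo_poly m (P : {poly C}) : holo_on m (fun z => P.[z]).
Proof.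
have h : forall z : C, Omega_ m z -> (1 : {poly C}).[z] != 0.
  by move=> z _; rewrite hornerE oner_neq0.
by apply: holo_ext (holo_frac P h) => z _; rewrite hornerE divr1.
Qed.

Lemma holo_cst m (c : C) : holo_on m (fun=> c).
Proof. by apply: holo_ext (holo_poly m c%:P) => z _; rewrite hornerC. Qed.

Lemma holoD m h k : holo_on m h -> holo_on m k -> holo_on m (fun z => h z + k z).
Proof.
move=> hh hk e e0; have [P [Q hPQ]] := hh e e0; have [P' [Q' hPQ']] := hk e e0.
exists (P * Q' + P' * Q), (Q * Q') => z hz.
have [Q0 h1] := hPQ z hz; have [Q0' h2] := hPQ' z hz.
rewrite !hornerE mulf_neq0 //; split=> //.
have -> : h z + k z - (P.[z] * Q'.[z] + P'.[z] * Q.[z]) / (Q.[z] * Q'.[z]) =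
   (h z - P.[z] / Q.[z]) + (k z - P'.[z] / Q'.[z]) by field; rewrite Q0 Q0'.
exact: absD_lt.
Qed.

Lemma holoM m h k : holo_on m h -> holo_on m k -> holo_on m (fun z => h z * k z).
Proof.
move=> hh hk e e0; have [B B0 hB] := holo_bounded hh; have [B' B'0 hB'] := holo_bounded hk.
have e1 : 0 < Num.min B' (e / B) by rewrite lt_min B'0 divr_gt0.
have e2 : 0 < e / B' by rewrite divr_gt0.
have [P [Q hPQ]] := hh _ e2; have [P' [Q' hPQ']] := hk _ e1.
exists (P * P'), (Q * Q') => z hz.
have [Q0 h1] := hPQ z hz; have [Q0' h2] := hPQ' z hz.
rewrite !hornerE mulf_neq0 //; split=> //.
have -> : h z * k z - (P.[z] * P'.[z]) / (Q.[z] * Q'.[z]) =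
   h z * (k z - P'.[z] / Q'.[z]) + (h z - P.[z] / Q.[z]) * (P'.[z] / Q'.[z]).
  by field; rewrite Q0 Q0'.
move: h2; rewrite lt_min => /andP[h2 h3].
apply: absD_lt; rewrite CabsM.
  apply: le_lt_trans (_ : B * v (k z - P'.[z] / Q'.[z]) < e).
    by rewrite ler_wpM2r ?Cabs_ge0 ?hB.
  by rewrite mulrC -ltr_pdivlMr.
apply: le_lt_trans (_ : v (h z - P.[z] / Q.[z]) * B' < e); last by rewrite -ltr_pdivlMr.
rewrite ler_wpM2l ?Cabs_ge0 // -[X in v X](subKr (k z)).
by apply: absB_le; rewrite ?hB' // ltW.
Qed.

Lemma holoX m h j : holo_on m h -> holo_on m (fun z => h z ^+ j).
Proof.
move=> hh; elim: j => [|j IH]; first exact: holo_cst.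
by apply: holo_ext (holoM hh IH) => z _; rewrite exprS.
Qed.

Lemma holo_prod m I (s : seq I) (F : I -> C -> C) :
  (forall i, holo_on m (F i)) -> holo_on m (fun z => \prod_(i <- s) F i z).
Proof.
move=> hF; elim: s => [|i s IH].
  by apply: holo_ext (holo_cst m 1) => z _; rewrite big_nil.
by apply: holo_ext (holoM (hF i) IH) => z _; rewrite big_cons.
Qed.

Lemma holo_lim m h : (forall e : R, 0 < e ->
    exists2 k, holo_on m k & forall z, Omega_ m z -> v (h z - k z) < e) -> holo_on m h.
Proof.
move=> hl e e0; have [k hk hhk] := hl e e0; have [P [Q hPQ]] := hk e e0.
exists P, Q => z hz; have [Q0 h1] := hPQ z hz; split=> //.
exact: abs_chain_lt (hhk z hz) h1.
Qed.

Lemma holo_scale m d h : d != 0 -> holo_on (m + (size d).-1) h ->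
  holo_on m (fun z => h (iA C d * z)).
Proof.
move=> d0 hh e e0; have [P [Q hPQ]] := hh e e0.
exists (P \Po (iA C d *: 'X)), (Q \Po (iA C d *: 'X)) => z hz.
rewrite !horner_comp !hornerE; apply: hPQ; case: hz => z1 z2; split.
  rewrite CabsM abs_iA // exprD mulrC ler_wpM2r //.
  by rewrite exprn_ge0 // ler0n.
have D0 : iA C d != 0 by rewrite iA_eq0.
move=> x hx; have -> : iA C d * z - x = iA C d * (z - x / iA C d) by field.
have -> : x / iA C d = Cemb C (tofrac d)^-1 * x by rewrite fmorphV mulrC.
rewrite CabsM; apply: le_trans (_ : 1 * qR ^- m <= _).
  rewrite mul1r lef_pV2 ?posrE ?exprn_gt0 ?qR_gt0 //.
  by rewrite ler_eXn2l ?qR_gt1 // leq_addr.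
by rewrite ler_pM ?invr_ge0 ?exprn_ge0 ?ler0n ?abs_iA_ge1 //; apply/z2/KinftyZ.
Qed.

Lemma holo_latform_div m (P : {poly C}) i : holo_on m (fun z => P.[z] / latform z i).
Proof.
have [->|i0] := eqVneq i 0.
  apply: holo_ext (holo_cst m 0) => z _.
  by rewrite /latform rmorph0 mul0r addr0 invr0 mulr0.
have h : forall z : C, Omega_ m z -> ((iA C i.1)%:P * 'X + (iA C i.2)%:P).[z] != 0.
  by move=> z hz; rewrite !hornerE; apply: (latform_neq0 (Omega_subset hz) i0).
by apply: holo_ext (holo_frac P h) => z _; rewrite !hornerE.
Qed.

Lemma holo_lamexp m (P : {poly C}) : holo_on m (fun z => lamexp z P.[z]).
Proof.
pose E N z := latprod (latform z) (polyN2 Fq N) P.[z].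
have hE N : holo_on m (E N).
  apply: holoM; first exact: holo_poly.
  apply: holo_prod => i; apply: holoD; first exact: holo_cst.
  apply: holo_ext (holo_latform_div m (- P) i) => z _; by rewrite hornerN mulNr.
have [W W0 hW] := poly_bounded P (exprn_ge0 m (ltW (qR_gt0 Fq R))).
have q2 : 0 < qR ^- (m + m) by rewrite invr_gt0 exprn_gt0 ?qR_gt0.
(* [W] bounds |P| on |z| <= q^m, and outside [polyN2 N] the lattice points have absolute value at
   least q^-2m q^N by [latform_ge]. Being independent of z, this bound makes the convergence uniform
   on [Omega_ m]. *)
pose eps N := W / qR ^- (m + m) * qR ^- N.
have eps0 N : 0 < eps N by rewrite mulr_gt0 ?divr_gt0 // invr_gt0 exprn_gt0 ?qR_gt0.
have small N z i : Omega_ m z -> i \notin polyN2 Fq N -> v (P.[z] / latform z i) <= eps N.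
  move=> hz; rewrite mem_polyN2 negb_and -!ltnNge => hi.
  have h1 : qR ^- (m + m) * qR ^+ N <= v (latform z i).
    have [h1 h2] := latform_ge i hz.
    case/orP: hi => /(abs_iA_ge C) h; [apply: le_trans h1|apply: le_trans h2];
      by rewrite ler_wpM2l // ltW.
  have p1 : 0 < qR ^- (m + m) * qR ^+ N by rewrite mulr_gt0 // exprn_gt0 ?qR_gt0.
  rewrite abs_div ler_pdivrMr ?(lt_le_trans p1) //.
  apply: le_trans (_ : eps N * (qR ^- (m + m) * qR ^+ N) <= _); last first.
    by rewrite ler_wpM2l // ltW.
  have -> : eps N * (qR ^- (m + m) * qR ^+ N) = W.
    rewrite /eps; field; rewrite ?invr_eq0 !expf_neq0 // gt_eqF ?qR_gt0 //.
  by apply: hW; case: hz.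
have epscvg e : 0 < e -> exists N, forall j, (N <= j)%N -> eps j < e.
  move=> e0; have c0 : 0 < W / qR ^- (m + m) by rewrite divr_gt0.
  have [N hN] := exists_qN_lt Fq (divr_gt0 e0 c0); exists N => j /hN.
  by rewrite /eps ltr_pdivlMr // mulrC.
have [N0 hN0] := epscvg 1 ltr01.
have [B B0 hB] := holo_bounded (hE N0).
apply: holo_lim => e e0.
have [N1 hN1] := epscvg (e / B) (divr_gt0 e0 B0).
pose N := maxn N0 N1; exists (E N) => // z hz.
apply: le_lt_trans (_ : eps N * B < e); last first.
  by rewrite -ltr_pdivlMr //; apply/hN1/leq_maxr.
apply: (vcvg_le (N := N) (lamexp_cvg _ (Omega_subset hz))) => M hM.
apply: le_trans (latprod_compare (eps := eps N) (polyN2_uniq _ _) (polyN2_uniq _ _) (polyN2_sub hM) _ _ _) _.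
- exact: ltW.
- by apply/ltW/hN0/leq_maxl.
- by move=> i; apply: small.
rewrite ler_wpM2l ?(ltW (eps0 _)) //; apply: le_trans (hB z hz).
apply: latprod_abs_le; rewrite ?polyN2_uniq //.
  by apply: polyN2_sub; rewrite leq_maxl.
move=> i /(small N0 z i hz) h; apply: le_trans h _; exact/ltW/hN0.
Qed.

Lemma holo_moore m : holo_on m (@moore Fq R C).
Proof.
have h1 : holo_on m (fun z => lamexp z (z / T)).
  by apply: holo_ext (holo_lamexp m (T^-1 *: 'X)) => z _; rewrite !hornerE mulrC.
have h2 : holo_on m (fun z => lamexp z T^-1).
  by apply: holo_ext (holo_lamexp m (T^-1)%:P) => z _; rewrite !hornerE.
apply: holoD; first by apply: holoM => //; apply: holoX.
apply: holo_ext (holoM (holo_cst m (-1)) (holoM (holoX q h2) h1)) => z _.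
by rewrite mulN1r.
Qed.

(** One global pair h, k serves for every m; this class is closed under integral powers and yields
    [mero] directly. *)
Definition unit_quotient (phi : C -> C) : Prop :=
  exists h k, (forall m, holo_on m h /\ holo_on m k) /\
    forall z, Omega z -> [/\ h z != 0, k z != 0 & phi z = h z / k z].

Lemma unit_quotientM phi psi : unit_quotient phi -> unit_quotient psi ->
  unit_quotient (fun z => phi z * psi z).
Proof.
move=> [h [k [hh hhk]]] [h' [k' [hh' hhk']]].
exists (fun z => h z * h' z), (fun z => k z * k' z); split=> [m|z hz].
  by have [? ?] := hh m; have [? ?] := hh' m; split; apply: holoM.
have [h0 k0 ->] := hhk z hz; have [h0' k0' ->] := hhk' z hz.
by rewrite !mulf_neq0 // mulf_div.
Qed.

Lemma unit_quotientV phi : unit_quotient phi -> unit_quotient (fun z => (phi z)^-1).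
Proof.
move=> [h [k [hh hhk]]]; exists k, h; split=> [m|z hz]; first by case: (hh m).
by have [h0 k0 ->] := hhk z hz; rewrite invf_div.
Qed.

Lemma unit_quotient1 : unit_quotient (fun=> 1).
Proof.
exists (fun=> 1), (fun=> 1); split=> [m|z hz]; first by split; apply: holo_cst.
by rewrite oner_neq0 divr1.
Qed.

Lemma unit_quotientX phi j : unit_quotient phi -> unit_quotient (fun z => phi z ^+ j).
Proof.
move=> hp; elim: j => [|j IH]; first exact: unit_quotient1.
have := unit_quotientM hp IH; congr unit_quotient.
by apply/funext => z; rewrite exprS.
Qed.

Lemma unit_quotientXz phi (j : int) : unit_quotient phi -> unit_quotient (fun z => phi z ^ j).
Proof.
case: j => j hp; first exact: unit_quotientX.
exact: (unit_quotientV (unit_quotientX j.+1 hp)).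
Qed.

Lemma unit_quotient_prod I (s : seq I) (phi : I -> C -> C) :
  (forall i, unit_quotient (phi i)) -> unit_quotient (fun z => \prod_(i <- s) phi i z).
Proof.
move=> hp; elim: s => [|i s IH].
  have := unit_quotient1; congr unit_quotient; by apply/funext => z; rewrite big_nil.
have := unit_quotientM (hp i) IH; congr unit_quotient.
by apply/funext => z; rewrite big_cons.
Qed.

Lemma unit_quotient_moore d : d != 0 -> unit_quotient (fun z => moore (iA C d * z)).
Proof.
move=> d0; exists (fun z => moore (iA C d * z)), (fun=> 1); split=> [m|z hz].
  by split; [apply: holo_scale => //; apply: holo_moore | apply: holo_cst].
by rewrite oner_neq0 divr1 moore_neq0 //; apply: Omega_scale.
Qed.

Lemma unit_quotient_mero phi : unit_quotient phi -> mero (fun z => Some (phi z)).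
Proof.
move=> [h [k [hh hhk]]] m; exists h, k; have [h1 h2] := hh m; split=> //.
- by have [z hz] := Omega_nonempty m; exists z => //; case: (hhk z (Omega_subset hz)).
- by move=> z hz; left; case: (hhk z (Omega_subset hz)).
by move=> z hz; have [_ k0 ->] := hhk z (Omega_subset hz); rewrite (negbTE k0).
Qed.

Definition omul (f1 f2 : C -> option C) : C -> option C := fun z =>
  if f1 z is Some x then if f2 z is Some y then Some (x * y) else None else None.

(** For functions without zeros or poles, numerators and denominators vanish nowhere on [Omega_ m],
    so multiplying them creates no common zeros. *)
Lemma mero_omul (f1 f2 : C -> option C) : mero f1 -> mero f2 ->
  (forall z, Omega z -> f1 z <> None /\ f1 z <> Some 0) ->
  (forall z, Omega z -> f2 z <> None /\ f2 z <> Some 0) -> mero (omul f1 f2).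
Proof.
move=> m1 m2 u1 u2 m.
have nz (f : C -> option C) h k z : Omega z -> (forall z, Omega z -> f z <> None /\ f z <> Some 0) ->
    f z = (if k z == 0 then None else Some (h z / k z)) -> h z != 0 /\ k z != 0 :> C.
  move=> hz /(_ z hz)[n1 n2] E; move: n1 n2; rewrite E; case: eqP => // k0 _ n2.
  by split; apply/eqP => // h0; apply: n2; rewrite h0 mul0r.
have [h1 [k1 [hh1 hk1 _ _ E1]]] := m1 m; have [h2 [k2 [hh2 hk2 _ _ E2]]] := m2 m.
have nz1 z : Omega_ m z -> h1 z != 0 /\ k1 z != 0.
  by move=> hz; apply: (nz f1) => //; [exact: Omega_subset hz | exact: E1].
have nz2 z : Omega_ m z -> h2 z != 0 /\ k2 z != 0.
  by move=> hz; apply: (nz f2) => //; [exact: Omega_subset hz | exact: E2].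
exists (fun z => h1 z * h2 z), (fun z => k1 z * k2 z); split.
- exact: holoM.
- exact: holoM.
- have [z hz] := Omega_nonempty m; exists z => //.
  by rewrite mulf_neq0 //; [case: (nz1 z hz) | case: (nz2 z hz)].
- by move=> z hz; left; rewrite mulf_neq0 //; [case: (nz1 z hz) | case: (nz2 z hz)].
move=> z hz; have [_ a1] := nz1 z hz; have [_ a2] := nz2 z hz.
by rewrite /omul E1 // E2 // (negbTE a1) (negbTE a2) (negbTE (mulf_neq0 a1 a2)) mulf_div.
Qed.

(** * Expansions and germs *)

(** [t_expansion] with the series replaced by its sum and the leading coefficient made explicit;
    expansions can then be multiplied as functions. *)
Definition gord n g (f : C -> option C) (m : int) (c : C) : Prop :=
  exists F (r : R), [/\ germ F, F 0 = c, 0 < r & forall z, imag_ge r z ->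
    f (mobius g z) = Some (t_param n g z ^ m * F (t_param n g z))].

Lemma gordM n g f1 f2 (m1 m2 : int) (c1 c2 : C) : n != 0 -> g \in unitmx ->
  gord n g f1 m1 c1 -> gord n g f2 m2 c2 ->
  gord n g (omul f1 f2) (m1 + m2) (c1 * c2).
Proof.
move=> n0 gu [F [r [[rh [B [rh0 hF]]] F0 r0 h]]] [F' [r' [[rh' [B' [rh0' hF']]] F0' r0' h']]].
have rm : 0 < Num.max r r' by rewrite lt_max r0.
exists (fun t => F t * F' t), (Num.max r r'); split=> //; last 2 first.
- by rewrite F0 F0'.
- move=> z hz; have [t0 _] := t_param_small n0 gu rm hz.
  rewrite /omul h; last by apply: imag_ge_le hz; rewrite le_max lexx.
  rewrite h'; last by apply: imag_ge_le hz; rewrite le_max lexx orbT.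
  by rewrite expfzDr // mulrACA.
pose rho := Num.min rh rh'; have rho0 : 0 < rho by rewrite lt_min rh0.
exists rho, (B * B'); split=> //; apply: power_seriesM => //.
  by apply: power_series_shrink hF; rewrite // ge_min lexx.
by apply: power_series_shrink hF'; rewrite // ge_min lexx orbT.
Qed.

Lemma gord_t_expansion n g f (m : int) (c : C) : n != 0 -> g \in unitmx ->
  gord n g f m c -> exists2 a : nat -> C, a 0%N = c & t_expansion n f g m a.
Proof.
move=> n0 gu [F [r [[rho [B [rho0 hF]]] F0 r0 h]]]; have [a [ha1 ha2]] := hF.
exists a; first by rewrite -(power_series_coef0 rho0 ha2).
have rm : 0 < Num.max r (rho^-1 + 1) by rewrite lt_max r0.
exists (Num.max r (rho^-1 + 1)) => // z hz.
have [t0 ht] := t_param_small n0 gu rm hz.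
exists (t_param n g z ^ m * F (t_param n g z)).
  by apply: h; apply: imag_ge_le hz; rewrite le_max lexx.
have ht' : v (t_param n g z) < rho.
  apply: le_lt_trans ht _; rewrite invf_plt ?posrE //.
  by rewrite lt_max ltrDl ltr01 orbT.
apply: vcvg_ext (vcvgZ (t_param n g z ^ m) (ha2 _ ht')) => N.
by rewrite big_distrr; apply: eq_bigr => j _ /=; rewrite expfzDr // mulrCA.
Qed.

(** Convergence at a single point with t != 0, which exists by [imag_ge_nonempty], bounds the
    coefficients and makes the series converge on the disc |x| < |t|. *)
Lemma t_expansion_gord n g f (m : int) (a : nat -> C) : n != 0 -> g \in unitmx ->
  t_expansion n f g m a -> gord n g f m (a 0%N).
Proof.
move=> n0 gu [r r0 h]; have [z0 hz0] := imag_ge_nonempty r.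
have [t0 _] := t_param_small n0 gu r0 hz0; set t := t_param n g z0 in t0.
have [y _ hy] := h _ hz0; pose rho := v t; have rho0 : 0 < rho by rewrite abs_gt0.
have S (x : C) l : x != 0 -> vcvg v (fun N => \sum_(j < N) a j * x ^ (m + j%:Z)) l ->
    vcvg v (fun N => \sum_(j < N) a j * x ^+ j) (x ^ (- m) * l).
  move=> x0 hl; apply: vcvg_ext (vcvgZ (x ^ (- m)) hl) => N.
  rewrite big_distrr; apply: eq_bigr => j _ /=.
  by rewrite mulrCA -expfzDr // addrA addNr add0r.
have hS := S _ _ t0 hy.
have [B B0 hB] : exists2 B : R, 0 < B & forall j, v (a j) * rho ^+ j <= B.
  have [B B0 hB] := vcvg_bound hS; exists B => // j.
  have -> : v (a j) * rho ^+ j = v (\sum_(i < j.+1) a i * t ^+ i - \sum_(i < j) a i * t ^+ i).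
    by rewrite big_ord_recr /= addrAC subrr add0r CabsM absX.
  exact: absB_le.
pose F x := vlim v (fun N => \sum_(j < N) a j * x ^+ j).
have cF x : v x < rho -> vcvg v (fun N => \sum_(j < N) a j * x ^+ j) (F x).
  move=> hx; suff [l hl] : exists l, vcvg v (fun N => \sum_(j < N) a j * x ^+ j) l.
    by rewrite /F (vlimE hl).
  apply: (vcvg_ex (eps := fun j => B * (v x / rho) ^+ j)).
    apply: geometric_small; first by rewrite divr_ge0 ?Cabs_ge0 ?ltW.
    by rewrite ltr_pdivrMr // mul1r.
  move=> j; rewrite big_ord_recr /= addrAC subrr add0r CabsM absX expr_div_n mulrCA.
  rewrite [X in X <= _]mulrC ler_wpM2l ?exprn_ge0 ?Cabs_ge0 //.
  by rewrite ler_pdivlMr ?exprn_gt0.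
have hF : power_series rho B F by exists a.
exists F, (Num.max r (rho^-1 + 1)); split.
- by exists rho, B.
- exact: power_series_coef0 rho0 cF.
- by rewrite lt_max r0.
move=> z hz; have rm : 0 < Num.max r (rho^-1 + 1) by rewrite lt_max r0.
have [tz0 ht] := t_param_small n0 gu rm hz.
have ht' : v (t_param n g z) < rho.
  apply: le_lt_trans ht _; rewrite invf_plt ?posrE //.
  by rewrite lt_max ltrDl ltr01 orbT.
have [|y' -> hy'] := h z; first by apply: imag_ge_le hz; rewrite le_max lexx.
congr Some; rewrite -(vcvg_unique (S _ _ tz0 hy') (cF _ ht')) mulrA -expfzDr //.
by rewrite subrr expr0z mul1r.
Qed.

Lemma tord_gord n g f phi (m : int) : (exists2 r : R, 0 < r & forall z, imag_ge r z -> f (mobius g z) = Some (phi z)) ->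
  tord n g phi m -> exists2 c : C, c != 0 & gord n g f m c.
Proof.
move=> [r r0 h] [F [r' [[hF F0] r0' h']]]; exists (F 0) => //.
exists F, (Num.max r r'); split=> //; first by rewrite lt_max r0.
move=> z hz; rewrite h; last by apply: imag_ge_le hz; rewrite le_max lexx.
by rewrite h' //; apply: imag_ge_le hz; rewrite le_max lexx orbT.
Qed.

End Holomorphic.

(** * Cusps *)

Lemma scalemx_mulmx_inv (F : fieldType) (M N : 'M[F]_2) (u w : 'cV[F]_2) (c : F) :
  N *m M = 1%:M -> c != 0 -> w = c *: (M *m u) -> u = c^-1 *: (N *m w).
Proof. by move=> NM c0 ->; rewrite -scalemxAr mulmxA NM mul1mx scalerA mulVf // scale1r. Qed.

Lemma scalemx_mulmx_trans (F : fieldType) (M N : 'M[F]_2) (u w x : 'cV[F]_2) (c k : F) :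
  w = c *: (M *m u) -> x = k *: (N *m w) -> x = (k * c) *: (N *m M *m u).
Proof. by move=> -> ->; rewrite -scalemxAr scalerA mulmxA. Qed.

Lemma scale_colP (F : fieldType) (u : 'cV[F]_2) (x y s t D a b : F) :
  s != 0 -> t != 0 -> u 0 0 = x / s -> u 1 0 = y / t -> D * a = x * t -> D * b = y * s ->
  u = D / (s * t) *: \col_(i < 2) if i == 0 then a else b.
Proof.
move=> s0 t0 E0 E1 Ex Ey; apply/matrixP; apply: ord2P => j; rewrite !ord1 !mxE /=.
  by rewrite E0 mulrAC Ex; field; rewrite s0 t0.
by rewrite E1 mulrAC Ey; field; rewrite s0 t0.
Qed.

Lemma scale_by_frac (F : fieldType) (p s x y c : F) :
  s != 0 -> c = p / s -> x = c * y -> s * x = p * y.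
Proof. by move=> s0 -> ->; field. Qed.

Section Cusps.
Variable (Fq : finFieldType).
Local Notation A := {poly Fq}.
Local Notation K := {fraction {poly Fq}}.
Local Notation q := #|Fq|.
Implicit Types (a b d m n : A) (g h : 'M[A]_2) (c : K) (u w : 'cV[K]_2).

Lemma Gamma0_unit n g : Gamma0 n g -> g \in unitmx.
Proof. by case/andP. Qed.

Lemma Gamma0M n g h : Gamma0 n g -> Gamma0 n h -> Gamma0 n (g *m h).
Proof.
case/andP=> gu gn /andP[hu hn]; rewrite /Gamma0 unitmx_mul gu hu mulmx2E /=.
by rewrite dvdp_add // ?(dvdp_mulr _ gn) // dvdp_mull.
Qed.

Lemma Gamma0V n g : Gamma0 n g -> Gamma0 n (invmx g).
Proof.
case/andP=> gu gn; rewrite /Gamma0 unitmx_inv gu /= (invmx2_col0 gu).2 dvdpNr.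
exact: dvdp_mull.
Qed.

Lemma Gamma0_1 n : Gamma0 n 1%:M.
Proof. by rewrite /Gamma0 unitmx1 mxE /= dvdp0. Qed.

Lemma Gamma0Z n (e : Fq) g : e != 0 -> Gamma0 n g -> Gamma0 n (e%:P *: g).
Proof.
move=> e0 /andP[gu gn]; rewrite /Gamma0 mxE dvdp_mull // andbT.
rewrite unitmxE detZ unitrM -unitmxE gu andbT unitrX // poly_unitE size_polyC e0 /=.
by rewrite coefC /= unitfE.
Qed.

Local Notation pt a b := (ptP1 (tofrac a) (tofrac b)).

Lemma ptP1_act g a b : map_mx (@tofrac _) g *m pt a b =
  pt (g 0 0 * a + g 0 1 * b) (g 1 0 * a + g 1 1 * b).
Proof.
apply/matrixP => i j; rewrite mulmx2E !mxE /= !tofracD !tofracM.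
by move: i; apply: ord2P.
Qed.

Lemma cusp_orbit_refl n u : cusp_orbit n u u.
Proof.
exists 1%:M, 1; split; [exact: Gamma0_1 | exact: oner_neq0 |].
by rewrite map_mx1 mul1mx scale1r.
Qed.

Lemma cusp_orbit_eq n u w : cusp_orbit n u w -> cusp_orbit n w = cusp_orbit n u.
Proof.
move=> [g [c [gG c0 Ew]]]; apply/seteqP; split=> x [h [k [hG k0 Ex]]].
  exists (h *m g), (k * c); split; [exact: Gamma0M | exact: (mulf_neq0 k0 c0) |].
  by rewrite map_mxM; exact: scalemx_mulmx_trans Ew Ex.
have mg : map_mx (@tofrac _) (invmx g) *m map_mx (@tofrac _) g = 1%:M :> 'M[K]_2.
  by rewrite -map_mxM (mulVmx (Gamma0_unit gG)) map_mx1.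
have Eu := scalemx_mulmx_inv mg c0 Ew.
have c1 := invr_neq0 c0.
exists (h *m invmx g), (k / c); split; [|exact: (mulf_neq0 k0 c1)|].
  exact: Gamma0M hG (Gamma0V gG).
by rewrite map_mxM; exact: scalemx_mulmx_trans Eu Ex.
Qed.

Lemma cusps_eq n (x : set 'cV[K]_2) u : cusps n x -> x u -> x = cusp_orbit n u.
Proof. by move=> [w w0 <-] /cusp_orbit_eq. Qed.

Lemma coprimep_act g a b : g \in unitmx -> coprimep a b ->
  coprimep (g 0 0 * a + g 0 1 * b) (g 1 0 * a + g 1 1 * b).
Proof.
move=> gu /Bezout1[x [y xy]]; set h := invmx g.
have hg : h *m g = 1%:M by rewrite mulVmx.
have e i j : h i 0 * g 0 j + h i 1 * g 1 j = (i == j)%:R.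
  by rewrite -mulmx2E hg mxE.
apply/Bezout_eq1_coprimepP; exists (x * h 0 0 + y * h 1 0, x * h 0 1 + y * h 1 1) => /=.
rewrite -xy.
transitivity (x * ((h 0 0 * g 0 0 + h 0 1 * g 1 0) * a + (h 0 0 * g 0 1 + h 0 1 * g 1 1) * b)
  + y * ((h 1 0 * g 0 0 + h 1 1 * g 1 0) * a + (h 1 0 * g 0 1 + h 1 1 * g 1 1) * b)).
  by ring.
by rewrite !e /= !mul1r !mul0r addr0 add0r.
Qed.

Lemma tofrac_eq0' a : (tofrac a == 0 :> K) = (a == 0).
Proof. by rewrite -tofrac0 tofrac_eq. Qed.

(** For c = p / s, Bezout relations for the two primitive vectors give p | s and s | p. *)
Lemma primitive_scale a b a' b' c : coprimep a b -> coprimep a' b' -> c != 0 ->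
  pt a' b' = c *: pt a b -> exists2 e : Fq, e != 0 & a' = e%:P * a /\ b' = e%:P * b.
Proof.
move=> cab cab' c0 E; have [p [s [s0 Ec]]] := fraction_repr c.
have S0 : tofrac s != 0 :> K by rewrite tofrac_eq0'.
have p0 : p != 0 by apply: contraNneq c0 => p0; rewrite Ec p0 tofrac0 mul0r.
have eq1 x y : tofrac x = c * tofrac y :> K -> s * x = p * y.
  move=> h; apply/eqP; rewrite -(@tofrac_eq {poly Fq}) !tofracM.
  by apply/eqP; apply: scale_by_frac S0 Ec h.
have /matrixP E' := E; have Ea := E' 0 0; have Eb := E' 1 0.
rewrite !mxE /= in Ea Eb; move/eq1: Ea => Ea; move/eq1: Eb => Eb.
have ps : p %| s.
  have [x [y xy]] := Bezout1 cab'; rewrite -[s]mulr1 -xy.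
  have -> : s * (x * a' + y * b') = p * (x * a + y * b).
    by rewrite mulrDr mulrCA Ea [s * (y * _)]mulrCA Eb; ring.
  exact: dvdp_mulIl.
have sp : s %| p.
  have [x [y xy]] := Bezout1 cab; rewrite -[p]mulr1 -xy.
  have -> : p * (x * a + y * b) = s * (x * a' + y * b').
    by rewrite [RHS]mulrDr [s * (x * _)]mulrCA Ea [s * (y * _)]mulrCA Eb; ring.
  exact: dvdp_mulIl.
have /eqpP[[c1 c2] /= /andP[c10 c20] ecc] : p %= s by rewrite /eqp ps sp.
have Ep : p = (c2 / c1)%:P * s.
  by rewrite mul_polyC mulrC -scalerA -ecc scalerA mulVf // scale1r.
exists (c2 / c1); first by rewrite mulf_neq0 ?invr_eq0.
by split; apply: (mulfI s0); rewrite ?Ea ?Eb Ep; ring.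
Qed.

(** The constant left over by [primitive_scale] is absorbed into g, since [Gamma0 n] contains the
    scalar matrices. *)
Lemma orbit_primitive n a b a' b' : coprimep a b -> coprimep a' b' ->
  cusp_orbit n (pt a b) (pt a' b') -> exists g,
    [/\ Gamma0 n g, a' = g 0 0 * a + g 0 1 * b & b' = g 1 0 * a + g 1 1 * b].
Proof.
move=> cab cab' [g [c [gG c0 E]]]; rewrite ptP1_act in E.
have [e e0 [Ea Eb]] := primitive_scale (coprimep_act (Gamma0_unit gG) cab) cab' c0 E.
exists (e%:P *: g); split; first exact: Gamma0Z.
  by rewrite Ea !mxE; ring.
by rewrite Eb !mxE; ring.
Qed.

Lemma orbit_of_act n g a b : Gamma0 n g ->
  cusp_orbit n (pt a b) (pt (g 0 0 * a + g 0 1 * b) (g 1 0 * a + g 1 1 * b)).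
Proof.
by move=> gG; exists g, 1; rewrite oner_neq0 scale1r ptP1_act.
Qed.

Lemma orbit_gcd_dvd n g a b : Gamma0 n g -> gcdp b n %| gcdp (g 1 0 * a + g 1 1 * b) n.
Proof.
case/andP=> _ gn; rewrite dvdp_gcd dvdp_gcdr andbT; apply: dvdp_add.
  by apply: dvdp_mulr; apply: dvdp_trans gn; exact: dvdp_gcdr.
by apply: dvdp_mull; exact: dvdp_gcdl.
Qed.

Lemma orbit_gcd n a b a' b' : coprimep a b -> coprimep a' b' ->
  cusp_orbit n (pt a b) (pt a' b') -> gcdp b n %= gcdp b' n.
Proof.
move=> cab cab' h; have [g [gG _ Eb]] := orbit_primitive cab cab' h.
have h' : cusp_orbit n (pt a' b') (pt a b).
  by rewrite (cusp_orbit_eq h); apply: cusp_orbit_refl.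
have [g' [gG' _ Eb']] := orbit_primitive cab' cab h'.
apply/andP; split; first by rewrite Eb; exact: orbit_gcd_dvd.
by rewrite Eb'; exact: orbit_gcd_dvd.
Qed.

Lemma gcdp_divisor d n : d %| n -> gcdp d n %= d.
Proof. by move=> dn; rewrite /eqp dvdp_gcdl dvdp_gcd dvdpp. Qed.

Lemma coprimep_divisor a d n : d %| n -> coprimep a n -> coprimep a d.
Proof. by move=> dn; apply: coprimep_dvdl. Qed.

Lemma height_unique n (x : set 'cV[K]_2) d d' : cusps n x ->
  d \is monic -> d %| n -> d' \is monic -> d' %| n ->
  has_height n x d -> has_height n x d' -> d = d'.
Proof.
move=> hx dm dn dm' dn' [a [_ ca ha]] [a' [_ ca' ha']].
have cad := coprimep_divisor dn ca; have cad' := coprimep_divisor dn' ca'.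
rewrite (cusps_eq hx ha) in ha'.
have := orbit_gcd cad cad' ha'.
rewrite (eqp_ltrans (gcdp_divisor dn)) (eqp_rtrans (gcdp_divisor dn')).
by rewrite eqp_monic // => /eqP.
Qed.

Lemma maps_oo_height n (x : set 'cV[K]_2) d g : cusps n x -> d %| n ->
  has_height n x d -> maps_oo_to g x -> gcdp (g 1 0) n %= d.
Proof.
move=> hx dn [a [_ ca ha]] [gu hg].
rewrite (cusps_eq hx ha) in hg.
have := orbit_gcd (coprimep_divisor dn ca) (unitmx_coprime_col0 gu) hg.
by rewrite (eqp_ltrans (gcdp_divisor dn)) eqp_sym.
Qed.

(** The witness is the part of n prime to a. A prime factor of n dividing a divides neither m nor k;
    any other divides k but not a. *)
Lemma coprimep_lift a m n : n != 0 -> coprimep a m -> exists k, coprimep (a + m * k) n.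
Proof.
move=> n0 cam; exists (gdcop a n); set k := gdcop a n.
have cka : coprimep k a by rewrite coprimep_gdco.
have [a0|a0] := eqVneq a 0.
  rewrite a0 add0r; move: cam cka; rewrite a0 coprime0p coprimep0 => m1 k1.
  by rewrite coprimepMl (eqp_coprimepl _ m1) (eqp_coprimepl _ k1) coprime1p.
apply: (coprimep_dvdl (dvdp_gdcor n a0)); rewrite coprimepMr; apply/andP; split.
  by rewrite coprimep_sym addrC coprimep_addl_mul.
apply: coprimep_expr; rewrite coprimep_sym -[a in X in coprimep _ X]mul1r coprimep_addl_mul.
by rewrite coprimepMr cam coprimep_sym.
Qed.

Lemma coprimep_lift_monic a m n : n \is monic -> m != 0 -> coprimep a m ->
  exists k, coprimep (a + m * k) n /\ a + m * k \is monic.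
Proof.
move=> nm m0 cam; have n0 := monic_neq0 nm; have [k hk] := coprimep_lift n0 cam.
(* The added multiple of m n changes no residue modulo m or n, has leading coefficient 1, and
   dominates thanks to X^N. *)
pose N := size (a + m * k); exists (k + (lead_coef m)^-1 *: (n * 'X^N)).
have l0 : lead_coef m != 0 by rewrite lead_coef_eq0.
rewrite mulrDr addrA; split.
  rewrite -scalerAr scalerAl mulrCA coprimep_sym addrC mulrC coprimep_addl_mul.
  by rewrite coprimep_sym.
rewrite monicE lead_coefDr.
  rewrite lead_coefM lead_coefZ lead_coefM (monicP nm) lead_coefXn !mulr1.
  by rewrite mulfV.
rewrite size_mul // ?scaler_eq0 ?invr_eq0 ?mulf_eq0 ?negb_or ?l0 ?n0 ?expf_eq0 ?polyX_eq0 ?andbF //.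
rewrite size_scale ?invr_eq0 // size_mulXn // -/N.
have : (0 < size m)%N by rewrite size_poly_gt0.
have : (0 < size n)%N by rewrite size_poly_gt0.
by case: (size n) => // i _; case: (size m) => // j _; rewrite addSn /= addnS addnS ltnS addnCA leq_addr.
Qed.

Lemma primitive_repr u : u != 0 -> exists a b c, [/\ coprimep a b, c != 0 & u = c *: pt a b].
Proof.
move=> u0; have [p0 [s0 [s00 E0]]] := fraction_repr (u 0 0).
have [p1 [s1 [s10 E1]]] := fraction_repr (u 1 0).
pose x := p0 * s1; pose y := p1 * s0; pose D := gcdp x y.
have S0 : tofrac s0 != 0 :> K by rewrite tofrac_eq0'.
have S1 : tofrac s1 != 0 :> K by rewrite tofrac_eq0'.
have xy0 : (x != 0) || (y != 0).
  rewrite -negb_and; apply: contra u0 => /andP[]; rewrite !mulf_eq0 (negbTE s00) (negbTE s10) !orbF.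
  move=> /eqP z0 /eqP z1; apply/eqP/matrixP; apply: ord2P => j; rewrite !ord1 !mxE.
    by rewrite E0 z0 tofrac0 mul0r.
  by rewrite E1 z1 tofrac0 mul0r.
have D0 : D != 0 by rewrite gcdp_eq0 negb_and.
exists (x %/ D), (y %/ D), (tofrac D / (tofrac s0 * tofrac s1)); split.
- by rewrite coprimep_div_gcd.
- have D1 : tofrac D != 0 :> K by rewrite tofrac_eq0'.
  have SS := invr_neq0 (mulf_neq0 S0 S1).
  exact: (mulf_neq0 D1 SS).
have Ex : tofrac D * tofrac (x %/ D) = tofrac p0 * tofrac s1 :> K.
  by rewrite -!tofracM mulrC divpK ?dvdp_gcdl.
have Ey : tofrac D * tofrac (y %/ D) = tofrac p1 * tofrac s0 :> K.
  by rewrite -!tofracM mulrC divpK ?dvdp_gcdr.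
exact: scale_colP S0 S1 E0 E1 Ex Ey.
Qed.

(** Move (a : b) by a matrix with lower row (n Ga, De) such that n Ga a + De b is the monic gcd d of
    b and n; a translation then makes the upper entry monic and prime to n. *)
Lemma cusp_height n (x : set 'cV[K]_2) : n \is monic -> cusps n x ->
  exists d, [/\ d \is monic, d %| n & has_height n x d].
Proof.
move=> nm [u u0 Ex]; have n0 := monic_neq0 nm.
have [a [b [c [cab c0 Eu]]]] := primitive_repr u0.
have hx : x (pt a b).
  rewrite -Ex; exists 1%:M, c^-1; split; [exact: Gamma0_1 | exact: invr_neq0 c0 |].
  by rewrite map_mx1; apply: (scalemx_mulmx_inv (mul1mx _) c0); rewrite mul1mx.
have cx : cusps n x by exists u.
pose d0 := gcdp b n; have d00 : d0 != 0 by rewrite gcdp_eq0 negb_and n0 orbT.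
have l0 : lead_coef d0 != 0 by rewrite lead_coef_eq0.
pose d := (lead_coef d0)^-1 *: d0.
have dm : d \is monic by rewrite monicE lead_coefZ mulVf.
have dd0 : d %= d0 by apply: eqp_scale; rewrite invr_eq0.
have dn : d %| n by rewrite (eqp_dvdl _ dd0) dvdp_gcdr.
have db : d %| b by rewrite (eqp_dvdl _ dd0) dvdp_gcdl.
have dn0 : d != 0 := monic_neq0 dm.
pose n' := n %/ d; pose b' := b %/ d.
have En : n' * d = n by rewrite divpK.
have Eb : b' * d = b by rewrite divpK.
have cop : coprimep b' (n' * a).
  rewrite coprimepMr; apply/andP; split.
    have : coprimep (b %/ d0) (n %/ d0) by rewrite coprimep_div_gcd // n0 orbT.
    have il0 : (lead_coef d0)^-1 != 0 by rewrite invr_eq0.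
    by rewrite /b' /n' /d !divpZr // coprimepZl ?coprimepZr ?invr_eq0.
  by apply: (coprimep_dvdr (p := b)); [rewrite -Eb dvdp_mulIl | rewrite coprimep_sym].
have [y [z yz]] := Bezout1 cop.
have cyn : coprimep y (n' * a).
  apply/Bezout_eq1_coprimepP; exists (b', z) => /=; by rewrite mulrC.
(* Shifting the Bezout solution (y, z) by k (n' a, - b') preserves the relation and makes [De] prime
   to n; it is prime to [Ga] because b' De + n' a Ga = 1. *)
have [k hk] := coprimep_lift n0 cyn.
pose De := y + n' * a * k; pose Ga := z - k * b'.
have row : n * Ga * a + De * b = d.
  rewrite -En -{1}Eb /De /Ga.
  transitivity (d * (y * b' + z * (n' * a))); first by ring.
  by rewrite yz mulr1.
have cGD : coprimep De (n * Ga).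
  rewrite coprimepMr hk /=; apply/Bezout_eq1_coprimepP; exists (b', n' * a) => /=.
  rewrite -yz /De /Ga; ring.
have [al [be ab]] := Bezout1 cGD.
pose g := mx2 al (- be) (n * Ga) De.
have gG : Gamma0 n g.
  rewrite /Gamma0 mx2E dvdp_mulIl andbT; apply: mx2_unit.
  by rewrite mulNr opprK -ab.
have h1 := orbit_of_act a b gG.
rewrite !mx2E row in h1.
have cad : coprimep (al * a + - be * b) d.
  by have := coprimep_act (Gamma0_unit gG) cab; rewrite !mx2E row.
have [k' [hk1 hk2]] := coprimep_lift_monic nm dn0 cad.
exists d; split=> //; exists (al * a + - be * b + d * k'); split=> //.
pose t := mx2 1 k' 0 1.
have tG : Gamma0 n t by rewrite /Gamma0 mx2E dvdp0 andbT; apply: mx2_unit; ring.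
have h2 := orbit_of_act (al * a + - be * b) d tG.
rewrite !mx2E !mul1r mul0r add0r in h2.
rewrite (cusps_eq cx hx) -(cusp_orbit_eq h1) [d * k']mulrC; exact: h2.
Qed.

(** For monic n and monic d dividing n, the cusps of height d correspond to the units of A modulo
    this gcd, up to nonzero constants. *)
Definition cusp_modulus n d := gcdp d (n %/ d).

Lemma same_height_orbit n d a a' (e : Fq) : n != 0 -> d %| n -> e != 0 ->
  coprimep a n -> coprimep a' n ->
  cusp_modulus n d %| a' - e%:P * a -> cusp_orbit n (pt a d) = cusp_orbit n (pt a' d).
Proof.
move=> n0 dn e0 ca0 ca' hm; set b := e%:P * a in hm.
have ca : coprimep b n.
  by rewrite /b mul_polyC coprimepZl.
transitivity (cusp_orbit n (pt b d)).
  pose s := mx2 e%:P 0 0 1.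
  have sG : Gamma0 n s.
    rewrite /Gamma0 mx2E dvdp0 andbT unitmxE det_mx2 mulr1 mul0r subr0.
    by rewrite poly_unitE size_polyC e0 coefC /= unitfE.
  have h := orbit_of_act a d sG; rewrite !mx2E !mul0r !mul1r addr0 add0r in h.
  by rewrite (cusp_orbit_eq h).
pose n' := n %/ d; have En : n' * d = n by rewrite divpK.
have d0 : d != 0 by apply: contraTneq dn => ->; rewrite dvd0p.
(* Solvable because d is prime to b a', so that gcd(d, n' b a') is the cusp modulus. The relation is
   what makes the matrix [g] below have determinant 1 and send (b, d) to (a', d). *)
have [x [y Exy]] : exists x y, x * d + y * (n' * (b * a')) = a' - b.
  have cd : coprimep d (b * a').
    by rewrite coprimepMr ![coprimep d _]coprimep_sym !(coprimep_divisor dn).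
  have eq1 : gcdp d (n' * (b * a')) %= gcdp d n' by apply: Gauss_gcdpl.
  have hm' : gcdp d (n' * (b * a')) %| a' - b by rewrite (eqp_dvdl _ eq1).
  have [[x y] /= exy] := Bezoutp d (n' * (b * a')).
  have : x * d + y * (n' * (b * a')) %| a' - b by rewrite (eqp_dvdl _ exy).
  move=> /dvdpP[k ->]; exists (k * x), (k * y); ring.
pose g := mx2 (1 + n' * y * a') x (n * y) (1 - n' * y * b) : 'M[A]_2.
have rel : a' - b = x * d + y * (n' * (b * a')) by [].
have gG : Gamma0 n g.
  rewrite /Gamma0 mx2E dvdp_mulIl andbT; apply: mx2_unit.
  rewrite -En.
  transitivity (1 + n' * y * (a' - b - (x * d + y * (n' * (b * a'))))); first by ring.
  by rewrite rel subrr mulr0 addr0.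
have h := orbit_of_act b d gG; rewrite !mx2E in h.
have E1 : (1 + n' * y * a') * b + x * d = a'.
  transitivity (b + (x * d + y * (n' * (b * a')))); first by ring.
  by rewrite Exy addrC subrK.
have E2 : n * y * b + (1 - n' * y * b) * d = d by rewrite -En; ring.
by rewrite E1 E2 in h; rewrite (cusp_orbit_eq h).
Qed.

Lemma same_orbit_height n d a a' : n != 0 -> d %| n -> coprimep a n -> coprimep a' n ->
  cusp_orbit n (pt a d) = cusp_orbit n (pt a' d) ->
  exists2 e : Fq, e != 0 & cusp_modulus n d %| a' - e%:P * a.
Proof.
move=> n0 dn ca ca' E; have d0 : d != 0 by apply: contraTneq dn => ->; rewrite dvd0p.
have h : cusp_orbit n (pt a d) (pt a' d) by rewrite E; apply: cusp_orbit_refl.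
have [g [/andP[gu gn] Ea Ed]] := orbit_primitive (coprimep_divisor dn ca) (coprimep_divisor dn ca') h.
set m := cusp_modulus n d.
pose n' := n %/ d; have En : n' * d = n by rewrite divpK.
have md : m %| d by apply: dvdp_gcdl. have mn' : m %| n' by apply: dvdp_gcdr.
have [k Ek] := dvdpP _ _ gn.
have E11 : g 1 1 = 1 - n' * (k * a).
  apply: (mulIf d0); move: Ed; rewrite Ek -En => Ed.
  by rewrite mulrBl mul1r {2}Ed; ring.
(* The constant sought is det g: modulo m, both d and n vanish and g 1 1 is 1, so det g is congruent
   to g 0 0 and a' to g 0 0 * a. *)
have : size (\det g) == 1%N by move: (gu); rewrite unitmxE poly_unitE => /andP[].
move=> /size_poly1P[e e0 he]; exists e => //.
rewrite det2E E11 Ek in he.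
have -> : a' - e%:P * a = d * g 0 1 + n' * (k * a * a * g 0 0 + g 0 1 * k * d * a).
  by rewrite -he Ea -En; ring.
by apply: dvdp_add; apply: dvdp_mulr.
Qed.

(** After cancelling gcd(n, u), the condition on e is that n' divides w (e - 1) - u b for some b.
    The modulus m divides n' and u and is prime to w, so m divides e - 1; if m is constant, u is
    prime to n' and every e != 0 occurs. *)
Lemma cusp_weightE n d g : n != 0 -> d %| n -> g \in unitmx -> gcdp (g 1 0) n %= d ->
  cusp_weight n g = if size (cusp_modulus n d) == 1%N then q.-1 else 1%N.
Proof.
move=> n0 dn gu gd; set u := g 1 0 in gd *; set w := g 1 1; set m := cusp_modulus n d.
have d0 : d != 0 by apply: contraTneq dn => ->; rewrite dvd0p.
pose n' := n %/ d.
have g0 : gcdp n u != 0 by rewrite gcdp_eq0 negb_and n0.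
have gd' : gcdp n u %= d by rewrite (eqp_ltrans (gcdpC _ _)).
have nn : n %/ gcdp n u %= n'.
  rewrite -(eqp_mul2r _ _ g0) divpK ?dvdp_gcdl // (eqp_rtrans (eqp_mull n' gd')).
  by rewrite /n' divpK // eqpxx.
have du : d %| u by rewrite -(eqp_dvdl _ gd) dvdp_gcdl.
have mu : m %| u by apply: dvdp_trans du; apply: dvdp_gcdl.
have cmw : coprimep m w.
  apply: (coprimep_dvdr mu); rewrite coprimep_sym; exact: unitmx_coprime_row1.
have key e : `[< exists b, cusp_stab n g e b >] = (e != 0) && ((e == 1) || (size m == 1%N)).
  apply/asboolP/andP => [[b]|[e0]].
    rewrite cusp_stabE // => /andP[-> h]; split=> //.
    move: h; rewrite dvdp_mul_gcd // (eqp_dvdl _ nn) => h.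
    have : m %| w * (e - 1)%:P.
      rewrite -[w * _](subrK (u * b)); apply: dvdp_add; last exact: dvdp_mulr.
      by apply: dvdp_trans h; apply: dvdp_gcdr.
    rewrite Gauss_dvdpr //; have [->//|e1] := eqVneq e 1 => hd.
    apply/eqP/eqP; rewrite eqn_leq size_poly_gt0 gcdp_eq0 negb_and d0 andbT.
    have := dvdp_leq _ hd; rewrite polyC_eq0 subr_eq0 e1 => /(_ isT) hs.
    by apply: leq_trans hs (size_polyC_leq1 _).
  case/orP => [/eqP->|m1].
    by exists 0; rewrite cusp_stabE // oner_neq0 subrr polyC0 !mulr0 subrr mulr0 dvdp0.
  have cun : coprimep u n'.
    have -> : u = u %/ d * d by rewrite divpK.
    rewrite coprimepMl; apply/andP; split; last by rewrite /coprimep.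
    have : coprimep (u %/ gcdp n u) (n %/ gcdp n u).
      by rewrite coprimep_sym coprimep_div_gcd // n0.
    rewrite (eqp_coprimepr _ nn) => h; apply: (coprimep_dvdr _ h).
    rewrite -(dvdp_mul2r _ _ g0) divpK ?dvdp_gcdr //.
    have : u %/ d * gcdp n u %= u by rewrite (eqp_ltrans (eqp_mull _ gd')) divpK // eqpxx.
    by move=> /andP[].
  have [x [y xy]] := Bezout1 cun.
  exists (x * (w * (e - 1)%:P)); rewrite cusp_stabE // e0 /= dvdp_mul_gcd // (eqp_dvdl _ nn).
  have -> : w * (e - 1)%:P - u * (x * (w * (e - 1)%:P)) = n' * (y * (w * (e - 1)%:P)).
    by rewrite -[w * _ in X in X - _]mul1r -xy; ring.
  exact: dvdp_mulIl.
rewrite /cusp_weight; case: ifP => m1.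
  rewrite -(cardC1 (0 : Fq)); apply: eq_card => e; rewrite !inE key m1 orbT andbT //.
rewrite -(card1 (1 : Fq)); apply: eq_card => e; rewrite !inE key m1 orbF.
by case: (eqVneq e 1) => [->|]; rewrite ?oner_neq0 ?andbF.
Qed.

End Cusps.

(** * Counting cusps *)

Section Degree.
Variable (Fq : finFieldType).
Local Notation A := {poly Fq}.
Local Notation K := {fraction {poly Fq}}.
Local Notation q := #|Fq|.
Implicit Types (a b d m n : A).

Definition residues m : seq A := [seq a <- polyN Fq (size m).-1 | coprimep a m].

Definition phi m : nat := size (residues m).

Definition divs n : seq A := [seq d <- polyN Fq (size n) | (d \is monic) && (d %| n)].

Definition wt n d : nat := if size (cusp_modulus n d) == 1%N then q.-1 else 1%N.

Lemma mem_divs n d : n != 0 -> (d \in divs n) = (d \is monic) && (d %| n).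
Proof.
move=> n0; rewrite mem_filter mem_polyN; apply: andb_idr => /andP[_ dn].
exact: dvdp_leq.
Qed.

Lemma divs_uniq n : uniq (divs n).
Proof. by rewrite filter_uniq ?polyN_uniq. Qed.

Lemma monic_divisorsE n : n != 0 -> monic_divisors n = [set` divs n].
Proof.
move=> n0; apply/seteqP; split=> d /=.
  by move=> [dm dn]; rewrite mem_divs // dm.
by rewrite mem_divs // => /andP[].
Qed.

Lemma cusp_modulus_neq0 n d : d != 0 -> cusp_modulus n d != 0.
Proof. by move=> d0; rewrite gcdp_eq0 negb_and d0. Qed.

Definition height_divisor n (al : A -> int) : cuspdiv Fq :=
  fun c => \sum_(d \in monic_divisors n) al d * cuspP n d c.

Lemma height_divisorE n al (c : set 'cV[K]_2) d : n \is monic -> cusps n c ->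
  d \is monic -> d %| n -> has_height n c d -> height_divisor n al c = al d.
Proof.
move=> nm hc dm dn hd; have n0 := monic_neq0 nm.
have din : d \in divs n by rewrite mem_divs // dm.
rewrite /height_divisor monic_divisorsE // -fsbig_seq ?divs_uniq //.
rewrite (bigD1_seq d) ?divs_uniq //= big_seq_cond big1 ?addr0.
  rewrite /cuspP; case: asboolP => [_|[]]; by [rewrite mulr1 | split].
move=> d' /andP[]; rewrite mem_divs // => /andP[dm' dn'] dd'.
rewrite /cuspP; case: asboolP => [[_ hd']|_]; last by rewrite mulr0.
by rewrite (height_unique hc dm' dn' dm dn hd' hd) eqxx in dd'.
Qed.

Lemma height_divisor0 n al (c : set 'cV[K]_2) : n != 0 -> ~ cusps n c ->
  height_divisor n al c = 0.
Proof.
move=> n0 hc; rewrite /height_divisor monic_divisorsE // -fsbig_seq ?divs_uniq //.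
by rewrite big1 // => d _; rewrite /cuspP; case: asboolP => [[]//|_]; rewrite mulr0.
Qed.

Lemma residues_scale m a (e : Fq) : e != 0 -> a \in residues m -> e%:P * a \in residues m.
Proof.
move=> e0; rewrite !mem_filter !mem_polyN => /andP[ca sa].
by rewrite mul_polyC coprimepZl // ca /= size_scale.
Qed.

Lemma residues_eq m a b : m != 0 -> a \in residues m -> b \in residues m -> m %| a - b -> a = b.
Proof.
rewrite !mem_filter !mem_polyN => m0 /andP[_ sa] /andP[_ sb] h.
apply/eqP; rewrite -subr_eq0; apply: contraT => n0.
have := dvdp_leq n0 h; rewrite leqNgt => /negP[].
apply: leq_ltn_trans (size_polyD _ _) _; rewrite size_polyN gtn_max.
by rewrite -size_poly_gt0 in m0; rewrite -(prednK m0) !ltnS sa sb.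
Qed.

Lemma sum_fibers (I : eqType) (J : eqType) (f : I -> J) (s : seq I) (F : I -> int) :
  \sum_(x <- s) F x = \sum_(c <- undup (map f s)) \sum_(x <- s | f x == c) F x.
Proof.
rewrite [RHS](eq_bigr (fun c => \sum_(x <- s) if f x == c then F x else 0)); last first.
  by move=> c _; rewrite big_mkcond.
rewrite exchange_big /= big_seq [RHS]big_seq; apply: eq_bigr => x xs.
rewrite -big_mkcond /= (eq_bigl (fun c => c == f x)); last by move=> c; rewrite eq_sym.
rewrite -big_filter; have -> : [seq c <- undup (map f s) | c == f x] = [:: f x].
  by apply: filter_pred1_uniq; rewrite ?undup_uniq // mem_undup map_f.
by rewrite big_seq1.
Qed.

(* The residues prime to the modulus map onto the cusps of height [d]; the fibres
   are the orbits of the scalars, of size [(q - 1) / wt n d]. *)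
Lemma degree_relation n al : n \is monic ->
  (exists2 s, uniq s & cusps n = [set` s]) /\
  (cuspdeg n (height_divisor n al) = 0 ->
   \sum_(d <- divs n) (wt n d * phi (cusp_modulus n d))%:Z * al d = 0).
Proof.
move=> nm; have n0 := monic_neq0 nm.
pose md d := cusp_modulus n d.
pose L := [seq (d, a) | d <- divs n, a <- residues (md d)].
have memL d a : ((d, a) \in L) = [&& d \is monic, d %| n & a \in residues (md d)].
  apply/allpairsPdep/and3P => [[d' [a' [h1 h2 [-> ->]]]]|[h1 h2 h3]].
    by move: h1; rewrite mem_divs // => /andP[-> ->].
  by exists d, a; rewrite mem_divs // h1 h2.
have uL : uniq L.
  apply: allpairs_uniq_dep.
  - exact: divs_uniq.
  - by move=> d _; rewrite filter_uniq ?polyN_uniq.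
  - by move=> [d a] [d' a'] _ _ /= [-> ->].
have exl (x : A * A) : exists a', x \in L ->
    [/\ a' \is monic, coprimep a' n & md x.1 %| a' - x.2].
  case: x => d a; have [|h] := boolP ((d, a) \in L); last by exists 0.
  rewrite memL => /and3P[dm dn]; rewrite mem_filter => /andP[ca _].
  have [k [h1 h2]] := coprimep_lift_monic nm (cusp_modulus_neq0 n (monic_neq0 dm)) ca.
  by exists (a + md d * k) => _; split=> //=; rewrite addrAC subrr add0r dvdp_mulIl.
have [lft hl] := choice exl.
pose pt (x : A * A) : 'cV[K]_2 := ptP1 (tofrac (lft x)) (tofrac x.1).
pose f x := cusp_orbit n (pt x).
have cf x : x \in L -> cusps n (f x).
  move=> xL; exists (pt x) => //=; apply/negP => /eqP E.
  have := congr1 (fun M : 'cV[K]_2 => M 0 0) E; rewrite !mxE /= => /eqP.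
  by rewrite tofrac_eq0' => /eqP E0; have [/monic_neq0/eqP] := hl x xL.
have hf x : x \in L -> has_height n (f x) x.1.
  by move=> xL; have [lm lc _] := hl x xL; exists (lft x); split=> //; exact: cusp_orbit_refl.
have fE x d (xL : (d, x) \in L) : height_divisor n al (f (d, x)) = al d.
  have := xL; rewrite memL => /and3P[dm dn _].
  by apply: height_divisorE (cf _ xL) dm dn (hf _ xL).
have cuspsE : cusps n = [set` undup (map f L)].
  apply/seteqP; split=> c /=.
    move=> hc; have [d [dm dn [a [am ca ha]]]] := cusp_height nm hc.
    have d0 := monic_neq0 dm; have m0 := cusp_modulus_neq0 n d0.
    have mn : md d %| n by apply: dvdp_trans dn; apply: dvdp_gcdl.
    have xL : (d, a %% md d) \in L.
      rewrite memL dm dn /= mem_filter coprimep_modl (coprimep_divisor mn ca) mem_polyN /=.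
      by rewrite -ltnS prednK ?size_poly_gt0 // ltn_modp.
    rewrite mem_undup; apply/mapP; exists (d, a %% md d) => //.
    have [lm lc ld] := hl _ xL.
    rewrite (cusps_eq hc ha) /f /pt /=; symmetry.
    apply: (@same_height_orbit _ n d _ _ 1) => //; first exact: oner_neq0.
    rewrite polyC1 mul1r -(subrKA (a %% md d)); apply: dvdp_add.
      by rewrite {1}(divp_eq a (md d)) addrK dvdp_mull.
    by rewrite -opprB dvdpNr.
  by rewrite mem_undup => /mapP[x xL ->]; apply: cf.
split; first by exists (undup (map f L)); rewrite ?undup_uniq.
move=> hdeg.
have deg0 : \sum_(c <- undup (map f L)) height_divisor n al c = 0.
  by rewrite -[RHS]hdeg /cuspdeg cuspsE -fsbig_seq ?undup_uniq.
have fiber x0 : x0 \in L -> \sum_(x <- L | f x == f x0) (wt n x.1)%:Z = q.-1%:Z.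
  case: x0 => d0 a0 x0L; have := x0L; rewrite memL => /and3P[dm dn ra].
  have d00 := monic_neq0 dm; have m0 := cusp_modulus_neq0 n d00.
  have same x : x \in L -> f x = f (d0, a0) -> exists2 e : Fq, e != 0 & x = (d0, e%:P * a0).
    case: x => d a xL Ef; have := xL; rewrite memL => /and3P[dm' dn' ra'].
    have Ed : d = d0.
      apply: (height_unique (cf _ xL) dm' dn' dm dn (hf _ xL)).
      by rewrite Ef; apply: hf.
    subst d; have [_ lc ld] := hl _ xL; have [_ lc0 ld0] := hl _ x0L.
    have [e e0 he] := same_orbit_height n0 dn lc0 lc (esym Ef).
    exists e => //; congr pair; apply: (residues_eq m0 ra' (residues_scale e0 ra)).
    have -> : a - e%:P * a0 = (lft (d0, a) - e%:P * lft (d0, a0)) -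
        (lft (d0, a) - a) + e%:P * (lft (d0, a0) - a0) by ring.
    by apply: dvdp_add; [apply: dvdp_sub | apply: dvdp_mull].
  have back e : e != 0 -> (d0, e%:P * a0) \in L /\ f (d0, e%:P * a0) = f (d0, a0).
    move=> e0; have xL : (d0, e%:P * a0) \in L by rewrite memL dm dn residues_scale.
    split=> //; symmetry; have [_ lc ld] := hl _ xL; have [_ lc0 ld0] := hl _ x0L.
    apply: (same_height_orbit (e := e)) => //=.
    have -> : lft (d0, e%:P * a0) - e%:P * lft (d0, a0) =
      (lft (d0, e%:P * a0) - e%:P * a0) - e%:P * (lft (d0, a0) - a0) by ring.
    by apply: dvdp_sub => //; apply: dvdp_mull.
  rewrite -big_filter.
  have [m1|m1] := boolP (size (md d0) == 1%N).
    have -> : [seq x <- L | f x == f (d0, a0)] = [:: (d0, a0)].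
      apply: perm_small_eq => //; apply: uniq_perm; rewrite ?filter_uniq // => x.
      rewrite mem_filter inE; apply/andP/eqP => [[/eqP Ef xL]|-> //].
      have [e e0 ->] := same x xL Ef; congr pair.
      move: ra; rewrite mem_filter mem_polyN (eqP m1) /= leqn0 size_poly_eq0.
      by case/andP=> _ /eqP->; rewrite mulr0.
    by rewrite big_seq1 /wt m1.
  have a00 : a0 != 0.
    apply: contraNneq m1 => a00; move: ra; rewrite mem_filter a00 => /andP[].
    by rewrite coprime0p -size_poly_eq1.
  have pe : perm_eq [seq x <- L | f x == f (d0, a0)]
      [seq (d0, e%:P * a0) | e <- [seq e <- enum Fq | e != 0]].
    apply: uniq_perm; first exact: filter_uniq.
      rewrite map_inj_uniq; first exact/filter_uniq/enum_uniq.
      by move=> e e' [/(mulIf a00)/polyC_inj].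
    move=> x; rewrite mem_filter; apply/andP/mapP => [[/eqP Ef xL]|[e]].
      have [e e0 ->] := same x xL Ef; exists e => //.
      by rewrite mem_filter e0 mem_enum.
    rewrite mem_filter => /andP[e0 _ ->]; have [h1 h2] := back e e0.
    by rewrite h2.
  rewrite (perm_big _ pe) big_map (eq_bigr (fun=> 1)) => [|e _]; last first.
    by rewrite /wt /= (negbTE m1).
  rewrite big_filter big_enum_cond /= sumr_const -(cardC1 (0 : Fq)).
  by rewrite natz; congr (Posz _); apply: eq_card => e; rewrite !inE andbT.
(* With these weights every cusp is counted q - 1 times, so the sum over residues is q - 1 times the
   degree. *)
have : \sum_(x <- L) (wt n x.1)%:Z * height_divisor n al (f x) = 0.
  rewrite (sum_fibers f).
  transitivity (\sum_(c <- undup (map f L)) q.-1%:Z * height_divisor n al c).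
    rewrite big_seq [RHS]big_seq; apply: eq_bigr => c; rewrite mem_undup => /mapP[x0 x0L ->].
    transitivity ((\sum_(x <- L | f x == f x0) (wt n x.1)%:Z) * height_divisor n al (f x0)).
      by rewrite mulr_suml; apply: eq_bigr => x /eqP ->.
    by rewrite fiber.
  by rewrite -mulr_sumr deg0 mulr0.
rewrite big_allpairs_dep /= => E; rewrite -[RHS]E big_seq [RHS]big_seq.
apply: eq_bigr => d dd.
transitivity (\sum_(a <- residues (md d)) (wt n d)%:Z * al d).
  rewrite big_const_seq count_predT iter_addr addr0 /phi -/(md d).
  by rewrite PoszM -mulr_natr natz; ring.
rewrite big_seq [RHS]big_seq; apply: eq_bigr => a aa; rewrite fE //.
by move: dd; rewrite memL mem_divs // => /andP[-> ->].
Qed.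

Lemma card_polyN N : size (polyN Fq N) = (q ^ N)%N.
Proof. by rewrite size_map -cardE card_mx mul1n. Qed.

Lemma phi_eqp m m' : m %= m' -> phi m = phi m'.
Proof.
move=> h; rewrite /phi /residues (eqp_size h); congr size; apply: eq_filter => a.
exact: eqp_coprimepr.
Qed.

(** Chinese remainder theorem; surjectivity follows from injectivity by counting. *)
Lemma phiM m m' : m != 0 -> m' != 0 -> coprimep m m' -> phi (m * m') = (phi m * phi m')%N.
Proof.
move=> m0 m0' cop; set s := (size m).-1; set s' := (size m').-1.
have sm : size m = s.+1 by rewrite prednK ?size_poly_gt0.
have sm' : size m' = s'.+1 by rewrite prednK ?size_poly_gt0.
have smm : (size (m * m')).-1 = (s + s')%N by rewrite size_mul // sm sm' addnS.
pose f a := (a %% m, a %% m').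
have fin a : f a \in [seq (x, y) | x <- polyN Fq s, y <- polyN Fq s'].
  apply/allpairsP; exists (f a); split=> //; first by rewrite mem_polyN -ltnS -sm ltn_modp.
  by rewrite mem_polyN -ltnS -sm' ltn_modp.
have finj : {in polyN Fq (s + s') &, injective f}.
  move=> a b; rewrite !mem_polyN => sa sb [E1 E2].
  apply/eqP; rewrite -subr_eq0; apply: contraT => ab0.
  have : m * m' %| a - b.
    by rewrite Gauss_dvdp // /dvdp !modpD !modpN E1 E2 !subrr eqxx.
  move/(dvdp_leq ab0); rewrite leqNgt => /negP[].
  apply: leq_ltn_trans (size_polyD _ _) _; rewrite size_polyN size_mul // sm sm' addnS /= addSn ltnS.
  by rewrite geq_max sa sb.
have pe : perm_eq (map f (polyN Fq (s + s'))) [seq (x, y) | x <- polyN Fq s, y <- polyN Fq s'].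
  have u2 : uniq [seq (x, y) | x <- polyN Fq s, y <- polyN Fq s'].
    by apply: allpairs_uniq; rewrite ?polyN_uniq // => -[? ?] [? ?].
  have u1 : uniq (map f (polyN Fq (s + s'))) by rewrite map_inj_in_uniq ?polyN_uniq.
  apply: uniq_perm => //; apply: (uniq_min_size u1 _ _).2.
    by move=> x /mapP[a _ ->].
  by rewrite size_allpairs !card_polyN (size_map f) card_polyN expnD.
rewrite /phi /residues smm !size_filter.
transitivity (count (fun x : A * A => coprimep x.1 m && coprimep x.2 m') (map f (polyN Fq (s + s')))).
  by rewrite [RHS]count_map; apply: eq_count => a /=; rewrite coprimepMr !coprimep_modl.
rewrite (permP pe) -sum1_count big_mkcond big_allpairs_dep /= -/s -/s'.
rewrite -!sum1_count big_distrl /= [RHS]big_mkcond; apply: eq_bigr => a _.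
case: (coprimep a m) => /=; last by rewrite big1.
by rewrite mul1n -big_mkcond.
Qed.

Lemma phi_pow (p : A) k : irreducible_poly p -> (0 < k)%N ->
  phi (p ^+ k) = (anorm p ^ k.-1 * (anorm p - 1))%N.
Proof.
move=> pirr k0; have [sp _] := pirr; have p0 : p != 0 by rewrite -size_poly_gt0 ltnW.
set s := (size p).-1; have sps : size p = s.+1 by rewrite prednK // ltnW.
have spk : (size (p ^+ k)).-1 = (s * k.-1 + s)%N.
  by rewrite size_exp -/s /= -mulnSr prednK.
rewrite /phi /residues spk size_filter.
rewrite (eq_count (a2 := predC (fun a => p %| a))); last first.
  by move=> a /=; rewrite coprimep_pexpr // coprimep_sym irreducible_poly_coprime.
have h : (count (fun a => (p %| a)%R) (polyN Fq (s * k.-1 + s)) = q ^ (s * k.-1))%N.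
  rewrite -size_filter (perm_size (polyN_multiples (s * k.-1) p0)) size_map.
  exact: card_polyN.
have := count_predC (fun a => p %| a) (polyN Fq (s * k.-1 + s)).
rewrite h card_polyN expnD => E.
rewrite /anorm -/s -expnM mulnBr muln1 -E; lia.
Qed.

End Degree.

(** * The matrix of orders *)

Section LocalMatrix.
Implicit Types (r i j k : nat) (x : int).

(* [x ^ (local_order r i j)] is the order of the function of level [p ^ i] at the
   cusps of height [p ^ j] of level [p ^ r]. *)
Definition local_order r i j : nat := (2 * minn i j + (r - minn r (2 * j)) - i)%N.

(** At j = k the combination (-x, x^2 + 1, -x) of orders gives x^(maxn (r - k) k) (x^2 - 1); the
    extra power of x raises it to the common value x^(r-1) (x^2 - 1). At k = 0 and k = r the two
    entries x and -1 give this value directly. *)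
Definition mu_diag x r k : int := if (k == 0%N) || (k == r) then x else
  x ^+ (r.-1 - maxn (r - k) k) * (x ^+ 2 + 1).
Definition mu_off x r k : int := if (k == 0%N) || (k == r) then -1 else
  - (x ^+ (r.-1 - maxn (r - k) k) * x).

(* Column [k] of [x ^ (r - 1) (x ^ 2 - 1)] times the inverse of the matrix of orders,
   which is tridiagonal. *)
Definition mu x r k i : int :=
  (i == k)%:R * mu_diag x r k + ((i.+1 == k)%:R + (i == k.+1)%:R) * mu_off x r k.

Lemma sum_delta (F : nat -> int) (c : int) r k :
  \sum_(i < r.+1) F i * ((i == k :> nat)%:R * c) = if (k <= r)%N then F k * c else 0.
Proof.
case: leqP => h.
  rewrite (bigD1 (Ordinal (h : (k < r.+1)%N))) //= eqxx mul1r big1 ?addr0 // => i /eqP ik.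
  by case: eqP => [E|_]; [case: ik; apply: val_inj | rewrite mul0r mulr0].
rewrite big1 // => i _; case: eqP => [E|_]; last by rewrite mul0r mulr0.
by have := ltn_ord i; rewrite E ltnS leqNgt h.
Qed.

Lemma sum_mu (F : nat -> int) x r k : (k <= r)%N ->
  \sum_(i < r.+1) F i * mu x r k i = F k * mu_diag x r k +
    (if (0 < k)%N then F k.-1 * mu_off x r k else 0) +
    (if (k < r)%N then F k.+1 * mu_off x r k else 0).
Proof.
move=> kr; rewrite (eq_bigr (fun i : 'I_r.+1 => F i * ((i == k :> nat)%:R * mu_diag x r k) +
   (F i * ((i.+1 == k :> nat)%:R * mu_off x r k) + F i * ((i == k.+1 :> nat)%:R * mu_off x r k)))).
  rewrite !big_split /= !sum_delta kr -addrA; congr (_ + (_ + _)).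
  case: k kr => [|k] kr /=; first by rewrite big1 // => i _; rewrite mul0r mulr0.
  under eq_bigr do rewrite eqSS.
  by rewrite sum_delta ltnW.
by move=> i _; rewrite /mu; ring.
Qed.

(** For fixed j, the entries x ^ local_order r i j are multiplied by x at each step up to i = j and
    divided by x afterwards. The combination (-x, x^2 + 1, -x) kills geometric progressions of ratio
    x and 1 / x, so only the peak j = k survives. At an end of the range one progression remains,
    and (x, -1) suffices. *)
Lemma local_inverse x r j k : (0 < r)%N -> (j <= r)%N -> (k <= r)%N ->
  \sum_(i < r.+1) x ^+ local_order r i j * mu x r k i =
  if j == k then (x ^+ 2 - 1) * x ^+ r.-1 else 0.
Proof.
move=> r0 jr kr; rewrite (sum_mu (fun i => x ^+ local_order r i j)) //.
rewrite /mu_diag /mu_off.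
have [k0|k0] := eqVneq k 0%N.
  rewrite k0 /= r0 addr0; have [j0|j0] := eqVneq j 0%N.
    have -> : local_order r 0 j = r.-1.+1 by rewrite /local_order; lia.
    have -> : local_order r 1 j = r.-1 by rewrite /local_order; lia.
    by rewrite exprS; ring.
  have -> : local_order r 1 j = (local_order r 0 j).+1 by rewrite /local_order; lia.
  by rewrite exprS; ring.
have kp : (0 < k)%N by rewrite lt0n.
rewrite kp /=; have [kr'|kr'] := eqVneq k r.
  rewrite kr' ltnn addr0; have [jr'|jr'] := eqVneq j r.
    have -> : local_order r r j = r.-1.+1 by rewrite /local_order; lia.
    have -> : local_order r r.-1 j = r.-1 by rewrite /local_order; lia.
    by rewrite exprS; ring.
  have -> : local_order r r.-1 j = (local_order r r j).+1 by rewrite /local_order; lia.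
  by rewrite exprS; ring.
have kr2 : (k < r)%N by rewrite ltn_neqAle kr' kr.
rewrite kr2 /=; have [E|jk] := eqVneq j k.
  have -> : r.-1 = ((r.-1 - maxn (r - k) k) + (maxn (r - k) k).-1.+1)%N by lia.
  have -> : local_order r k j = (maxn (r - k) k).-1.+1 by rewrite /local_order; lia.
  have -> : local_order r k.-1 j = (maxn (r - k) k).-1 by rewrite /local_order; lia.
  have -> : local_order r k.+1 j = (maxn (r - k) k).-1 by rewrite /local_order; lia.
  have -> : (r.-1 - maxn (r - k) k + (maxn (r - k) k).-1.+1 - maxn (r - k) k =
    r.-1 - maxn (r - k) k)%N by lia.
  by rewrite exprD exprS; ring.
have [lt|ge] := ltnP j k.
  have -> : local_order r k.-1 j = (local_order r k.+1 j).+2 by rewrite /local_order; lia.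
  have -> : local_order r k j = (local_order r k.+1 j).+1 by rewrite /local_order; lia.
  by rewrite !exprS; ring.
have {}ge : (k < j)%N by rewrite ltn_neqAle eq_sym jk.
have -> : local_order r k.+1 j = (local_order r k.-1 j).+2 by rewrite /local_order; lia.
have -> : local_order r k j = (local_order r k.-1 j).+1 by rewrite /local_order; lia.
by rewrite !exprS; ring.
Qed.

Definition local_phi x (m : nat) : int := if m == 0%N then 1 else x ^+ m.-1 * (x - 1).

(** The local form of the link between degree and weight: column sums are x - 1 times the Euler
    function of p^(minn k (r - k)), the cusp modulus at height p^k. *)
Lemma local_sum x r k : (0 < r)%N -> (k <= r)%N ->
  \sum_(i < r.+1) mu x r k i = (x - 1) * local_phi x (minn k (r - k)).
Proof.
move=> r0 kr; rewrite (eq_bigr (fun i : 'I_r.+1 => 1 * mu x r k i)); last first.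
  by move=> i _; rewrite mul1r.
rewrite (sum_mu (fun=> 1)) // /mu_diag /mu_off /local_phi.
have [k0|k0] := eqVneq k 0%N; first by rewrite k0 min0n /= r0; ring.
have kp : (0 < k)%N by rewrite lt0n.
rewrite kp /=; have [kr'|kr'] := eqVneq k r.
  by rewrite kr' subnn minn0 ltnn /=; ring.
have kr2 : (k < r)%N by rewrite ltn_neqAle kr' kr.
rewrite kr2; have -> : (minn k (r - k) == 0)%N = false by lia.
have -> : (r.-1 - maxn (r - k) k = (minn k (r - k)).-1)%N by lia.
by ring.
Qed.

End LocalMatrix.

(** * Divisors and exponent vectors *)

Section Exponents.
Variables (Fq : finFieldType) (s : nat) (p : 'I_s -> {poly Fq}).
Hypotheses (p_monic : forall i, p i \is monic).
Hypotheses (p_irr : forall i, irreducible_poly (p i)).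
Hypotheses (p_inj : injective p).
Implicit Types (k l r : 'I_s -> nat) (d u : {poly Fq}).

Definition dd k : {poly Fq} := \prod_(i < s) p i ^+ k i.

Lemma p_neq0 i : p i != 0. Proof. exact: monic_neq0. Qed.

Lemma dd_monic k : dd k \is monic.
Proof. by apply: monic_prod => i _; apply: monic_exp. Qed.

Lemma dd_neq0 k : dd k != 0. Proof. exact/monic_neq0/dd_monic. Qed.

Lemma p_coprime i j : i != j -> coprimep (p i) (p j).
Proof.
move=> ij; rewrite irreducible_poly_coprime //; apply/negP => h.
have [_ hj] := p_irr j; have [si _] := p_irr i.
have := hj (p i); rewrite neq_ltn si orbT => /(_ isT h).
by rewrite eqp_monic // => /eqP/p_inj/eqP; rewrite (negbTE ij).
Qed.

Lemma ddD k l : dd k * dd l = dd (fun i => k i + l i)%N.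
Proof. by rewrite -big_split; apply: eq_bigr => i _; rewrite exprD. Qed.

Lemma dd_ext k l : k =1 l -> dd k = dd l.
Proof. by move=> h; apply: eq_bigr => i _; rewrite h. Qed.

Lemma dd_exp_le k i t : p i ^+ t %| dd k -> (t <= k i)%N.
Proof.
rewrite /dd (bigD1 i) //= Gauss_dvdpl.
  by rewrite dvdp_Pexp2l //; case: (p_irr i).
apply: coprimep_expl; elim/big_ind: _ => [|x y hx hy|j ji]; first exact: coprimep1.
  by rewrite coprimepMr hx hy.
by apply: coprimep_expr; apply: p_coprime; rewrite eq_sym.
Qed.

Lemma dd_dvdP k l : reflect (forall i, (k i <= l i)%N) (dd k %| dd l).
Proof.
apply: (iffP idP) => [h i|h].
  apply: dd_exp_le; apply: dvdp_trans h; rewrite /dd (bigD1 i) //=; exact: dvdp_mulIl.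
rewrite (@dd_ext l (fun i => k i + (l i - k i))%N); last by move=> i; rewrite subnKC.
by rewrite -ddD dvdp_mulIl.
Qed.

Lemma dd_inj k l : dd k = dd l -> k =1 l.
Proof.
move=> E i; apply/eqP; rewrite eqn_leq.
by rewrite (elimT (dd_dvdP k l) _ i) ?(elimT (dd_dvdP l k) _ i) // E dvdpp.
Qed.

Lemma dd_divisor d k : d \is monic -> d %| dd k ->
  exists2 l, (forall i, (l i <= k i)%N) & d = dd l.
Proof.
have [N] := ubnP (size d); elim: N d k => // N IH d k hN dm dk.
have [/existsP[i hi]|/existsPn hn] := boolP [exists i, p i %| d]; last first.
  have cop : coprimep d (dd k).
    rewrite /dd; elim/big_ind: _ => [|x y hx hy|j _]; first exact: coprimep1.
      by rewrite coprimepMr hx hy.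
    by apply: coprimep_expr; rewrite coprimep_sym irreducible_poly_coprime.
  exists (fun=> 0%N) => //; rewrite /dd big1 => [|i _]; last by rewrite expr0.
  apply/eqP; rewrite -eqp_monic ?monic1 //.
  have : coprimep d d by apply: (coprimep_dvdl dk).
  by rewrite coprimepp size_poly_eq1.
have ki : (0 < k i)%N.
  by apply: (@dd_exp_le k i 1); rewrite expr1; apply: dvdp_trans dk.
pose de (j : 'I_s) : nat := (j == i).
have pde : dd de = p i.
  by rewrite /dd (bigD1 i) //= /de eqxx expr1 big1 ?mulr1 // => j /negbTE->; rewrite expr0.
have Ed : d = p i * (d %/ p i) by rewrite mulrC divpK.
have Ek : dd k = p i * dd (fun j => k j - de j)%N.
  rewrite -pde ddD; apply: dd_ext => j; rewrite /de; case: eqP => [->|_] /=; lia.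
have d0 : d %/ p i != 0.
  by apply: contraTneq dm => h; rewrite Ed h mulr0 monicE lead_coef0 eq_sym oner_eq0.
have [||| l hl El] := IH (d %/ p i) (fun j => k j - de j)%N.
- rewrite -ltnS; apply: leq_ltn_trans hN; rewrite size_divp ?p_neq0 // ltn_subrL.
  have [h _] := p_irr i; rewrite size_poly_gt0 (monic_neq0 dm) andbT.
  by rewrite -ltnS prednK // ltnW.
- by have := dm; rewrite {1}Ed monicMl.
- by move: dk; rewrite {1}Ed Ek dvdp_mul2l ?p_neq0.
exists (fun j => de j + l j)%N; last by rewrite Ed El -{1}pde ddD.
by move=> j; have := hl j; rewrite /de; case: eqP => [->|_] /=; lia.
Qed.

Lemma dd_gcd k l : gcdp (dd k) (dd l) %= dd (fun i => minn (k i) (l i)).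
Proof.
set g := gcdp _ _; have g0 : g != 0 by rewrite gcdp_eq0 negb_and dd_neq0.
have l0 : (lead_coef g)^-1 != 0 by rewrite invr_eq0 lead_coef_eq0.
have gm : (lead_coef g)^-1 *: g \is monic by rewrite monicE lead_coefZ mulVf // lead_coef_eq0.
have eg : (lead_coef g)^-1 *: g %= g by apply: eqp_scale.
have gk : (lead_coef g)^-1 *: g %| dd k by rewrite (eqp_dvdl _ eg) dvdp_gcdl.
have [m hm Em] := dd_divisor gm gk.
rewrite -(eqp_ltrans eg) Em (@dd_ext m (fun i => minn (k i) (l i))) ?eqpxx // => i.
apply/eqP; rewrite eqn_leq leq_min hm /=; apply/andP; split.
  by move: i; apply/dd_dvdP; rewrite -Em (eqp_dvdl _ eg) dvdp_gcdr.
move: i; apply/dd_dvdP; rewrite -Em (eqp_dvdr _ eg) dvdp_gcd.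
by apply/andP; split; apply/dd_dvdP => i; [apply: geq_minl | apply: geq_minr].
Qed.

Lemma anorm_dd k : anorm (dd k) = (\prod_(i < s) anorm (p i) ^ k i)%N.
Proof.
suff [_ ->] : dd k != 0 /\ anorm (dd k) = (\prod_(i < s) anorm (p i) ^ k i)%N by [].
rewrite /dd; elim/big_ind2: _ => [|x m y m' [x0 <-] [y0 <-]|i _].
- by rewrite oner_neq0 /anorm size_poly1.
- by rewrite mulf_neq0 // anormM.
by rewrite expf_neq0 ?p_neq0 // anormX ?p_neq0.
Qed.

Lemma phi1 : phi (1 : {poly Fq}) = 1%N.
Proof.
rewrite /phi /residues size_poly1 size_filter.
have -> : polyN Fq 0 = [:: 0].
  apply: perm_small_eq => //; apply: uniq_perm; rewrite ?polyN_uniq // => a.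
  by rewrite mem_polyN leqn0 size_poly_eq0 inE.
by rewrite /= coprimep1.
Qed.

Lemma anorm_p_gt1 i : (1 < anorm (p i))%N.
Proof.
by have [h _] := p_irr i; rewrite -(expn0 #|Fq|) ltn_exp2l ?(q_gt1 Fq) // -ltnS prednK // ltnW.
Qed.

Lemma phi_dd k : (phi (dd k))%:Z = \prod_(i < s) local_phi (anorm (p i))%:Z (k i).
Proof.
have key (t : seq 'I_s) : uniq t ->
    (phi (\prod_(i <- t) p i ^+ k i))%:Z = \prod_(i <- t) local_phi (anorm (p i))%:Z (k i).
  elim: t => [|i t IH] /=; first by rewrite !big_nil phi1.
  case/andP => it ut; rewrite !big_cons phiM ?PoszM ?IH //.
  - congr (_ * _); rewrite /local_phi; have [->|ki] := eqVneq (k i) 0%N; first by rewrite expr0 phi1.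
    rewrite phi_pow ?lt0n // PoszM -subzn ?(ltnW (anorm_p_gt1 i)) //.
    by congr (_ * _); rewrite -[LHS]natz natrX natz.
  - by rewrite expf_neq0 ?p_neq0.
  - by rewrite prodf_seq_neq0; apply/allP => j _; rewrite expf_neq0 ?p_neq0.
  apply: coprimep_expl; rewrite big_seq; elim/big_ind: _ => [|x y hx hy|j jt]; first exact: coprimep1.
    by rewrite coprimepMr hx hy.
  by apply: coprimep_expr; apply: p_coprime; apply: contraNneq it => ->.
by rewrite /dd; apply: (key (index_enum _)); apply: index_enum_uniq.
Qed.

Lemma cusp_modulus_dd r k : (forall i, (k i <= r i)%N) ->
  cusp_modulus (dd r) (dd k) %= dd (fun i => minn (k i) (r i - k i)).
Proof.
move=> h; rewrite /cusp_modulus.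
have -> : dd r %/ dd k = dd (fun i => r i - k i)%N.
  rewrite (@dd_ext r (fun i => (r i - k i) + k i)%N); last by move=> i; rewrite subnK.
  by rewrite -ddD mulpK ?dd_neq0.
exact: dd_gcd.
Qed.

(** Write d, up to a constant, as x u + y n; its square is congruent to x^2 u^2 modulo n. *)
Lemma gcdp_sqr n u d : n != 0 -> gcdp u n %= d -> gcdp n (u ^+ 2) %= gcdp n (d ^+ 2).
Proof.
move=> n0 ud; have du : d %| u by rewrite -(eqp_dvdl _ ud) dvdp_gcdl.
apply/andP; split; rewrite dvdp_gcd dvdp_gcdl /=.
  have [[x y] /= xy] := Bezoutp u n.
  have E : d ^+ 2 %= (x * u + y * n) ^+ 2.
    by apply: eqp_exp; rewrite -(eqp_ltrans ud) eqp_sym.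
  rewrite (eqp_dvdr _ E).
  have -> : (x * u + y * n) ^+ 2 = x ^+ 2 * u ^+ 2 + n * (x * u * y + x * u * y + y ^+ 2 * n) by ring.
  by apply: dvdp_add; [apply: dvdp_mull; exact: dvdp_gcdr | apply: dvdp_mulr; exact: dvdp_gcdl].
by apply: dvdp_trans (dvdp_gcdr _ _) _; apply: dvdp_exp2r.
Qed.

(** The three terms of [local_order] come from the squared gcd, from the width of the cusp and from
    the division by |dd i|; for i, j <= r its natural subtractions are exact. *)
Lemma order_dd r i j (g : 'M[{poly Fq}]_2) : (forall t, (i t <= r t)%N) -> (forall t, (j t <= r t)%N) ->
  gcdp (g 1 0) (dd r) %= dd j ->
  (\prod_(t < s) anorm (p t) ^ local_order (r t) (i t) (j t) * anorm (dd i) =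
   anorm (gcdp (dd i) (g 1%R 0%R)) ^ 2 * anorm (stab_gen (dd r) g))%N.
Proof.
move=> hi hj hg; set u := g 1 0 in hg *.
have n0 := dd_neq0 r.
have e1 : gcdp (dd i) u %= dd (fun t => minn (i t) (j t)).
  rewrite -(eqp_rtrans (dd_gcd i j)).
  have di : dd i %| dd r by apply/dd_dvdP.
  apply/andP; split; rewrite dvdp_gcd dvdp_gcdl /=.
    rewrite -(eqp_dvdr _ hg) dvdp_gcd dvdp_gcdr /=; apply: dvdp_trans di; exact: dvdp_gcdl.
  apply: dvdp_trans (dvdp_gcdr _ _) _; by rewrite -(eqp_dvdl _ hg) dvdp_gcdl.
have e2 : gcdp (dd r) (u ^+ 2) %= dd (fun t => minn (r t) (2 * j t)).
  rewrite (eqp_ltrans (gcdp_sqr n0 hg)) expr2 ddD.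
  rewrite (@dd_ext (fun t => j t + j t)%N (fun t => 2 * j t)%N); last by move=> t; rewrite mul2n addnn.
  exact: dd_gcd.
have e3 : (anorm (stab_gen (dd r) g) * anorm (dd (fun t => minn (r t) (2 * j t))) = anorm (dd r))%N.
  rewrite -(anorm_eqp e2) -anormM ?divpK ?dvdp_gcdl //; first exact: stab_gen_neq0.
  by rewrite gcdp_eq0 negb_and n0.
have e4 : anorm (stab_gen (dd r) g) = (\prod_(t < s) anorm (p t) ^ (r t - minn (r t) (2 * j t)))%N.
  have h0 := anorm_gt0 (dd (fun t => minn (r t) (2 * j t))).
  apply/eqP; rewrite -(eqn_pmul2r h0) e3 !anorm_dd -big_split /=; apply/eqP.
  by apply: eq_bigr => t _; rewrite -expnD subnK // geq_minl.
rewrite (anorm_eqp e1) e4 !anorm_dd -mulnn -!big_split /=.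
apply: eq_bigr => t _; rewrite -!expnD; congr (_ ^ _)%N; rewrite /local_order.
by have := hi t; have := hj t; lia.
Qed.

End Exponents.

(** * Modular units *)

Section Units.
Variables (Fq : finFieldType) (R : realType) (C : Cinfty Fq R).
Local Notation v := (@Cabs Fq R C).
Local Notation q := #|Fq|.
Implicit Types (n d : {poly Fq}) (g : 'M[{poly Fq}]_2) (z : C) (f : C -> option C).

Lemma prod_expz_sum (s : seq {poly Fq}) (rho : {poly Fq} -> int) (x : C) : x != 0 ->
  \prod_(d <- s) x ^ rho d = x ^ (\sum_(d <- s) rho d).
Proof.
by move=> x0; elim: s => [|d s IH]; rewrite ?big_nil ?expr0z // !big_cons IH expfzDr.
Qed.

(** Conjugation by diag(d, 1) keeps [Gamma0 n] inside GL_2(A) because d divides the lower left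
    entry; it preserves the determinant and the automorphy factor. *)
Lemma moore_Gamma0 n d g z : n != 0 -> d %| n -> Gamma0 n g -> Omega z ->
  moore (iA C d * mobius g z) = iA C (\det g) / autj g z ^+ q.+1 * moore (iA C d * z).
Proof.
move=> n0 dn /andP[gu gn] hz.
have d0 : d != 0 by apply: contraTneq dn => ->; rewrite dvd0p.
have [k Ek] := dvdpP _ _ (dvdp_trans dn gn).
have D0 : iA C d != 0 by rewrite iA_eq0.
pose h := mx2 (g 0 0) (g 0 1 * d) k (g 1 1).
have dh : \det h = \det g by rewrite det_mx2 det2E Ek; ring.
have hu : h \in unitmx by rewrite unitmxE dh -unitmxE.
have jh : autj h (iA C d * z) = autj g z.
  by rewrite /autj !mx2E Ek rmorphM; ring.
have -> : iA C d * mobius g z = mobius h (iA C d * z).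
  rewrite /mobius -/(autj g z) -/(autj h (iA C d * z)) jh !mx2E rmorphM mulrA.
  by congr (_ / _); ring.
by rewrite moore_mobius ?dh ?jh //; apply: Omega_scale.
Qed.

Definition eta_quotient (s : seq {poly Fq}) (rho : {poly Fq} -> int) z : C :=
  \prod_(d <- s) (moore (iA C d * z))^-1 ^ rho d.

Lemma tord_prod n g (s : seq {poly Fq}) (psi : {poly Fq} -> C -> C) (m : {poly Fq} -> int) :
  n != 0 -> g \in unitmx -> (forall d, d \in s -> tord n g (psi d) (m d)) ->
  tord n g (fun z => \prod_(d <- s) psi d z) (\sum_(d <- s) m d).
Proof.
move=> n0 gu; elim: s => [|d s IH] h.
  exists (fun=> 1), 1; split=> //; first by apply: unit_germ_cst; exact: oner_neq0.
  by move=> z _; rewrite !big_nil expr0z mul1r.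
have h1 : tord n g (psi d) (m d) by apply: h; rewrite inE eqxx.
have h2 : tord n g (fun z => \prod_(d <- s) psi d z) (\sum_(d <- s) m d).
  by apply: IH => d' ds; apply: h; rewrite inE ds orbT.
rewrite big_cons; have := tordM n0 gu h1 h2; congr tord.
by apply/funext => z; rewrite big_cons.
Qed.

Section EtaQuotient.
Variables (n : {poly Fq}) (s : seq {poly Fq}) (rho : {poly Fq} -> int).
Hypotheses (n0 : n != 0) (hs : forall d, d \in s -> d %| n).
Hypothesis (rho0 : \sum_(d <- s) rho d = 0).
Local Notation f := (fun z : C => Some (eta_quotient s rho z)).

Lemma eta_quotient_gord g (kap : {poly Fq} -> nat) : g \in unitmx ->
  (forall d, d \in s ->
    (kap d * anorm d = anorm (gcdp d (g 1%R 0%R)) ^ 2 * anorm (stab_gen n g))%N) ->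
  exists2 c, c != 0 & gord n g f (\sum_(d <- s) (kap d)%:Z * rho d) c.
Proof.
move=> gu hk.
(* The automorphy factor is removed from each function separately; the total power removed is 1
   because the exponents sum to 0. *)
pose psi d z := ((moore (iA C d * mobius g z))^-1 / autj g z ^+ q.+1) ^ rho d.
have hpsi d : d \in s -> tord n g (psi d) ((kap d)%:Z * rho d).
  move=> ds; apply: tordXz; have [k [F [r [Ek hF r0 h]]]] := moore_cusp C n0 (hs ds) gu.
  have Ekk : k = kap d by apply/eqP; rewrite -(eqn_pmul2r (anorm_gt0 d)) Ek hk.
  exists F, r; split=> // z hz; rewrite h // -Ekk mulrAC mulfV ?mul1r //.
  by rewrite expf_neq0 // autj_neq0 //; apply: imag_ge_Omega hz.
apply: tord_gord (tord_prod n0 gu hpsi); exists 1 => // z hz; congr Some.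
have hO := imag_ge_Omega ltr01 hz.
have j0 : autj g z ^+ q.+1 != 0 by rewrite expf_neq0 // autj_neq0.
transitivity (eta_quotient s rho (mobius g z) *
  \prod_(d <- s) (autj g z ^+ q.+1)^-1 ^ rho d).
  by rewrite (prod_expz_sum _ _ (invr_neq0 j0)) rho0 expr0z mulr1.
by rewrite /eta_quotient -big_split; apply: eq_bigr => d _; rewrite /psi expfzMl.
Qed.

Lemma eta_quotient_unit : modular_unit n f.
Proof.
have uq : unit_quotient (fun z : C => eta_quotient s rho z).
  rewrite /eta_quotient.
  (* [unit_quotient_prod] quantifies over every index, including d = 0, where the Moore function is
     of no use; hence the value 1 outside [s]. *)
  have uqd d : unit_quotient (fun z : C => if d \in s then (moore (iA C d * z))^-1 ^ rho d else 1).
    have [ds|_] := boolP (d \in s); last exact: unit_quotient1.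
    have d0 : d != 0 by apply: contraTneq (hs ds) => ->; rewrite dvd0p.
    exact: (unit_quotientXz (rho d) (unit_quotientV (unit_quotient_moore C d0))).
  have := unit_quotient_prod s uqd; congr unit_quotient; apply/funext => z.
  by rewrite big_seq [RHS]big_seq; apply: eq_bigr => d ->.
split.
  split; first exact: unit_quotient_mero.
    move=> g z gG hz; congr Some; rewrite /eta_quotient.
    have gu := Gamma0_unit gG.
    have j0 : (iA C (\det g) / autj g z ^+ q.+1)^-1 != 0.
      rewrite invr_eq0 mulf_neq0 ?iA_eq0 ?detg_neq0 // invr_eq0 expf_neq0 //.
      exact: autj_neq0.
    rewrite (_ : \prod_(d <- s) (moore (iA C d * mobius g z))^-1 ^ rho d =
      \prod_(d <- s) (((iA C (\det g) / autj g z ^+ q.+1)^-1) ^ rho d *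
                      (moore (iA C d * z))^-1 ^ rho d)).
      by rewrite big_split /= prod_expz_sum // rho0 expr0z mul1r.
    rewrite big_seq [RHS]big_seq; apply: eq_bigr => d ds.
    by rewrite (moore_Gamma0 n0 (hs ds) gG hz) [in LHS]invfM expfzMl.
  move=> c _ g [gu _].
  have hk d : d \in s -> exists k : nat,
      (k * anorm d = anorm (gcdp d (g 1%R 0%R)) ^ 2 * anorm (stab_gen n g))%N.
    by move=> ds; have [k [F [r [Ek _ _ _]]]] := moore_cusp C n0 (hs ds) gu; exists k.
  have [kap hkap] : exists kap : {poly Fq} -> nat, forall d, d \in s ->
      (kap d * anorm d = anorm (gcdp d (g 1%R 0%R)) ^ 2 * anorm (stab_gen n g))%N.
    have hk' d : exists k : nat, d \in s ->
        (k * anorm d = anorm (gcdp d (g 1%R 0%R)) ^ 2 * anorm (stab_gen n g))%N.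
      have [/hk[k Ek]|nd] := boolP (d \in s); first by exists k.
      by exists 0%N.
    by have [kap hkap] := choice hk'; exists kap.
  have [c0 _ hg] := eta_quotient_gord gu hkap.
  have [a _ ha] := gord_t_expansion n0 gu hg.
  by exists (\sum_(d <- s) (kap d)%:Z * rho d), a.
move=> z hz; split=> // -[E].
have [h [k [_ /(_ z hz)[h0 k0 E']]]] := uq.
by have := mulf_neq0 h0 (invr_neq0 k0); rewrite -E' E eqxx.
Qed.

End EtaQuotient.

Lemma modular_unit_omul n f1 f2 : n != 0 ->
  modular_unit n f1 -> modular_unit n f2 -> modular_unit n (omul f1 f2).
Proof.
move=> n0 [[m1 i1 c1] u1] [[m2 i2 c2] u2]; split.
  split; first exact: mero_omul.
    by move=> g z gG hz; rewrite /omul i1 // i2.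
  move=> c hc g hg; have [gu _] := hg.
  have [k1 [a1 e1]] := c1 c hc g hg; have [k2 [a2 e2]] := c2 c hc g hg.
  have := gordM n0 gu (t_expansion_gord n0 gu e1) (t_expansion_gord n0 gu e2).
  by move=> /(gord_t_expansion n0 gu)[a _ ha]; exists (k1 + k2), a.
move=> z hz; have [] := u1 z hz; have [] := u2 z hz; rewrite /omul.
case: (f1 z) => // x; case: (f2 z) => // y _ y0 _ x0; split=> // -[/eqP].
rewrite mulf_eq0 => /orP[/eqP E|/eqP E]; [by apply: x0; rewrite E | by apply: y0; rewrite E].
Qed.

(** Natural powers are enough: where an inverse would be wanted, the divisor is negated before its
    unit is chosen. *)
Fixpoint opow f (k : nat) : C -> option C :=
  if k is k'.+1 then omul f (opow f k') else fun=> Some 1.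

Lemma gord_opow n g f m c k : n != 0 -> g \in unitmx ->
  gord n g f m c -> gord n g (opow f k) (m * k%:Z) (c ^+ k).
Proof.
move=> n0 gu h; elim: k => [|k IH] /=.
  rewrite mulr0 expr0; exists (fun=> 1), 1; split=> //.
    by exists 1, (v 1); split=> //; apply: power_series_cst.
  by move=> z _; rewrite expr0z mul1r.
have := gordM n0 gu h IH; rewrite exprS; congr gord.
by rewrite -addn1 PoszD mulrDr mulr1 addrC.
Qed.

Lemma modular_unit_opow n f k : n != 0 -> modular_unit n f -> modular_unit n (opow f k).
Proof.
move=> n0 hf; elim: k => [|k IH] /=; last exact: modular_unit_omul.
have := @eta_quotient_unit n [::] (fun=> 0) n0 (fun d => _) (big_nil _ _ _ _).
rewrite (_ : (fun z : C => Some (eta_quotient [::] (fun=> 0) z)) = (fun=> Some 1)).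
  by apply.
by apply/funext => z; rewrite /eta_quotient big_nil.
Qed.

(** The order is required at every matrix sending oo to the cusp, whereas [cusp_order] provides a
    single matrix that cannot be prescribed. *)
Definition strong_divisor n f (D : cuspdiv Fq) : Prop := modular_unit n f /\
  forall c, cusps n c -> forall g, maps_oo_to g c ->
    exists2 a, a != 0 & gord n g f (D c * (cusp_weight n g)%:Z) a.

Lemma cusp_has_matrix n c : n \is monic -> cusps n c -> exists g, maps_oo_to (Fq := Fq) g c.
Proof.
move=> nm hc; have [d [dm dn [a [am ca ha]]]] := cusp_height nm hc.
have [x [y xy]] := Bezout1 (coprimep_divisor dn ca).
exists (mx2 a (- y) d x); split; last by rewrite !mx2E.
by apply: mx2_unit; rewrite mulNr opprK -xy; ring.
Qed.

Lemma strong_unit_divisor n f D : n \is monic -> (forall c, ~ cusps n c -> D c = 0) ->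
  strong_divisor n f D -> unit_divisor n f D.
Proof.
move=> nm D0 [_ h] c; case: asboolP => hc; last exact: D0.
have n0 := monic_neq0 nm; have [g hg] := cusp_has_matrix nm hc; have [gu _] := hg.
have [a a0 ha] := h c hc g hg; have [b b0 hb] := gord_t_expansion n0 gu ha.
by exists g, b; rewrite b0.
Qed.

(** The expansion of f1 is taken at the matrix that comes with f2, so both use the same parameter
    and their orders add. *)
Lemma unit_divisor_combine n f1 f2 D1 D2 k : n \is monic -> (forall c, ~ cusps n c -> D1 c = 0) ->
  strong_divisor n f1 D1 -> modular_unit n f2 -> unit_divisor n f2 D2 ->
  unit_divisors C n (fun c => D1 c + D2 c * k%:Z).
Proof.
move=> nm D10 [u1 h1] u2 h2; have n0 := monic_neq0 nm.
exists (omul f1 (opow f2 k)); first by apply: modular_unit_omul => //; apply: modular_unit_opow.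
move=> c; have := h2 c; case: asboolP => hc; last by rewrite D10 // => ->; rewrite mul0r.
move=> [g [a [hg a0 ha]]]; have [gu _] := hg.
have [b b0 hb] := h1 c hc g hg.
have := gordM n0 gu hb (gord_opow k n0 gu (t_expansion_gord n0 gu ha)).
move=> /(gord_t_expansion n0 gu)[a' Ea' ha']; exists g, a'; split=> //.
  by rewrite Ea' mulf_neq0 // expf_neq0.
by move: ha'; congr t_expansion; ring.
Qed.

End Units.

(** * Units with prescribed divisors, and the exponent *)

Section Main.
Variables (Fq : finFieldType) (R : realType) (C : Cinfty Fq R).
Variables (s : nat) (p : 'I_s -> {poly Fq}) (r : 'I_s -> nat).
Hypotheses (p_monic : forall i, p i \is monic).
Hypotheses (p_irr : forall i, irreducible_poly (p i)).
Hypotheses (p_inj : injective p) (r_gt0 : forall i, (1 <= r i)%N).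
Local Notation n := (dd p r).
Local Notation x i := ((anorm (p i))%:Z).
Local Notation M := (\max_(i < s) r i)%N.
(** Exponent vectors with one common range for all coordinates; [ok] imposes the individual bounds
    [r i], the form in which sums of products distribute. *)
Local Notation E := {ffun 'I_s -> 'I_M.+1}.
Local Notation ok := (family (fun (i : 'I_s) (j : 'I_M.+1) => (j <= r i)%N)).
Local Notation N := (\prod_(i < s) ((anorm (p i) ^ 2 - 1) * anorm (p i) ^ (r i).-1))%N.

Lemma okP (k : E) : reflect (forall i, (k i <= r i)%N) (k \in ok).
Proof. by apply: (iffP familyP) => h i; exact: h. Qed.

Lemma divs_perm : perm_eq (divs n) [seq dd p (fun i => k i) | k : E <- enum ok].
Proof.
have n0 := dd_neq0 p_monic r.
apply: uniq_perm; first exact: divs_uniq.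
  rewrite map_inj_in_uniq ?enum_uniq // => k l _ _ Ekl; apply/ffunP => i.
  by apply: val_inj; apply: (dd_inj p_monic p_irr p_inj Ekl i).
move=> d; rewrite mem_divs //; apply/andP/mapP => [[dm dn]|[k kok ->]].
  have [l hl ->] := dd_divisor p_monic p_irr p_inj dm dn.
  have lM i : (l i < M.+1)%N by rewrite ltnS (leq_trans (hl i)) // leq_bigmax.
  exists [ffun i => Ordinal (lM i)].
    by rewrite mem_enum; apply/okP => i; rewrite ffunE; exact: hl.
  by apply: dd_ext => i; rewrite ffunE.
split; first exact: dd_monic.
by apply/(dd_dvdP p_monic p_irr p_inj)/okP; rewrite -mem_enum.
Qed.

Definition mu_vec (k i : E) : int := \prod_(t < s) mu (x t) (r t) (k t) (i t).

Lemma sum_ok (F : 'I_s -> nat -> int) :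
  \sum_(i in ok) \prod_(t < s) F t (i t) = \prod_(t < s) \sum_(j < (r t).+1) F t j.
Proof.
rewrite -(bigA_distr_big_dep (fun (t : 'I_s) (j : 'I_M.+1) => (j <= r t)%N) (fun t j => F t j)).
apply: eq_bigr => t _; rewrite (big_ord_widen_cond M.+1 xpredT (F t)) ?ltnS ?leq_bigmax //.
Qed.

(** The order matrix is a tensor product, so the sum factors into the local ones, and one coordinate
    where j and k differ makes it vanish. *)
Lemma mu_vec_inverse (j k : E) : j \in ok -> k \in ok ->
  \sum_(i in ok) (\prod_(t < s) anorm (p t) ^ local_order (r t) (i t) (j t))%N%:Z * mu_vec k i =
  if j == k then N%:Z else 0.
Proof.
move=> /okP hj /okP hk.
transitivity (\sum_(i in ok) \prod_(t < s)
    (x t ^+ local_order (r t) (i t) (j t) * mu (x t) (r t) (k t) (i t))).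
  apply: eq_bigr => i _; rewrite /mu_vec -natz natr_prod -big_split /=.
  by apply: eq_bigr => t _; rewrite natrX natz.
rewrite (sum_ok (fun t i => x t ^+ local_order (r t) i (j t) * mu (x t) (r t) (k t) i)).
under eq_bigr => t _ do rewrite (local_inverse _ (r_gt0 t) (hj t) (hk t)).
case: eqP => [->|jk].
  rewrite -natz natr_prod; apply: eq_bigr => t _; rewrite eqxx natrM.
  have a1 : (1 <= anorm (p t) ^ 2)%N by rewrite expn_gt0 anorm_gt0.
  by move: (anorm (p t)) a1 => y a1; rewrite (natrB _ a1) !natrX !natz.
have /existsP[t ht] : [exists t, j t != k t].
  rewrite -negb_forall; apply/negP => /forallP h; apply: jk; apply/ffunP => t.
  exact/eqP/h.
rewrite (bigD1 t) //= (_ : (j t == k t :> nat) = false) ?mul0r //.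
by apply/negbTE; move: ht; rewrite -val_eqE.
Qed.

Lemma mu_vec_sum (k : E) : k \in ok ->
  \sum_(i in ok) mu_vec k i =
  \prod_(t < s) (x t - 1) * (phi (cusp_modulus n (dd p (fun t => k t))))%:Z.
Proof.
move=> /okP hk; rewrite (sum_ok (fun t i => mu (x t) (r t) (k t) i)).
under eq_bigr => t _ do rewrite (local_sum _ (r_gt0 t) (hk t)).
rewrite big_split /=; congr (_ * _).
by rewrite (phi_eqp (cusp_modulus_dd p_monic p_irr p_inj hk)) phi_dd.
Qed.

Lemma height_divisor_unit al : cuspdeg n (height_divisor n al) = 0 ->
  exists f : C -> option C, strong_divisor n f (fun c => height_divisor n al c * N%:Z).
Proof.
move=> hdeg; have nm : n \is monic := dd_monic p_monic r; have n0 := monic_neq0 nm.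
pose D (k : E) := dd p (fun i => k i).
have Dinj : injective D.
  by move=> k l Ekl; apply/ffunP => i; apply: val_inj; apply: (dd_inj p_monic p_irr p_inj Ekl i).
(* In the parameter t the wanted order at height [D k] is [al (D k)] times the weight of the cusp;
   applying the scaled inverse matrix to these orders gives the exponents. *)
pose co (i : E) : int := \sum_(k in ok) al (D k) * (wt n (D k))%:Z * mu_vec k i.
pose rho d : int := \sum_(i in ok | D i == d) co i.
have rhoD i : i \in ok -> rho (D i) = co i.
  move=> iok; rewrite /rho (big_pred1 i) // => k /=; rewrite (inj_eq Dinj).
  by case: eqP => [->|]; rewrite ?iok ?andbF.
have sumE (F : {poly Fq} -> int) : \sum_(d <- divs n) F d = \sum_(i in ok) F (D i).
  by rewrite (perm_big _ divs_perm) big_map big_enum.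
have rho0 : \sum_(d <- divs n) rho d = 0.
  rewrite sumE (eq_bigr co); last by move=> i; apply: rhoD.
  rewrite /co exchange_big /=.
  transitivity (\sum_(k in ok) \prod_(t < s) (x t - 1) *
     ((wt n (D k) * phi (cusp_modulus n (D k)))%:Z * al (D k))).
    by apply: eq_bigr => k kok; rewrite -mulr_sumr mu_vec_sum // PoszM /D; ring.
  rewrite -mulr_sumr -(sumE (fun d => (wt n d * phi (cusp_modulus n d))%:Z * al d)).
  by rewrite ((degree_relation al nm).2 hdeg) mulr0.
have hs d : d \in divs n -> d %| n by rewrite mem_divs // => /andP[].
exists (fun z => Some (eta_quotient (divs n) rho z)); split.
  exact: eta_quotient_unit.
move=> c hc g hg; have [gu _] := hg.
have [d [dm dn hd]] := cusp_height nm hc.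
have := mem_divs d n0; rewrite dm dn (perm_mem divs_perm) => /mapP[j]; rewrite mem_enum => jok Ed.
have gd := maps_oo_height hc dn hd hg.
have Dval := height_divisorE al nm hc dm dn hd.
have hj := elimT (okP j) jok.
(* The division is exact for the divisors of n, by [order_dd]. *)
pose kap d' : nat := (anorm (gcdp d' (g 1%R 0%R)) ^ 2 * anorm (stab_gen n g) %/ anorm d')%N.
have kapD i : i \in ok -> kap (D i) = (\prod_(t < s) anorm (p t) ^ local_order (r t) (i t) (j t))%N.
  move=> /okP hi; rewrite /kap -(order_dd p_monic p_irr p_inj hi hj).
    by rewrite mulnK ?anorm_gt0.
  by rewrite -Ed.
have hkap d' : d' \in divs n -> (kap d' * anorm d' =
    anorm (gcdp d' (g 1%R 0%R)) ^ 2 * anorm (stab_gen n g))%N.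
  rewrite (perm_mem divs_perm) => /mapP[i]; rewrite mem_enum => iok ->.
  rewrite kapD //; apply: (order_dd p_monic p_irr p_inj (elimT (okP i) iok) hj).
  by rewrite -Ed.
have [a a0 ha] := eta_quotient_gord C n0 hs rho0 gu hkap.
exists a => //; move: ha; congr gord.
rewrite sumE Dval (cusp_weightE n0 dn gu gd) -/(wt n d).
transitivity (\sum_(i in ok) \sum_(k in ok) al (D k) * (wt n (D k))%:Z *
   ((\prod_(t < s) anorm (p t) ^ local_order (r t) (i t) (j t))%N%:Z * mu_vec k i)).
  apply: eq_bigr => i iok; rewrite rhoD // kapD // /co mulr_sumr.
  by apply: eq_bigr => k _; ring.
rewrite exchange_big /=.
transitivity (\sum_(k in ok) al (D k) * (wt n (D k))%:Z * (if j == k then N%:Z else 0)).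
  by apply: eq_bigr => k kok; rewrite -mulr_sumr mu_vec_inverse.
rewrite (bigD1 j) //= eqxx [X in _ + X]big1; last first.
  by move=> k /andP[_ kj]; rewrite eq_sym (negbTE kj) mulr0.
have -> : d = D j := Ed.
by rewrite addr0; ring.
Qed.

Lemma Div0_scale D (k : int) : Div0cuspK n D -> Div0cuspK n (fun c => D c * k).
Proof.
have nm : n \is monic := dd_monic p_monic r; have n0 := monic_neq0 nm.
move=> [[al ED] hdeg]; split.
  exists (fun d => al d * k); apply/funext => c; rewrite ED.
  rewrite monic_divisorsE // -!fsbig_seq ?divs_uniq // mulr_suml.
  by apply: eq_bigr => d _; ring.
have [[cs ucs Ecs] _] := degree_relation al nm.
move: hdeg; rewrite /cuspdeg Ecs -!fsbig_seq // => hdeg.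
by rewrite -mulr_suml hdeg mul0r.
Qed.

Lemma theorem_dd : exists2 e : nat, class_group_exponent C n e & (e %| N)%N.
Proof.
have nm : n \is monic := dd_monic p_monic r; have n0 := monic_neq0 nm.
have N0 : (0 < N)%N.
  rewrite prodn_gt0 // => i; rewrite muln_gt0 expn_gt0 anorm_gt0 andbT subn_gt0.
  by rewrite -{1}(expn0 (anorm (p i))) ltn_exp2l ?anorm_p_gt1.
pose P (m : nat) := forall D, Div0cuspK n D -> (Div0cuspK n `&` unit_divisors C n) (D *+ m).
have scaleE (D : cuspdiv Fq) (m : nat) : D *+ m = (fun c => D c * m%:Z).
  by rewrite natmulfctE; apply/funext => c; rewrite -mulr_natr natz.
have str D : Div0cuspK n D -> exists f : C -> option C, strong_divisor n f (fun c => D c * N%:Z).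
  by move=> [[al ->] hdeg]; apply: height_divisor_unit hdeg.
have D0 D c : Div0cuspK n D -> ~ cusps n c -> D c = 0.
  by move=> [[al ->] _] hc; apply: (height_divisor0 al n0 hc).
have PN : P N.
  move=> D hD; rewrite scaleE; split; first exact: Div0_scale.
  have [f hf] := str D hD; exists f; first by case: hf.
  by apply: strong_unit_divisor hf => // c hc; rewrite (D0 D) ?mul0r.
have exP : exists m, (0 < m)%N && `[< P m >] by exists N; rewrite N0; apply/asboolP.
have [e /andP[e0 /asboolP Pe] emin] := ex_minnP exP.
exists e.
  split=> // m m0 Pm; apply: emin; rewrite m0; exact/asboolP.
(* A nonzero remainder would contradict the minimality of [e]: (N mod e) D is N D, the divisor of a
   constructed unit, plus N div e times the divisor e (- D) of some unit. *)
rewrite /dvdn; apply: contraT; rewrite -lt0n => r0.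
have : P (N %% e)%N.
  move=> D hD; rewrite scaleE; split; first exact: Div0_scale.
  have hD' := Div0_scale (-1) hD.
  have [f1 hf1] := str D hD.
  have [_ [f2 u2 hf2]] := Pe _ hD'; rewrite scaleE in hf2.
  have D10 c : ~ cusps n c -> D c * N%:Z = 0 by move=> hc; rewrite (D0 D) ?mul0r.
  have := unit_divisor_combine (N %/ e)%N nm D10 hf1 u2 hf2.
  congr unit_divisors; apply/funext => c /=.
  by rewrite {1}(divn_eq N e) PoszD PoszM; ring.
move=> /asboolP Pr; have := emin (N %% e)%N; rewrite r0 Pr => /(_ isT).
by rewrite leqNgt ltn_mod e0.
Qed.

End Main.

Theorem theorem1p9 (Fq : finFieldType) (R : realType) (C : Cinfty Fq R)
    (s : nat) (p : 'I_s -> {poly Fq}) (r : 'I_s -> nat) (n : {poly Fq})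
    (hs : (1 <= s)%N)
    (p_monic : forall i, p i \is monic)
    (p_irr : forall i, irreducible_poly (p i))
    (p_inj : injective p)
    (r_gt0 : forall i, (1 <= r i)%N)
    (hn : n = \prod_(i < s) p i ^+ r i) :
  exists2 e : nat, class_group_exponent C n e &
    (e %| \prod_(i < s) ((anorm (p i) ^ 2 - 1) * anorm (p i) ^ (r i).-1))%N.
Proof. by rewrite hn; apply: theorem_dd. Qed.
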